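(* Let $S$ be a discrete valuation ring, $G$ a finite subgroup of $\mathrm{Aut}(S)$, $R=S^G$, and assume that the residue field extension $\bar S/\bar R$ is separable. Let $f\in Z^2(G,S^* )$ and let $T=S^f*G$ be a hereditary crossed product. Then the number of simple components of $T/M_ST=\bar S^{\bar f}*G$ is equal to the index of $\pi_{\bar f}(G/\Gamma_f)$ in $\mathrm{Hom}(\Gamma_f,\bar S^* )$. In particular, $\bar S^{\bar f}*G$ is simple if and only if $|\pi_{\bar f}(G/\Gamma_f)|=|\mathrm{Hom}(\Gamma_f,\bar S^* )|=d$, where $d=|\Gamma_f|$.
   Context: $M_S$ is the maximal ideal of $S$, $\bar S=S/M_S$, and $\bar R=R/(M_S\cap R)$. For $f\in Z^2(G,S^* )$, the crossed product $S^f*G=\bigoplus_{g\in G}SU_g$ is the free left $S$-module on symbols $U_g$ with multiplication $sU_g\,tU_h=s\,g(t)f(g,h)U_{gh}$ for $s,t\in S$, $g,h\in G$. Let $\bar f\in Z^2(G,\bar S^* )$ be the image of $f$; $T/M_ST\cong\bar S^{\bar f}*G$ is the crossed product over $\bar S$ defined by the same formula, and it is semisimple when $T$ is hereditary. The inertia subgroup $G_I\lhd G$ is the kernel of the induced action of $G$ on $\bar S$. $\Gamma_f$ denotes the maximal subgroup of $G_I$ such that the restriction of $\bar f$ to it is cohomologically trivial; when $T$ is hereditary, $\Gamma_f$ is unique, cyclic, and normal in $G$, of order prime to $\mathrm{char}(\bar S)$. Since $[\bar f]$ restricts trivially to $\Gamma_f$, one may and does replace $\bar f$ by a (normalized) cohomologous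 2-cocycle, still denoted $\bar f$, satisfying $\bar f(g_1,g_2)=\bar f(g_1,g_2a)$ for all $g_1,g_2\in G$, $a\in\Gamma_f$. Then $\pi_{\bar f}:G/\Gamma_f\to\mathrm{Hom}(\Gamma_f,\bar S^* )$ is the map sending $\bar g=g\Gamma_f$ to the homomorphism $a\mapsto\bar f(a,g)$, which does not depend on the choice of the representative $g$ of $\bar g$. It is a 1-cocycle for the diagonal action of $G/\Gamma_f$ on $\mathrm{Hom}(\Gamma_f,\bar S^* )$; this action is trivial here, so $\pi_{\bar f}$ is a group homomorphism. *)

(* Defs.v *)
From HB Require Import structures.
From mathcomp Require Import all_boot all_order all_algebra all_fingroup.
From mathcomp Require Import generic_quotient ring_quotient separable.
From mathcomp Require Import boolp classical_sets functions cardinality.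

Set Implicit Arguments.
Unset Strict Implicit.
Unset Printing Implicit Defensive.

Import GRing.Theory.
Local Open Scope quotient_scope.
Local Open Scope classical_set_scope.
Local Open Scope ring_scope.

Definition two_sided_ideal (A : nzRingType) (I : set A) : Prop :=
  [/\ I 0,
      forall x y, I x -> I y -> I (x + y),
      forall a x, I x -> I (a * x)
    & forall a x, I x -> I (x * a)].

Definition simple_ring (A : nzRingType) : Prop :=
  forall I : set A, two_sided_ideal I -> I = [set 0] \/ I = setT.

Definition minimal_two_sided_ideal (A : nzRingType) (I : set A) : Prop :=
  [/\ two_sided_ideal I, I <> [set 0]
    & forall J : set A, two_sided_ideal J -> J `<=` I -> J = [set 0] \/ J = I].

(* [A] is the direct sum of exactly [n] minimal two-sided ideals: these are the
   simple components of [A].  (As [A] has a unit, any such decomposition lists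
   all the minimal two-sided ideals of [A], so [n] is determined by [A].) *)
Definition has_simple_components (A : nzRingType) (n : nat) : Prop :=
  exists B : 'I_n -> set A,
    (forall i, minimal_two_sided_ideal (B i)) /\
    (forall a : A, exists! b : {ffun 'I_n -> A},
       (forall i, B i (b i)) /\ a = \sum_i b i).

Definition projective (A : nzRingType) (P : lmodType A) : Prop :=
  forall (M N : lmodType A) (p : {linear M -> N}) (h : {linear P -> N}),
    (forall y, exists x, p x = y) ->
    exists h' : {linear P -> M}, forall x, p (h' x) = h x.

(* Every left ideal is projective.  A left ideal is given as a left module [I]
   together with an embedding into the regular left module [A^o]. *)
Definition left_hereditary (A : nzRingType) : Prop :=
  forall (I : lmodType A) (i : {linear I -> A^o}), injective i -> projective I.

(* Right [A]-modules are left modules over the converse ring [A^c]. *)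
Definition hereditary (A : nzRingType) : Prop :=
  left_hereditary A /\ left_hereditary A^c.

(* A discrete valuation ring is a local principal ideal domain which is not a
   field; in a commutative ring, being local means that the sum of two
   non-units is a non-unit. *)
HB.mixin Record isDVR S of GRing.IntegralDomain S := {
  dvr_local : forall x y : S,
    x \isn't a GRing.unit -> y \isn't a GRing.unit ->
    x + y \isn't a GRing.unit;
  dvr_principal : forall I : set S, two_sided_ideal I ->
    exists a : S, I = [set b * a | b in setT];
  dvr_not_field : exists x : S, x != 0 /\ x \isn't a GRing.unit
}.

#[short(type="dvrType")]
HB.structure Definition DVR := {S of isDVR S & GRing.IntegralDomain S}.

Definition max_ideal (S : dvrType) : {pred S} :=
  fun x => x \isn't a GRing.unit.
Arguments max_ideal : clear implicits.

Section ResidueField.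
Variable S : dvrType.

Lemma max_idealE (x : S) : (x \in max_ideal S) = (x \isn't a GRing.unit).
Proof. by []. Qed.

Fact max_ideal_closed : idealr_closed (max_ideal S).
Proof.
have mulM (a u : S) : u \in max_ideal S -> a * u \in max_ideal S.
  by rewrite !max_idealE unitrM negb_and orbC => ->.
split=> [||a u v uM vM].
- by rewrite max_idealE unitr0.
- by rewrite max_idealE unitr1.
- by rewrite max_idealE dvr_local // -max_idealE mulM.
Qed.

HB.instance Definition _ := isIdealr.Build S (max_ideal S) max_ideal_closed.

Definition residue : Type := {ideal_quot (max_ideal S)}.
HB.instance Definition _ := GRing.ComNzRing.on residue.

Definition res (x : S) : residue := \pi_({ideal_quot (max_ideal S)}) x.

Fact res_is_zmod_morphism : zmod_morphism res.
Proof. exact: (rmorphB (\pi_({ideal_quot (max_ideal S)}))). Qed.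
Fact res_is_monoid_morphism : monoid_morphism res.
Proof.
split; [exact: (rmorph1 (\pi_({ideal_quot (max_ideal S)})))
       |exact: (rmorphM (\pi_({ideal_quot (max_ideal S)})))].
Qed.
HB.instance Definition _ :=
  GRing.isZmodMorphism.Build S residue res res_is_zmod_morphism.
HB.instance Definition _ :=
  GRing.isMonoidMorphism.Build S residue res res_is_monoid_morphism.

Definition lift_res (x : residue) : S := repr (x : {ideal_quot (max_ideal S)}).

Lemma lift_resK : cancel lift_res res.
Proof. by move=> x; rewrite /res /lift_res reprK. Qed.

Lemma res_eq (x y : S) : (res x == res y) = (x - y \isn't a GRing.unit).
Proof.
by rewrite -max_idealE; symmetry; exact: (Quotient.idealrBE (max_ideal S)).
Qed.

Lemma res_eq0 (x : S) : (res x == 0) = (x \isn't a GRing.unit).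
Proof. by rewrite -(rmorph0 res) res_eq subr0. Qed.

Definition residue_inv (x : residue) : residue :=
  if x == 0 then 0 else res (lift_res x)^-1.

Fact residue_mulVf (x : residue) : x != 0 -> residue_inv x * x = 1.
Proof.
move=> x0; rewrite /residue_inv (negbTE x0) -{2}(lift_resK x) -rmorphM /=.
by rewrite mulVr ?rmorph1 //; move: x0; rewrite -{1}(lift_resK x) res_eq0 negbK.
Qed.
Fact residue_inv0 : residue_inv 0 = 0.
Proof. by rewrite /residue_inv eqxx. Qed.

HB.instance Definition _ :=
  GRing.ComNzRing_isField.Build residue residue_mulVf residue_inv0.

End ResidueField.

Record ringAction (gT : finGroupType) (A : nzRingType) := RingAction {
  ract :> gT -> {rmorphism A -> A};
  ract1 : forall x, ract 1%g x = x;
  ractM : forall g h x, ract (g * h)%g x = ract g (ract h x)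
}.

(* A faithful action identifies [gT] with a finite subgroup of Aut(A). *)
Definition faithful_action (gT : finGroupType) (A : nzRingType)
    (act : ringAction gT A) : Prop :=
  forall g, (forall x, act g x = x) -> g = 1%g.

Definition action_kernel (gT : finGroupType) (A : nzRingType)
    (act : ringAction gT A) : set gT :=
  [set g | forall x, act g x = x].

Section Cocycles.
Variables (gT : finGroupType) (A : comUnitRingType) (act : ringAction gT A).

Record cocycle2 := Cocycle2 {
  cocycle_val :> gT -> gT -> A;
  cocycle_unit : forall g h, cocycle_val g h \is a GRing.unit;
  cocycleP : forall g h k,
    cocycle_val g h * cocycle_val (g * h)%g k =
    act g (cocycle_val h k) * cocycle_val g (h * k)%g
}.

Definition cohomologous (f f' : cocycle2) : Prop :=
  exists c : gT -> A, (forall g, c g \is a GRing.unit) /\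
    forall g h, f' g h = c g * act g (c h) / c (g * h)%g * f g h.

Definition normalized (f : cocycle2) : Prop :=
  forall g, f 1%g g = 1 /\ f g 1%g = 1.

Definition cohom_trivial_on (f : cocycle2) (H : {group gT}) : Prop :=
  exists c : gT -> A, (forall g, g \in H -> c g \is a GRing.unit) /\
    forall g h, g \in H -> h \in H -> f g h = c g * act g (c h) / c (g * h)%g.

Definition inertial_trivial (f : cocycle2) (H : {group gT}) : Prop :=
  [set` H] `<=` action_kernel act /\ cohom_trivial_on f H.

Definition maximal_inertial_trivial (f : cocycle2) (H : {group gT}) : Prop :=
  inertial_trivial f H /\
  forall K : {group gT}, inertial_trivial f K -> H \subset K -> K = H.

Lemma cocycle1l f k : cocycle_val f 1%g k = f 1%g 1%g.
Proof.
have := cocycleP f 1%g 1%g k; rewrite ract1 !mul1g => /eqP.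
by move/eqP/(mulIr (cocycle_unit f _ _)).
Qed.

Lemma cocycle1r f g : cocycle_val f g 1%g = act g (f 1%g 1%g).
Proof.
have := cocycleP f g 1%g 1%g; rewrite !mulg1.
by move/(mulIr (cocycle_unit f _ _)).
Qed.

End Cocycles.

Section CrossedProduct.
Variables (gT : finGroupType) (A : comUnitRingType) (act : ringAction gT A).
Variable f : cocycle2 act.

(* [x : crossed f] stands for the sum of the [x g] U_g, [g] in [gT]. *)
Definition crossed of cocycle2 act : Type := {ffun gT -> A}.
Local Notation T := (crossed f).

HB.instance Definition _ := GRing.Zmodule.copy T {ffun gT -> A}.

Definition crossed_term (s : A) (g : gT) : T :=
  [ffun k => if k == g then s else 0] : {ffun gT -> A}.

Definition crossed_one : T := crossed_term (f 1%g 1%g)^-1 1%g.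

Definition crossed_mul (x y : T) : T :=
  [ffun k => \sum_g x g * act g (y (g^-1 * k)%g) * f g (g^-1 * k)%g]
    : {ffun gT -> A}.

Lemma crossed_mul_term s g t h :
  crossed_mul (crossed_term s g) (crossed_term t h) =
  crossed_term (s * act g t * f g h) (g * h)%g.
Proof.
apply/ffunP=> k; rewrite !ffunE (bigD1 g) //= big1 => [|j jg]; last first.
  by rewrite !ffunE (negbTE jg) !mul0r.
rewrite addr0 !ffunE eqxx.
have -> : ((g^-1 * k)%g == h) = (k == (g * h)%g).
  by apply/eqP/eqP=> [<-|->]; rewrite ?mulKVg ?mulKg.
by case: eqP => [->|_]; rewrite ?mulKg // rmorph0 mulr0 mul0r.
Qed.

Fact crossed_mulA : associative crossed_mul.
Proof.
move=> x y z; apply/ffunP=> k; rewrite !ffunE.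
under [RHS]eq_bigr => g _ do rewrite ffunE -mulrA mulr_suml.
rewrite exchange_big /=; apply: eq_bigr => h _.
rewrite ffunE rmorph_sum /= mulr_sumr mulr_suml.
rewrite (reindex (fun g => h^-1 * g)%g) /=; last first.
  by exists (fun g => h * g)%g => g _; rewrite ?mulKg ?mulKVg.
apply: eq_bigr => g _.
have := cocycleP f h (h^-1 * g)%g (g^-1 * k)%g; rewrite mulKVg => cfP.
have e1 : (h^-1 * g * (g^-1 * k) = h^-1 * k)%g by rewrite !mulgA mulgK.
have e2 : ((h^-1 * g)^-1 * (h^-1 * k) = g^-1 * k)%g by rewrite invMg invgK mulgA mulgK.
rewrite e1 in cfP; rewrite e2 !rmorphM /= -ractM mulKVg.
transitivity (x h * act h (y (h^-1 * g)%g) * act g (z (g^-1 * k)%g)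
   * (act h (f (h^-1 * g)%g (g^-1 * k)%g) * f h (h^-1 * k)%g)).
  by rewrite !mulrA.
by rewrite -cfP -!mulrA; do 2!congr (_ * _); rewrite mulrCA.
Qed.

Fact crossed_mul1l : left_id crossed_one crossed_mul.
Proof.
move=> x; apply/ffunP=> k; rewrite ffunE (bigD1 1%g) //= big1 => [|g g1].
  rewrite ffunE eqxx addr0 invg1 mul1g ract1 cocycle1l mulrAC mulVr ?mul1r //.
  exact: cocycle_unit.
by rewrite ffunE (negbTE g1) !mul0r.
Qed.

Fact crossed_mul1r : right_id crossed_one crossed_mul.
Proof.
move=> x; apply/ffunP=> k; rewrite ffunE (bigD1 k) //= big1 => [|g gk].
  rewrite ffunE mulVg eqxx addr0 (cocycle1r f k).
  rewrite -mulrA -rmorphM mulVr ?rmorph1 ?mulr1 //.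
  exact: cocycle_unit.
rewrite ffunE; case: eqP => [gk1|_]; last by rewrite rmorph0 mulr0 mul0r.
by case/eqP: gk; rewrite -[k](mulKVg g) gk1 mulg1.
Qed.

Fact crossed_mulDl : left_distributive crossed_mul +%R.
Proof.
move=> x y z; apply/ffunP=> k; rewrite !ffunE -big_split /=.
by apply: eq_bigr => g _; rewrite ffunE !mulrDl.
Qed.

Fact crossed_mulDr : right_distributive crossed_mul +%R.
Proof.
move=> x y z; apply/ffunP=> k; rewrite !ffunE -big_split /=.
by apply: eq_bigr => g _; rewrite ffunE rmorphD mulrDr mulrDl.
Qed.

Fact crossed_one_neq0 : crossed_one != 0.
Proof.
apply/eqP=> /ffunP/(_ 1%g); rewrite !ffunE eqxx => /eqP.
by apply/negP; rewrite invr_eq0; apply: contraTneq (cocycle_unit f 1%g 1%g) => ->; rewrite unitr0.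
Qed.

HB.instance Definition _ := GRing.Zmodule_isNzRing.Build T
  crossed_mulA crossed_mul1l crossed_mul1r crossed_mulDl crossed_mulDr
  crossed_one_neq0.

End CrossedProduct.

Section Reduction.
Variables (S : dvrType) (gT : finGroupType) (act : ringAction gT S).

Definition bar_act (g : gT) (x : residue S) : residue S :=
  res (act g (lift_res x)).

Lemma ract_unit g x : (act g x \is a GRing.unit) = (x \is a GRing.unit).
Proof.
apply/idP/idP => [|/(rmorph_unit (act g))//].
by move/(rmorph_unit (act g^-1%g)); rewrite /= -ractM mulVg ract1.
Qed.

Lemma bar_act_res g x : bar_act g (res x) = res (act g x).
Proof.
apply/eqP; rewrite /bar_act res_eq -rmorphB ract_unit -res_eq.
by rewrite lift_resK.
Qed.

Fact bar_act_is_zmod_morphism g : zmod_morphism (bar_act g).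
Proof.
move=> x y; rewrite -(lift_resK x) -(lift_resK y) -rmorphB.
by rewrite !bar_act_res !rmorphB.
Qed.
Fact bar_act_is_monoid_morphism g : monoid_morphism (bar_act g).
Proof.
split=> [|x y]; first by rewrite -(rmorph1 (@res S)) bar_act_res !rmorph1.
rewrite -(lift_resK x) -(lift_resK y) -rmorphM.
by rewrite !bar_act_res !rmorphM.
Qed.
HB.instance Definition _ g := GRing.isZmodMorphism.Build
  (residue S) (residue S) (bar_act g) (bar_act_is_zmod_morphism g).
HB.instance Definition _ g := GRing.isMonoidMorphism.Build
  (residue S) (residue S) (bar_act g) (bar_act_is_monoid_morphism g).

Fact bar_act1 x : bar_act 1%g x = x.
Proof. by rewrite /bar_act ract1 lift_resK. Qed.
Fact bar_actM g h x : bar_act (g * h)%g x = bar_act g (bar_act h x).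
Proof. by rewrite -(lift_resK x) !bar_act_res ractM. Qed.

Definition bar_action : ringAction gT (residue S) :=
  @RingAction gT (residue S) bar_act bar_act1 bar_actM.

(* The extension of R/(M_S \cap R) in S/M_S is separable: every element is a
   root of a separable polynomial with coefficients in R/(M_S \cap R), which is
   identified with the image of R = S^G in S/M_S. *)
Definition residually_separable : Prop :=
  forall x : residue S, exists p : {poly residue S},
    [/\ forall i, exists r : S, (forall g, act g r = r) /\ p`_i = res r,
        separable_poly p & root p x].

Variable f : cocycle2 act.

Definition bar_cocycle_val (g h : gT) : residue S := res (f g h).

Fact bar_cocycle_unit g h : bar_cocycle_val g h \is a GRing.unit.
Proof. exact/rmorph_unit/cocycle_unit. Qed.
Fact bar_cocycleP g h k :
  bar_cocycle_val g h * bar_cocycle_val (g * h)%g k =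
  bar_action g (bar_cocycle_val h k) * bar_cocycle_val g (h * k)%g.
Proof. by rewrite /= bar_act_res -!rmorphM cocycleP. Qed.

Definition bar_cocycle : cocycle2 bar_action :=
  Cocycle2 bar_cocycle_unit bar_cocycleP.

End Reduction.

Section Characters.
Variables (gT : finGroupType) (H : {group gT}) (k : fieldType).

(* Hom(H, k^* ), as a set of functions on the group type [subg_of H] of
   elements of [H]; its group law is the pointwise product. *)
Definition Hom_units : set {ffun subg_of H -> k} :=
  [set chi | (forall a, chi a != 0) /\
             (forall a b, chi (a * b)%g = chi a * chi b)].

Definition char_mul (chi psi : {ffun subg_of H -> k}) :
  {ffun subg_of H -> k} := [ffun a => chi a * psi a].

Definition char_cosets (P Q : set {ffun subg_of H -> k}) :
    set (set {ffun subg_of H -> k}) :=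
  [set [set char_mul chi psi | psi in P] | chi in Q].

(* When [H] is normal, [coset_of H] is gT / H; the value at the coset [C] does
   not depend on the representative if [f g1 (g2 * a) = f g1 g2] for all [a] in
   [H]. *)
Definition pi_map (act : ringAction gT k) (f : cocycle2 act)
    (C : coset_of H) : {ffun subg_of H -> k} :=
  [ffun a => f (sgval a) (fingroup.repr C)].

Definition pi_image (act : ringAction gT k) (f : cocycle2 act) :
    set {ffun subg_of H -> k} :=
  [set pi_map f C | C in [set` ([set: gT]%G / H)%g]].

End Characters.

Arguments Hom_units {gT} H k _ : assert.
Arguments pi_image {gT} H {k act} f _ : assert.

(* Main.v *)
(* Write k for the residue field of S, p for its characteristic, I for the inertia group, w
   for the character a |-> res (a(pi) / pi) of I, pi being a uniformizer, and P for the kernel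
   of w, a p-group.

   The only consequence of heredity which is used is: if H <= I is a p-group such that the
   twisted group algebra k^f H is commutative, then k^f H is reduced.  Indeed this algebra is
   local, and if y in S^f H lifts a nonzero nilpotent element, then projectivity of the left
   ideal generated by pi and y makes pi = t y with nonunits t and y.  The norm of S^f H (the
   determinant of right multiplications) maps t and y to nonunits of S^H, and these have
   valuation at least |H|: S^H has residue field k, as k is both separable and purely
   inseparable over its residue field.  But the norm of pi has valuation |H|.

   A commutator of an element of P with an element of I is then p-unipotent, hence trivial,
   and as I / P is cyclic, k^f I is commutative; it is also reduced.  Kummer theory, applied
   with the automorphisms U_g |-> w(g) U_g, shows that every nonzero ideal of k^f I contains a
   nonzero element supported on the maximal subgroup Gamma trivializing f, hence one of the
   primitive idempotents e_i = d^-1 sum_a w(a)^-i U_a of the group algebra of Gamma.  A nonzero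
   ideal of the whole crossed product meets k^f I, so contains some e_i.  As e_i U_g = U_g e_j
   with w^j = w^i / pi_f(g), the simple components correspond to the orbits of the characters
   w^i of Gamma under multiplication by the image of pi_f. *)

From HB Require Import structures.
Require Import Defs.
From mathcomp Require Import all_boot all_order all_algebra all_fingroup.
From mathcomp Require Import pgroup cyclic separable ring.
From mathcomp Require Import boolp classical_sets functions cardinality.

Set Implicit Arguments.
Unset Strict Implicit.
Unset Printing Implicit Defensive.

Import GRing.Theory.
Local Open Scope ring_scope.

(** * Two-generated left ideals of a hereditary ring *)

(** Heredity is assumed of [crossed f], while reducedness is needed for subgroups H of the inertia
    group. Projectivity is therefore recorded as identities between ring elements
    ([left_hereditary_split]), which pass to S^f H because restriction of supports is S^f H-linear
    on both sides.

    When the commutators of P with I are studied, k^f P is not yet known to be commutative, so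
    reducedness is applied only to the cyclic group generated by one commutator z, where
    commutativity is automatic. The q-th power of the commutator of two terms, q = |P|, is clearly a
    scalar; that this scalar is 1 comes from a determinant on k^f P which conjugation by U_h
    preserves.

    The roots of unity of k come from w itself: an element of order p in Gamma would give a
    unipotent term, so d is invertible in k, w is injective on Gamma and its values are all the d-th
    roots of unity. Hence Gamma is cyclic and each of its characters is some w^i with i < d.

    In the Kummer argument, elements are raised to the power q so that w separates the points of
    their support; Lagrange interpolation in the twists then isolates single terms. *)

Section TwoGenerated.
Variables (A : nzRingType) (x y : A).

Definition ideal2 : {pred A^o} := fun t => `[< exists r s, t = r * x + s * y >].

Fact ideal2_submod_closed : submod_closed ideal2.
Proof.
split=> [|a u v /asboolP[r [s ->]] /asboolP[r' [s' ->]]]; apply/asboolP.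
  by exists 0, 0; rewrite !mul0r addr0.
exists (a * r + r'), (a * s + s').
by rewrite !mulrDl /GRing.scale /= mulrDr !mulrA addrACA.
Qed.
HB.instance Definition _ :=
  GRing.isSubmodClosed.Build A A^o ideal2 ideal2_submod_closed.

Definition ideal2_type := {t : A^o | t \in ideal2}.
HB.instance Definition _ := SubChoice.on ideal2_type.
HB.instance Definition _ := [SubChoice_isSubLmodule of ideal2_type by <:].

Fact ideal2_comb_subproof (u : A^o * A^o) : u.1 * x + u.2 * y \in ideal2.
Proof. by apply/asboolP; exists u.1, u.2. Qed.

Definition ideal2_comb (u : A^o * A^o) : ideal2_type :=
  Sub (u.1 * x + u.2 * y : A^o) (ideal2_comb_subproof u).

Fact ideal2_comb_linear : linear ideal2_comb.
Proof.
move=> a u v; apply: val_inj; rewrite /= !mulrDl.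
by rewrite /GRing.scale /= mulrDr !mulrA addrACA.
Qed.
HB.instance Definition _ := GRing.isLinear.Build A (A^o * A^o)%type ideal2_type _
  ideal2_comb ideal2_comb_linear.

(** By projectivity [ideal2_comb] has a linear section. The pairs (a, b) and (c, d) are its values
    at x and y, and the last clause holds because a linear map kills every relation between the
    generators. *)
Lemma left_hereditary_split : left_hereditary A ->
  exists a b c d : A,
  [/\ x = a * x + b * y, y = c * x + d * y
    & forall r s, r * x + s * y = 0 -> r * a + s * c = 0 /\ r * b + s * d = 0].
Proof.
move=> herA.
have surj (t : ideal2_type) : exists u, ideal2_comb u = t.
  case: t => t tP; have /asboolP[r [s t_def]] := tP.
  by exists (r, s); apply: val_inj.
have [sigma sigmaK] := herA ideal2_type
  (val : {linear ideal2_type -> A^o}) val_inj _ _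
  (ideal2_comb : {linear _ -> _}) (idfun : {linear ideal2_type -> ideal2_type}) surj.
pose gx := ideal2_comb (1, 0); pose gy := ideal2_comb (0, 1).
have vx : val gx = x by rewrite /= mul1r mul0r addr0.
have vy : val gy = y by rewrite /= mul1r mul0r add0r.
exists (sigma gx).1, (sigma gx).2, (sigma gy).1, (sigma gy).2; split.
- by have e := congr1 val (sigmaK gx); rewrite -{1}vx; apply: esym e.
- by have e := congr1 val (sigmaK gy); rewrite -{1}vy; apply: esym e.
move=> r s rs0.
have g0 : r *: gx + s *: gy = 0.
  by apply: val_inj; rewrite /= mul1r mul0r addr0 mul1r mul0r add0r; exact: rs0.
have := congr1 sigma g0; rewrite linearD !linearZ linear0 => e.
by split; [move/(congr1 fst): e | move/(congr1 snd): e].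
Qed.

End TwoGenerated.

(** * Crossed products *)

Section CrossedTheory.
Variables (gT : finGroupType) (A : comUnitRingType) (act : ringAction gT A).
Variable f : cocycle2 act.
Implicit Types (x y : crossed f) (g h k : gT) (s t : A).

Lemma cocycle_neq0 g h : f g h != 0.
Proof. by apply: contraTneq (cocycle_unit f g h) => ->; rewrite unitr0. Qed.

Lemma crossed_addE x y k : (x + y) k = x k + y k.
Proof. by rewrite ffunE. Qed.

Lemma crossed_oppE x k : (- x) k = - x k.
Proof. by rewrite ffunE. Qed.

Lemma crossed_zeroE k : (0 : crossed f) k = 0.
Proof. by rewrite ffunE. Qed.

Lemma crossed_sumE (I : Type) (r : seq I) (P : pred I) (F : I -> crossed f) k :
  (\sum_(i <- r | P i) F i) k = \sum_(i <- r | P i) F i k.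
Proof.
by elim/big_rec2: _ => [|i u v _ <-]; rewrite (crossed_zeroE, crossed_addE).
Qed.

Lemma crossed_mulE x y k :
  (x * y) k = \sum_g x g * act g (y (g^-1 * k)%g) * f g (g^-1 * k)%g.
Proof. by rewrite ffunE. Qed.

Lemma crossed_termE s g k : crossed_term f s g k = if k == g then s else 0.
Proof. by rewrite ffunE. Qed.

Lemma crossed_term_id s g : crossed_term f s g g = s.
Proof. by rewrite crossed_termE eqxx. Qed.

Lemma crossed_termM s g t h :
  crossed_term f s g * crossed_term f t h =
  crossed_term f (s * act g t * f g h) (g * h)%g.
Proof. exact: crossed_mul_term. Qed.

Lemma crossed_term_sum x : x = \sum_g crossed_term f (x g) g.
Proof.
apply/ffunP=> k; rewrite crossed_sumE (bigD1 k) //= crossed_term_id.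
rewrite big1 ?addr0 // => g gk; rewrite crossed_termE.
by rewrite eq_sym (negbTE gk).
Qed.

Lemma crossed_term_mulE s g x k :
  (crossed_term f s g * x) k = s * act g (x (g^-1 * k)%g) * f g (g^-1 * k)%g.
Proof.
rewrite crossed_mulE (bigD1 g) //= crossed_term_id big1 ?addr0 // => h hg.
by rewrite crossed_termE (negbTE hg) !mul0r.
Qed.

Lemma crossed_mul_termE x s g k :
  (x * crossed_term f s g) k =
  x (k * g^-1)%g * act (k * g^-1)%g s * f (k * g^-1)%g g.
Proof.
rewrite crossed_mulE (bigD1 (k * g^-1)%g) //= crossed_termE.
rewrite invMg invgK mulgKV eqxx big1 ?addr0 // => h hg.
rewrite crossed_termE; case: eqP => [gE|]; last by rewrite rmorph0 mulr0 mul0r.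
by case/eqP: hg; rewrite -gE invMg invgK mulKVg.
Qed.

(** As f need not be normalized, the unit is U_1 divided by f(1,1); the same division makes this map
    a ring morphism. Its image is not central: on the right it multiplies the coefficient at k by
    [act k s]. *)
Definition crossed_scalar s : crossed f := crossed_term f (s / f 1%g 1%g) 1%g.

Lemma crossed_scalar_mulE s x k : (crossed_scalar s * x) k = s * x k.
Proof.
rewrite crossed_term_mulE ract1 invg1 mul1g cocycle1l mulrAC.
by rewrite divrK ?cocycle_unit.
Qed.

Lemma crossed_mul_scalarE s x k : (x * crossed_scalar s) k = x k * act k s.
Proof.
rewrite crossed_mul_termE invg1 mulg1 (cocycle1r f k) rmorphM rmorphV ?cocycle_unit //.
by rewrite -!mulrA mulVr ?mulr1 // rmorph_unit ?cocycle_unit.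
Qed.

Lemma crossed_oneE : (1 : crossed f) = crossed_term f (f 1%g 1%g)^-1 1%g.
Proof. by []. Qed.

Lemma crossed_scalarE s k : crossed_scalar s k = if k == 1%g then s / f 1%g 1%g else 0.
Proof. exact: crossed_termE. Qed.

Fact crossed_scalar_zmod_morphism : zmod_morphism crossed_scalar.
Proof.
move=> s t; apply/ffunP=> k; rewrite crossed_addE crossed_oppE !crossed_scalarE.
by case: eqP => _; rewrite ?subr0 // mulrBl.
Qed.
Fact crossed_scalar_monoid_morphism : monoid_morphism crossed_scalar.
Proof.
split=> [|s t]; first by rewrite /crossed_scalar mul1r.
apply/ffunP=> k; rewrite crossed_scalar_mulE !crossed_scalarE.
by case: eqP => _; rewrite ?mulr0 // mulrA.
Qed.
HB.instance Definition _ := GRing.isZmodMorphism.Build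
  A (crossed f) crossed_scalar crossed_scalar_zmod_morphism.
HB.instance Definition _ := GRing.isMonoidMorphism.Build
  A (crossed f) crossed_scalar crossed_scalar_monoid_morphism.

Lemma crossed_scalar_term s g t :
  crossed_scalar s * crossed_term f t g = crossed_term f (s * t) g.
Proof.
apply/ffunP=> k; rewrite crossed_scalar_mulE !crossed_termE.
by case: eqP; rewrite ?mulr0.
Qed.

Lemma crossed_term0 g : crossed_term f 0 g = 0.
Proof. by apply/ffunP=> k; rewrite crossed_termE crossed_zeroE if_same. Qed.

Lemma crossed_termB s t g :
  crossed_term f (s - t) g = crossed_term f s g - crossed_term f t g.
Proof.
apply/ffunP=> k; rewrite crossed_addE crossed_oppE !crossed_termE.
by case: eqP => _; rewrite ?subr0.
Qed.

Lemma crossed_term_inj s t g : crossed_term f s g = crossed_term f t g -> s = t.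
Proof. by move/ffunP/(_ g); rewrite !crossed_term_id. Qed.

Lemma crossed_term_rinv s g : s \is a GRing.unit ->
  exists2 t, t \is a GRing.unit & crossed_term f s g * crossed_term f t g^-1%g = 1.
Proof.
move=> Us; pose u := f 1%g 1%g * (s * f g g^-1%g).
have Uu : u \is a GRing.unit by rewrite !unitrM Us !cocycle_unit.
exists (act g^-1%g u^-1); first by rewrite rmorph_unit ?unitrV.
rewrite crossed_termM mulgV -ractM mulgV ract1 crossed_oneE; congr crossed_term.
rewrite /u invrM ?cocycle_unit ?unitrM ?Us ?cocycle_unit // mulrAC mulrCA mulrA mulrC.
by rewrite mulVr ?mulr1 ?unitrM ?Us ?cocycle_unit.
Qed.

Lemma crossed_term_inv s g : s \is a GRing.unit -> exists2 t, t \is a GRing.unit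
  & crossed_term f s g * crossed_term f t g^-1%g = 1 /\
    crossed_term f t g^-1%g * crossed_term f s g = 1.
Proof.
move=> Us; have [t Ut st1] := crossed_term_rinv g Us; exists t => //; split=> //.
have [u _ tu1] := crossed_term_rinv g^-1 Ut; rewrite invgK in tu1.
suff <- : crossed_term f u g = crossed_term f s g by [].
by rewrite -[LHS]mul1r -st1 -mulrA tu1 mulr1.
Qed.

End CrossedTheory.

(** * Extension by zero and restriction of supports along an injective group morphism *)

Section SubCrossed.
Variables (hT gT : finGroupType) (A : comUnitRingType).
Variables (actH : ringAction hT A) (act : ringAction gT A).
Variables (fH : cocycle2 actH) (f : cocycle2 act) (phi : hT -> gT).
Hypotheses (phi_inj : injective phi).
Hypotheses (phiM : {morph phi : g h / (g * h)%g >-> (g * h)%g}).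
Hypotheses (actE : forall h x, actH h x = act (phi h) x).
Hypotheses (fE : forall g h, fH g h = f (phi g) (phi h)).
Implicit Types (u v : crossed fH) (t : crossed f).

Definition crossed_ext u : crossed f := \sum_h crossed_term f (u h) (phi h).
Definition crossed_restr t : crossed fH := [ffun h => t (phi h)] : {ffun hT -> A}.

Let phi1 : phi 1%g = 1%g.
Proof. by apply: (mulgI (phi 1%g)); rewrite -phiM !mulg1. Qed.
Let phiV h : phi h^-1%g = (phi h)^-1%g.
Proof. by apply: (mulgI (phi h)); rewrite -phiM !mulgV. Qed.

Lemma crossed_restrE t h : crossed_restr t h = t (phi h).
Proof. by rewrite ffunE. Qed.

Lemma crossed_extE u h : crossed_ext u (phi h) = u h.
Proof.
rewrite crossed_sumE (bigD1 h) //= crossed_term_id big1 ?addr0 // => j jh.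
by rewrite crossed_termE (inj_eq phi_inj) eq_sym (negbTE jh).
Qed.

Lemma crossed_ext_eq0 u g : g \notin codom phi -> crossed_ext u g = 0.
Proof.
move=> gP; rewrite crossed_sumE big1 // => j _; rewrite crossed_termE.
by case: eqP gP => // ->; rewrite codom_f.
Qed.

Lemma crossed_extK : cancel crossed_ext crossed_restr.
Proof. by move=> u; apply/ffunP=> h; rewrite crossed_restrE crossed_extE. Qed.

Lemma crossed_restrK t :
  (forall g, g \notin codom phi -> t g = 0) -> crossed_ext (crossed_restr t) = t.
Proof.
move=> t0; apply/ffunP=> g; case: (boolP (g \in codom phi)) => [/codomP[h ->]|gP].
  by rewrite crossed_extE crossed_restrE.
by rewrite crossed_ext_eq0 // t0.
Qed.

(** Restriction of supports is not multiplicative, but [u] involves only elements of the subgroup,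
    and translation by these preserves both the subgroup and its complement. *)
Lemma crossed_restr_mull u t :
  crossed_restr (crossed_ext u * t) = u * crossed_restr t.
Proof.
apply/ffunP=> h; rewrite crossed_restrE mulr_suml crossed_sumE crossed_mulE.
apply: eq_bigr => j _; rewrite crossed_term_mulE crossed_restrE.
by rewrite actE fE !phiM phiV.
Qed.

Lemma crossed_restr_mulr u t :
  crossed_restr (t * crossed_ext u) = crossed_restr t * u.
Proof.
apply/ffunP=> h; rewrite crossed_restrE mulr_sumr crossed_sumE crossed_mulE.
rewrite [RHS](reindex (fun j => h * j^-1)%g) /=; last first.
  by exists (fun j => j^-1 * h)%g => j _; rewrite invMg invgK (mulgKV, mulKVg).
apply: eq_bigr => j _; rewrite crossed_mul_termE crossed_restrE.
have -> : ((h * j^-1)^-1 * h = j)%g by rewrite invMg invgK mulgKV.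
by rewrite actE fE !phiM phiV.
Qed.

Fact crossed_restr_zmod_morphism : zmod_morphism crossed_restr.
Proof.
by move=> s t; apply/ffunP=> h; rewrite crossed_addE crossed_oppE !crossed_restrE crossed_addE crossed_oppE.
Qed.

Fact crossed_ext_zmod_morphism : zmod_morphism crossed_ext.
Proof.
move=> u v; rewrite /crossed_ext -sumrB; apply: eq_bigr => h _.
by rewrite -crossed_termB crossed_addE crossed_oppE.
Qed.

Fact crossed_ext_monoid_morphism : monoid_morphism crossed_ext.
Proof.
split=> [|u v].
  apply/ffunP=> g; case: (boolP (g \in codom phi)) => [/codomP[h ->]|gP].
    by rewrite crossed_extE !crossed_oneE !crossed_termE -phi1 (inj_eq phi_inj) fE.
  rewrite crossed_ext_eq0 // crossed_oneE crossed_termE; case: eqP gP => // ->.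
  by rewrite -phi1 codom_f.
rewrite -[RHS]crossed_restrK; first by rewrite crossed_restr_mull crossed_extK.
move=> g gP; rewrite mulr_suml crossed_sumE big1 // => h _.
rewrite crossed_term_mulE crossed_ext_eq0 ?rmorph0 ?mulr0 ?mul0r //.
apply: contraNN gP => /codomP[j e]; have -> : g = phi (h * j)%g by rewrite phiM -e mulKVg.
exact: codom_f.
Qed.

End SubCrossed.

Section CrossedPower.
Variables (gT : finGroupType) (A : comUnitRingType) (act : ringAction gT A).
Variable f : cocycle2 act.

Lemma crossed_term_exp s g n : s \is a GRing.unit ->
  exists2 c, c \is a GRing.unit & crossed_term f s g ^+ n = crossed_term f c (g ^+ n)%g.
Proof.
move=> Us; elim: n => [|n [c Uc IHn]].
  by exists (f 1%g 1%g)^-1; rewrite ?unitrV ?cocycle_unit.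
exists (s * act g c * f g (g ^+ n)%g); last by rewrite exprS IHn crossed_termM expgS.
by rewrite !unitrM Us cocycle_unit rmorph_unit.
Qed.

End CrossedPower.

Section CommutativeCrossed.
Variables (gT : finGroupType) (k : fieldType) (act : ringAction gT k).
Variable f : cocycle2 act.
Hypothesis comm : commutative (@GRing.mul (crossed f)).
Implicit Types (x y : crossed f).

(** The alias takes the commutativity proof as a parameter, so that a commutative ring structure,
    and with it the Frobenius lemmas, can be attached to it. *)
Definition com_crossed of commutative (@GRing.mul (crossed f)) : Type := crossed f.
Local Notation C := (com_crossed comm).
HB.instance Definition _ := GRing.NzRing.on C.
HB.instance Definition _ := GRing.PzRing_hasCommutativeMul.Build C comm.

Lemma com_crossed_pchar n : [pchar k].-nat n -> [pchar C].-nat n.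
Proof.
apply: sub_in_pnat => p _; exact: (rmorph_pchar (crossed_scalar f : {rmorphism k -> C})).
Qed.

Variable q : nat.
Hypothesis qP : [pchar k].-nat q.

Let q_gt0 : (0 < q)%N. Proof. by case/andP: qP. Qed.

Lemma com_crossed_frobD x y : (x + y) ^+ q = x ^+ q + y ^+ q.
Proof. exact: (@exprDn_pchar C x y q (com_crossed_pchar qP)). Qed.

Lemma com_crossed_exprMn n x y : (x * y) ^+ n = x ^+ n * y ^+ n.
Proof. exact: (@exprMn C). Qed.

Lemma com_crossed_frobB1 x : x ^+ q = 1 -> (x - 1) ^+ q = 0.
Proof.
move=> xq; rewrite com_crossed_frobD (@exprNn_pchar (crossed f) 1 q).
  by rewrite xq expr1n subrr.
exact: (com_crossed_pchar qP).
Qed.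

Lemma com_crossed_frob_sum x : x ^+ q = \sum_g crossed_term f (x g) g ^+ q.
Proof.
rewrite {1}[x]crossed_term_sum.
apply: (big_morph (fun x => x ^+ q) com_crossed_frobD).
by rewrite expr0n eqn0Ngt q_gt0.
Qed.

(** Frobenius is additive here, and the q-th power of a term at h is a term at [h ^+ q]. *)
Lemma com_crossed_frob_supp x g : (x ^+ q) g != 0 -> exists2 h, x h != 0 & g = (h ^+ q)%g.
Proof.
rewrite com_crossed_frob_sum crossed_sumE => /eqP.
case: (pselect (exists h, (crossed_term f (x h) h ^+ q) g != 0)) => [[h hP] _|nex []].
  have xh : x h != 0.
    by apply: contraNneq hP => ->; rewrite crossed_term0 expr0n eqn0Ngt q_gt0 crossed_zeroE.
  exists h => //; have [|c _ e] := @crossed_term_exp _ _ _ f (x h) h q; first by rewrite unitfE.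
  by move: hP; rewrite e crossed_termE; case: (g =P _) => // _; rewrite eqxx.
by apply: big1 => h _; apply/eqP; apply/negPn/negP => hP; apply: nex; exists h.
Qed.

(** This makes the algebra local: an element is invertible or nilpotent according to whether c is
    nonzero or zero. *)
Lemma com_crossed_frob_scalar x : (forall g : gT, g ^+ q = 1)%g ->
  exists c, x ^+ q = crossed_scalar f c.
Proof.
move=> gq; exists ((x ^+ q) 1%g * f 1%g 1%g); apply/ffunP=> g; rewrite crossed_scalarE.
case: eqP => [->|g1]; first by rewrite mulfK // cocycle_neq0.
apply/eqP; apply/negPn/negP => /com_crossed_frob_supp[h _].
by rewrite gq.
Qed.

Lemma com_crossed_nilD x y n : x ^+ n = 0 -> y ^+ n = 0 -> (x + y) ^+ n.*2 = 0.
Proof.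
move=> xn yn; rewrite -addnn (@exprDn C) big1 // => i _.
case: (leqP n i) => [ni|/ltnW lin].
  have yi : (y : C) ^+ i = 0 by rewrite -(subnK ni) exprD [X in _ * X]yn mulr0.
  by rewrite yi mulr0 mul0rn.
have xi : (x : C) ^+ (n + n - i) = 0.
  by rewrite -addnBA // exprD [X in X * _]xn mul0r.
by rewrite xi mul0r mul0rn.
Qed.

End CommutativeCrossed.

Section TrivialAction.
Variables (gT : finGroupType) (k : fieldType) (act : ringAction gT k).
Variable f : cocycle2 act.
Hypothesis act_triv : forall g x, act g x = x.

Lemma crossed_comm : (forall g h : gT, (g * h = h * g)%g) -> (forall g h, f g h = f h g) ->
  commutative (@GRing.mul (crossed f)).
Proof.
move=> gC fC x y; rewrite [x]crossed_term_sum [y]crossed_term_sum.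
rewrite mulr_suml mulr_sumr; apply: eq_bigr => g _.
rewrite mulr_suml mulr_sumr; apply: eq_bigr => h _; rewrite !crossed_termM !act_triv gC fC.
by rewrite [x g * y h]mulrC.
Qed.

(* In a cyclic group the [U_z ^+ i] commute and are multiples of the [U_(z ^+ i)]. *)
Lemma crossed_cyclic_comm (z : gT) : (forall g, g \in <[z]>%g) -> commutative (@GRing.mul (crossed f)).
Proof.
move=> zP; apply: crossed_comm => g h; have /cycleP[i ->] := zP g; have /cycleP[j ->] := zP h.
  exact: (commuteX2 i j (commute_refl z)).
have U1 : (1 : k) \is a GRing.unit by exact: unitr1.
have [c + ci] := crossed_term_exp f z i U1; have [d + dj] := crossed_term_exp f z j U1.
rewrite !unitfE => d0 c0; apply: (mulfI (mulf_neq0 c0 d0)).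
apply: (@crossed_term_inj _ _ _ f _ _ (z ^+ i * z ^+ j)%g).
have e := crossed_termM f c (z ^+ i)%g d (z ^+ j)%g; rewrite act_triv in e; rewrite -e.
rewrite (commuteX2 i j (commute_refl z)) [c * d]mulrC.
have e' := crossed_termM f d (z ^+ j)%g c (z ^+ i)%g; rewrite act_triv in e'; rewrite -e'.
by rewrite -ci -dj -!exprD addnC.
Qed.

End TrivialAction.

(** * The norm of a crossed product *)

Section CrossedNorm.
Variables (gT : finGroupType) (A : comUnitRingType) (act : ringAction gT A).
Variable f : cocycle2 act.
Implicit Types (x y z : crossed f).

(** Right multiplication by x is linear for the left A-module structure, even though A is not
    central. Row i holds the coordinates of U_i x, so matrices act on row vectors and multiply in
    the order of the ring. *)
Definition crossed_mx x : 'M[A]_#|gT| :=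
  \matrix_(i, j) (crossed_term f 1 (enum_val i) * x) (enum_val j).

Definition crossed_row x : 'rV[A]_#|gT| := \row_j x (enum_val j).

Definition crossed_norm x : A := \det (crossed_mx x).

Lemma crossed_rowM z x : crossed_row (z * x) = crossed_row z *m crossed_mx x.
Proof.
apply/rowP=> j; rewrite !mxE crossed_mulE (reindex (@enum_val gT gT)) /=; last first.
  exact: (onW_bij _ (enum_val_bij gT)).
by apply: eq_bigr => i _; rewrite !mxE crossed_term_mulE mul1r mulrA.
Qed.

Lemma crossed_row_inj : injective crossed_row.
Proof.
move=> x y xy; apply/ffunP=> g; have := congr1 (fun r : 'rV_#|gT| => r 0 (enum_rank g)) xy.
by rewrite !mxE enum_rankK.
Qed.

Lemma crossed_mxM x y : crossed_mx (x * y) = crossed_mx x *m crossed_mx y.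
Proof.
apply/row_matrixP=> i; rewrite row_mul.
have rE z : row i (crossed_mx z) = crossed_row (crossed_term f 1 (enum_val i) * z).
  by apply/rowP=> j; rewrite !mxE.
by rewrite !rE mulrA crossed_rowM.
Qed.

Lemma crossed_normM x y : crossed_norm (x * y) = crossed_norm x * crossed_norm y.
Proof. by rewrite /crossed_norm crossed_mxM det_mulmx. Qed.

Lemma crossed_norm_scalar s :
  crossed_norm (crossed_scalar f s) = \prod_g act g s.
Proof.
have -> : crossed_norm (crossed_scalar f s) =
    \det (diag_mx (\row_(j < #|gT|) act (enum_val j) s)).
  congr (\det _); apply/matrixP=> i j; rewrite !mxE crossed_mul_scalarE crossed_termE.
  rewrite (inj_eq enum_val_inj) eq_sym; case: eqP => [->|_]; first by rewrite mul1r.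
  by rewrite mul0r.
rewrite det_diag [RHS](reindex (@enum_val gT gT)) /=; last exact: (onW_bij _ (enum_val_bij gT)).
by apply: eq_bigr => i _; rewrite mxE.
Qed.

Lemma crossed_norm_unit x : crossed_norm x \is a GRing.unit ->
  exists2 z, z * x = 1 & x * z = 1.
Proof.
have left_inv y : crossed_norm y \is a GRing.unit -> exists z, z * y = 1.
  move=> Uy; pose r := crossed_row 1 *m invmx (crossed_mx y).
  exists ([ffun g => r 0 (enum_rank g)] : {ffun gT -> A}); apply: crossed_row_inj.
  rewrite crossed_rowM; have -> : crossed_row ([ffun g => r 0 (enum_rank g)] : {ffun gT -> A}) = r.
    by apply/rowP=> j; rewrite mxE ffunE enum_valK.
  by rewrite /r mulmxKV.
move=> Ux; have [z zx1] := left_inv x Ux; exists z => //.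
have [|w wz1] := left_inv z.
  have := congr1 crossed_norm zx1; rewrite crossed_normM -(rmorph1 (crossed_scalar f)).
  rewrite crossed_norm_scalar big1 => [e|g _]; last exact: rmorph1.
  by apply/unitrP; exists (crossed_norm x); rewrite e mulrC.
by rewrite -[X in X * z](mul1r x) -wz1 -(mulrA w) zx1 mulr1.
Qed.

Lemma crossed_norm1 : crossed_norm 1 = 1.
Proof.
rewrite -(rmorph1 (crossed_scalar f)) crossed_norm_scalar big1 // => g _.
exact: rmorph1.
Qed.

End CrossedNorm.

Section NormInvariant.
Variables (gT : finGroupType) (A : idomainType) (act : ringAction gT A).
Variable f : cocycle2 act.

(* Left multiplication by [U_g] is semilinear for the left [A]-module structure and
   commutes with right multiplications. *)
Lemma crossed_norm_fixed (x : crossed f) g : act g (crossed_norm x) = crossed_norm x.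
Proof.
pose si (i : 'I_#|gT|) := enum_rank (g * enum_val i : gT)%g.
have si_inj : injective si.
  by move=> i j /enum_rank_inj/mulgI/enum_val_inj.
(* X is the monomial matrix of left multiplication by U_g. Computing U_g (U_i x) in two ways shows
   that X intertwines the matrix of x with its image under [act g], so both have the same
   determinant. *)
pose X : 'M[A]_#|gT| := diag_mx (\row_i f g (enum_val i)) *m perm_mx (perm si_inj).
have XE i j : X i j = f g (enum_val i) * (enum_val j == g * enum_val i)%g%:R.
  rewrite /X mul_diag_mx !mxE permE /si; congr (_ * _%:R).
  by rewrite -(inj_eq enum_val_inj) enum_rankK eq_sym.
have detX : \det X != 0.
  rewrite /X det_mulmx det_diag det_perm mulf_neq0 ?signr_eq0 //.
  by apply/prodf_neq0 => i _; rewrite mxE cocycle_neq0.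
have XR : map_mx (act g) (crossed_mx x) *m X = X *m crossed_mx x.
  apply/matrixP=> i j; transitivity
    ((crossed_term f 1 g * (crossed_term f 1 (enum_val i) * x)) (enum_val j)).
    rewrite crossed_term_mulE mul1r mxE (bigD1 (enum_rank (g^-1 * enum_val j)%g)) //=.
    rewrite XE !mxE enum_rankK mulKVg eqxx mulr1 big1 ?addr0 // => l lj.
    rewrite XE; case: eqP => [e|_]; last by rewrite !mulr0.
    by case/eqP: lj; rewrite e mulKg enum_valK.
  rewrite mulrA crossed_termM rmorph1 !mul1r mxE (bigD1 (si i)) //= XE !mxE /si enum_rankK.
  rewrite eqxx mulr1 big1 ?addr0 => [|l li].
    by rewrite !crossed_term_mulE mul1r !mulrA.
  rewrite XE; case: eqP => [e|_]; last by rewrite mulr0 mul0r.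
  by case/eqP: li; rewrite -e enum_valK.
move: (X) detX XR => Y detY /(congr1 determinant); rewrite !det_mulmx det_map_mx mulrC.
by move/(mulfI detY).
Qed.

End NormInvariant.

(** * Discrete valuation rings *)

Section DVRTheory.
Variable S : dvrType.
Implicit Types (a b s t x : S).

Definition rdvd a s := exists b, s = b * a.

Lemma rdvd0 a : rdvd a 0. Proof. by exists 0; rewrite mul0r. Qed.
Lemma rdvd_mull a b s : rdvd a s -> rdvd a (b * s).
Proof. by case=> c ->; exists (b * c); rewrite mulrA. Qed.
Lemma rdvdD a s t : rdvd a s -> rdvd a t -> rdvd a (s + t).
Proof. by case=> b -> [c ->]; exists (b + c); rewrite mulrDl. Qed.
Lemma rdvd_sum a (I : Type) (r : seq I) (P : pred I) (F : I -> S) :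
  (forall i, P i -> rdvd a (F i)) -> rdvd a (\sum_(i <- r | P i) F i).
Proof. by move=> aF; apply: big_ind => //; [exact: rdvd0 | exact: rdvdD]. Qed.

Definition uniformizer pi :=
  [/\ pi != 0, pi \isn't a GRing.unit & forall s, s \isn't a GRing.unit -> rdvd pi s].

Lemma uniformizer_exists : exists pi, uniformizer pi.
Proof.
have idM : two_sided_ideal ((fun x => x \isn't a GRing.unit) : set S).
  split=> [|x y|a x|a x] /=; rewrite ?unitr0 //; first exact: dvr_local.
    by rewrite unitrM negb_and orbC => ->.
  by rewrite unitrM negb_and => ->.
have [pi piE] := dvr_principal _ idM.
have memI z : (z \isn't a GRing.unit) = [set b * pi | b in setT]%classic z :> Prop.
  exact: (f_equal (fun I : set S => I z) piE).
have genP s : s \isn't a GRing.unit -> rdvd pi s.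
  by rewrite memI => -[b _ <-]; exists b.
exists pi; split=> //.
  have [x [x0 /genP[b xE]]] := @dvr_not_field S.
  by apply: contra_neq x0 => pi0; rewrite xE pi0 mulr0.
by rewrite memI; exists 1; rewrite ?mul1r.
Qed.

Variable pi : S.
Hypothesis piP : uniformizer pi.

Let pi_neq0 : pi != 0. Proof. by case: piP. Qed.
Let pi_nunit : pi \isn't a GRing.unit. Proof. by case: piP. Qed.

Lemma uniformizer_expr_neq0 n : pi ^+ n != 0.
Proof. exact: expf_neq0. Qed.

Lemma uniformizer_dvd s : rdvd pi s <-> s \isn't a GRing.unit.
Proof.
split=> [[b ->]|]; first by rewrite unitrM negb_and pi_nunit orbT.
by case: piP => _ _; apply.
Qed.

Lemma uniformizer_dvd_res s : rdvd pi s <-> res s = 0.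
Proof.
split=> [/uniformizer_dvd|/eqP]; first by rewrite -res_eq0 => /eqP.
by rewrite res_eq0 => /uniformizer_dvd.
Qed.

(** Krull's intersection theorem: a generator a of the intersection is b pi with b again in the
    intersection, so a = c pi a for some c, and 1 - c pi is a unit. *)
Lemma uniformizer_cap s : (forall n, rdvd (pi ^+ n) s) -> s = 0.
Proof.
move=> sP; pose I : set S := fun x => forall n, rdvd (pi ^+ n) x.
have [|a aE] := @dvr_principal S I.
  split=> [n|x y xP yP n|b x xP n|b x xP n]; first exact: rdvd0.
  - exact: rdvdD.
  - exact: rdvd_mull.
  - by rewrite mulrC; apply: rdvd_mull.
have Ia : I a by rewrite aE; exists 1; rewrite ?mul1r.
have [b aEb] := Ia 1; rewrite expr1 in aEb.
have Ib : I b.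
  move=> n; have [c aEc] := Ia n.+1; exists c; apply: (mulIf pi_neq0).
  by rewrite -aEb aEc exprSr mulrA.
have [c _ bE] : [set b * a | b in setT]%classic b by rewrite -aE.
have : a * (1 - c * pi) = 0.
  by rewrite mulrBr mulr1 {1}aEb -bE mulrA [a * c]mulrC subrr.
have U1 : 1 - c * pi \is a GRing.unit.
  apply: contraT => N1; have := dvr_local _ _ N1 (_ : c * pi \isn't a GRing.unit).
  by rewrite subrK unitr1 unitrM negb_and pi_nunit orbT; apply.
move/(canRL (mulrK U1)); rewrite mul0r => a0.
have [d _ <-] : [set b * a | b in setT]%classic s by rewrite -aE.
by rewrite a0 mulr0.
Qed.

Lemma uniformizer_decomp s : s != 0 -> exists n u, u \is a GRing.unit /\ s = u * pi ^+ n.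
Proof.
move=> s0; have [n nP] : exists n, ~ rdvd (pi ^+ n) s.
  by apply/existsNP => sP; case/eqP: s0; apply: uniformizer_cap.
elim: n s s0 nP => [|n IHn] s s0 nP.
  by case: nP; exists s; rewrite mulr1.
case: (boolP (s \is a GRing.unit)) => [Us|/uniformizer_dvd[t sE]].
  by exists 0%N, s; rewrite mulr1.
have t0 : t != 0 by apply: contra_neq s0 => t0; rewrite sE t0 mul0r.
have [|m [u [Uu tE]]] := IHn t t0.
  by move=> [b tE]; apply: nP; exists b; rewrite sE tE exprSr mulrA.
by exists m.+1, u; split=> //; rewrite sE tE exprSr mulrA.
Qed.

Lemma uniformizer_expr_dvd m n u : u \is a GRing.unit ->
  rdvd (pi ^+ m) (u * pi ^+ n) -> (m <= n)%N.
Proof.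
move=> Uu [b bE]; rewrite leqNgt; apply/negP => nm.
move: bE; rewrite -(subnK nm) addnS exprS exprD mulrA mulrA => /(mulIf (uniformizer_expr_neq0 n)) uE.
by move: Uu; rewrite uE !unitrM (negbTE pi_nunit) andbF.
Qed.

End DVRTheory.

Section FixedResidue.
Variables (S : dvrType) (hT : finGroupType) (act : ringAction hT S).

Definition fixed_residue : {pred residue S} :=
  fun x => `[< exists r, (forall h, act h r = r) /\ res r = x >].

Fact fixed_residue_divring_closed : divring_closed fixed_residue.
Proof.
split=> [|x y /asboolP[r [rf <-]] /asboolP[s [sf <-]]|
  x y /asboolP[r [rf <-]] /asboolP[s [sf <-]]]; apply/asboolP.
- by exists 1; split=> [h|]; rewrite rmorph1.
- by exists (r - s); split=> [h|]; rewrite rmorphB ?rf ?sf.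
case: (boolP (s \is a GRing.unit)) => [Us|].
  by exists (r / s); split=> [h|]; rewrite rmorphM rmorphV ?rf ?sf.
rewrite -res_eq0 => /eqP ->; exists 0; rewrite invr0 mulr0.
by split=> [h|]; rewrite rmorph0.
Qed.
HB.instance Definition _ :=
  GRing.isDivringClosed.Build (residue S) fixed_residue fixed_residue_divring_closed.

Definition fixed_residue_field := {x : residue S | x \in fixed_residue}.
HB.instance Definition _ := SubChoice.on fixed_residue_field.
HB.instance Definition _ := [SubChoice_isSubIntegralDomain of fixed_residue_field by <:].
HB.instance Definition _ := [SubIntegralDomain_isSubField of fixed_residue_field by <:].

Hypothesis act_triv : forall h s, res (act h s) = res s.
Hypothesis card_pchar : [pchar residue S].-nat #|hT|.
Hypothesis sep : forall x : residue S, exists p : {poly residue S},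
  [/\ forall i, p`_i \in fixed_residue, separable_poly p & root p x].

Local Notation q := #|hT|.

(* The residue field of [S] is both purely inseparable and separable over that of
   the fixed ring. *)
Lemma fixed_residue_full x : x \in fixed_residue.
Proof.
have xq : x ^+ q \in fixed_residue.
  (* The norm of a lift of x is invariant, and its residue is x^q because the group acts trivially
     on residues. *)
  apply/asboolP; exists (\prod_h act h (lift_res x)); split=> [g|].
    rewrite rmorph_prod (reindex_inj (mulgI g^-1%g)) /=.
    by apply: eq_bigr => h _; rewrite -ractM mulKVg.
  rewrite rmorph_prod (eq_bigr (fun=> x)) ?prodr_const // => h _.
  by rewrite /= act_triv lift_resK.
have [p [pk sep_p px]] := sep x.
have [v vE] : exists v : {rmorphism fixed_residue_field -> residue S}, v =1 val.
  by exists (val : {rmorphism fixed_residue_field -> residue S}).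
have vK z : z \in fixed_residue -> v (insubd 0 z) = z.
  by move=> zk; rewrite vE; exact: (insubdK (0 : fixed_residue_field) zk).
pose p0 : {poly fixed_residue_field} := \poly_(i < size p) insubd 0 p`_i.
have p0E : map_poly v p0 = p.
  apply/polyP=> i; rewrite coef_map /= coef_poly; case: ltnP => [_|ip].
    exact: vK.
  by rewrite rmorph0 nth_default.
pose r0 : {poly fixed_residue_field} := 'X^q - (insubd 0 (x ^+ q))%:P.
have r0E : map_poly v r0 = ('X - x%:P) ^+ q.
  have qP : [pchar {poly residue S}].-nat q.
    by apply: sub_in_pnat card_pchar => l _; exact: (rmorph_pchar (@polyC (residue S))).
  rewrite exprDn_pchar // exprNn_pchar // -rmorphXn /=.
  rewrite /r0 rmorphB /= map_polyXn map_polyC /=; congr (_ - _%:P); exact: vK.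
(* The gcd is computed over the fixed residue field. Over k it divides (X - x)^q and vanishes at x,
   so it is a power of X - x up to a constant, with exponent 1 since p is separable; x is then read
   off as a quotient of its two coefficients. *)
pose D := gcdp p0 r0; have DE : map_poly v D = gcdp p (('X - x%:P) ^+ q).
  by rewrite gcdp_map p0E r0E.
have xD : root (map_poly v D) x.
  have q_gt0 : (0 < q)%N by apply/card_gt0P; exists 1%g.
  by rewrite DE root_gcd px -(prednK q_gt0) root_exp_XsubC eqxx.
have [j _ Dj] : exists2 j, (j <= q)%N & map_poly v D %= ('X - x%:P) ^+ j.
  by apply/dvdp_exp_XsubCP; rewrite DE dvdp_gcdr.
have j1 : j = 1%N.
  case: j Dj => [|[|j]] // Dj.
    by move: xD; rewrite (eqp_root Dj) expr0 (negPf (root1 x)).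
  have : map_poly v D %| p by rewrite DE dvdp_gcdl.
  by rewrite (eqp_dvdl _ Dj) (separable_nosquare sep_p) // size_XsubC.
move: Dj; rewrite {}j1 expr1 => /eqpP[[a b] /= /andP[a0 b0] DE'].
have Dk i : (map_poly v D)`_i \in fixed_residue by rewrite coef_map /= vE; exact: valP.
have D0 : a * (map_poly v D)`_0 = - (b * x).
  by have := congr1 (fun r : {poly _} => r`_0) DE'; rewrite !coefZ coefB coefX coefC /= sub0r mulrN.
have D1 : a * (map_poly v D)`_1 = b.
  by have := congr1 (fun r : {poly _} => r`_1) DE'; rewrite !coefZ coefB coefX coefC /= subr0 mulr1.
have D1n0 : (map_poly v D)`_1 != 0.
  by apply: contra_neq b0 => D10; rewrite -D1 D10 mulr0.
have -> : x = - ((map_poly v D)`_0 / (map_poly v D)`_1).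
  apply: (mulfI b0); rewrite -[LHS]opprK -D0 -D1 mulrN -mulrA.
  by rewrite [X in _ = - (a * X)]mulrCA mulfV // mulr1.
by rewrite rpredN rpred_div ?Dk.
Qed.

End FixedResidue.

Section WildFixedRing.
Variables (S : dvrType) (hT : finGroupType) (act : ringAction hT S).
Variable pi : S.
Hypothesis piP : uniformizer pi.

Lemma ract_uniformizer h : exists2 u, u \is a GRing.unit & act h pi = u * pi.
Proof.
have [pi0 pi_nunit pi_dvd] := piP.
have dvd g : rdvd pi (act g pi) by apply: pi_dvd; rewrite ract_unit.
have [[u uE] [v vE]] := (dvd h, dvd h^-1%g); exists u => //.
apply/unitrP; exists (act h v); suff e : act h v * u = 1 by split; rewrite // mulrC.
by apply: (mulIf pi0); rewrite -mulrA -uE -rmorphM -vE -ractM mulgV ract1 mul1r.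
Qed.

Hypothesis act_faithful : faithful_action act.
Hypothesis act_triv : forall h s, res (act h s) = res s.
Hypothesis card_pchar : [pchar residue S].-nat #|hT|.
Hypothesis sep : forall x : residue S, exists p : {poly residue S},
  [/\ forall i, p`_i \in fixed_residue act, separable_poly p & root p x].

(** This is the pi-adic expansion of s with invariant digits, which exist because every residue has
    an invariant lift ([fixed_residue_full]). *)
Lemma fixed_poly_approx m s : exists Q : {poly S}, [/\ (size Q <= m)%N,
  forall i h, act h Q`_i = Q`_i & rdvd (pi ^+ m) (s - Q.[pi])].
Proof.
elim: m => [|m [Q [sQ fQ [b bE]]]].
  exists 0; rewrite size_poly0; split=> // [i h|]; first by rewrite coef0 rmorph0.
  by exists (s - 0.[pi]); rewrite mulr1.
have /asboolP[c [fc cE]] := fixed_residue_full act_triv card_pchar sep (res b).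
have /(uniformizer_dvd_res piP)[d dE] : res (b - c) = 0 by rewrite rmorphB /= cE subrr.
exists (Q + c *: 'X^m); split.
- apply: (leq_trans (size_polyD _ _)); rewrite geq_max (leq_trans sQ) //.
  by rewrite (leq_trans (size_scale_leq _ _)) ?size_polyXn.
- move=> i h; rewrite coefD coefZ coefXn rmorphD rmorphM fQ fc; congr (_ + _ * _).
  by case: eqP; rewrite ?rmorph0 ?rmorph1.
exists d; rewrite hornerD hornerZ hornerXn opprD addrA bE -mulrBl dE.
by rewrite exprS mulrA.
Qed.

Lemma horner_ract (Q : {poly S}) h a : (forall i, act h Q`_i = Q`_i) ->
  act h Q.[a] = Q.[act h a].
Proof.
move=> fQ; rewrite -horner_map /=; congr (_.[_]).
by apply/polyP=> i; rewrite coef_map /= fQ.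
Qed.

(** An element fixing pi fixes every polynomial in pi with invariant coefficients, and these
    approximate each s modulo all powers of pi. *)
Lemma ract_uniformizer_inj g h : act g pi = act h pi -> g = h.
Proof.
move=> gh; apply/(mulgI g^-1%g)/esym; rewrite mulVg; apply: act_faithful => s.
set l := (_ * _)%g; have lpi : act l pi = pi by rewrite ractM -gh -ractM mulVg ract1.
apply/eqP; rewrite -subr_eq0; apply/eqP; apply: (uniformizer_cap piP) => n.
have [Q [_ fQ [b bE]]] := fixed_poly_approx n s.
exists (act l b - b); rewrite mulrBl -bE -{1}lpi -rmorphXn -rmorphM -bE rmorphB.
by rewrite horner_ract // lpi opprB addrA subrK.
Qed.

(* A fixed element [u * pi ^+ n] with [0 < n < #|hT|] would give, for every [N], a monic
   polynomial of degree [#|hT| - 1] with fixed coefficients whose values at the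
   [#|hT|] distinct conjugates of [pi] are divisible by [pi ^+ N]. *)
Lemma fixed_nunit_dvd r : (forall h, act h r = r) -> r \isn't a GRing.unit ->
  rdvd (pi ^+ #|hT|) r.
Proof.
move=> fr Nr; have [->|r0] := eqVneq r 0; first exact: rdvd0.
have [n [u [Uu rE]]] := uniformizer_decomp piP r0.
have [qn|nq] := leqP #|hT| n.
  by exists (u * pi ^+ (n - #|hT|)); rewrite rE -mulrA -exprD subnK.
have n_gt0 : (0 < n)%N.
  by rewrite lt0n; apply: contraNneq Nr => n0; rewrite rE n0 mulr1.
(* As r is a unit times pi^n, expansion modulo pi^n can be iterated with r in place of pi^n. Since r
   is invariant, its powers are absorbed into the coefficients and the degree in pi stays below
   n. *)
have approx N s : exists Q : {poly S}, [/\ (size Q <= n)%N,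
    forall i h, act h Q`_i = Q`_i & rdvd (r ^+ N) (s - Q.[pi])].
  elim: N s => [|N IHN] s.
    exists 0; rewrite size_poly0; split=> // [i h|]; first by rewrite coef0 rmorph0.
    by exists (s - 0.[pi]); rewrite mulr1.
  have [Q [sQ fQ [b bE]]] := fixed_poly_approx n s.
  have [Q1 [sQ1 fQ1 [c cE]]] := IHN (b / u).
  exists (Q + r *: Q1); split.
  - by rewrite (leq_trans (size_polyD _ _)) // geq_max sQ (leq_trans (size_scale_leq _ _)).
  - by move=> i h; rewrite coefD coefZ rmorphD rmorphM fQ fQ1 fr.
  exists c; rewrite hornerD hornerZ opprD addrA bE.
  have -> : b * pi ^+ n = r * (b / u).
    by rewrite rE mulrAC [u * _]mulrC divrK // mulrC.
  by rewrite -mulrBr cE exprS mulrCA.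
pose q := #|hT|; pose a : 'rV[S]_q := \row_j act (enum_val j) pi.
pose V := Vandermonde q a.
have detV : \det V = 0.
  apply: (uniformizer_cap piP) => N.
  suff [b bE] : rdvd (r ^+ N) (\det V).
    by exists (b * u ^+ N * pi ^+ (n.-1 * N)); rewrite bE rE exprMn -!mulrA -exprM -exprD
      addnC -mulSn prednK.
  have q_gt0 : (0 < q)%N by exact: leq_ltn_trans nq.
  have [Q [sQ fQ [b bE]]] := approx N (pi ^+ q.-1).
  pose P := 'X^(q.-1) - Q.
  have fP i h : act h P`_i = P`_i.
    rewrite coefB coefXn rmorphB fQ; congr (_ - _).
    by case: eqP; rewrite ?rmorph0 ?rmorph1.
  have sP : (size P <= q)%N.
    rewrite (leq_trans (size_polyD _ _)) // geq_max size_polyXn size_polyN prednK // leqnn.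
    by rewrite (leq_trans sQ) // ltnW.
  have Plead : P`_q.-1 = 1.
    rewrite coefB coefXn eqxx nth_default ?subr0 // (leq_trans sQ) //.
    by rewrite -ltnS prednK.
  have PV : (\row_(i < q) P`_i) *m V = \row_j (act (enum_val j) b * r ^+ N).
    apply/rowP=> j; rewrite !mxE.
    have -> : act (enum_val j) b * r ^+ N = act (enum_val j) P.[pi].
      by rewrite /P hornerD hornerN hornerXn bE rmorphM rmorphXn /= fr.
    rewrite horner_ract // (horner_coef_wide _ sP).
    by apply: eq_bigr => i _; rewrite !mxE.
  have lt_q : (q.-1 < q)%N by rewrite prednK.
  (* Cramer's rule: multiplying by the adjugate turns the row of coefficients of P into its multiple
     by [\det V]. The last coefficient is 1, so [\det V] itself is divisible by r^N. *)
  have := congr1 (fun M => (M *m \adj V) 0 (Ordinal lt_q)) PV.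
  rewrite -mulmxA mul_mx_adj mul_mx_scalar !mxE /= Plead mulr1 => ->.
  apply: rdvd_sum => j _; rewrite [X in X * _]mxE mulrAC.
  by exists (act (enum_val j) b * (\adj V) j (Ordinal lt_q)).
move/eqP: detV; rewrite det_Vandermonde prodf_seq_eq0 => /hasP[i _ /=].
rewrite prodf_seq_eq0 => /hasP[j _ /= /andP[ij]]; rewrite !mxE subr_eq0 => /eqP.
by move/ract_uniformizer_inj/enum_val_inj => e; move: ij; rewrite e ltnn.
Qed.

End WildFixedRing.

(** * Reducedness of commutative wild twisted group algebras *)

Section CrossedReduction.
Variables (S : dvrType) (gT : finGroupType) (act : ringAction gT S).
Variable f : cocycle2 act.
Local Notation T := (crossed f).
Local Notation Tbar := (crossed (bar_cocycle f)).

Definition crossed_res (x : T) : Tbar := [ffun g => res (x g)] : {ffun gT -> residue S}.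

Lemma crossed_resE x g : crossed_res x g = res (x g).
Proof. by rewrite ffunE. Qed.

Fact crossed_res_zmod_morphism : zmod_morphism crossed_res.
Proof.
move=> x y; apply/ffunP=> g.
by rewrite crossed_addE crossed_oppE !crossed_resE crossed_addE crossed_oppE rmorphB.
Qed.
Fact crossed_res_monoid_morphism : monoid_morphism crossed_res.
Proof.
split=> [|x y]; apply/ffunP=> g; rewrite crossed_resE.
  rewrite !crossed_oneE !crossed_termE; case: eqP; rewrite ?rmorph0 //.
  by rewrite rmorphV ?cocycle_unit.
rewrite !crossed_mulE rmorph_sum; apply: eq_bigr => h _.
by rewrite !rmorphM /= !crossed_resE bar_act_res.
Qed.
HB.instance Definition _ := GRing.isZmodMorphism.Build
  T Tbar crossed_res crossed_res_zmod_morphism.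
HB.instance Definition _ := GRing.isMonoidMorphism.Build
  T Tbar crossed_res crossed_res_monoid_morphism.

Lemma crossed_res_surj (y : Tbar) : exists x, crossed_res x = y.
Proof.
exists ([ffun g => lift_res (y g)] : {ffun gT -> S}); apply/ffunP=> g.
by rewrite crossed_resE ffunE lift_resK.
Qed.

Lemma crossed_res_norm x : crossed_norm (crossed_res x) = res (crossed_norm x).
Proof.
rewrite /crossed_norm -det_map_mx; congr (\det _); apply/matrixP=> i j; rewrite !mxE.
have -> : crossed_term (bar_cocycle f) 1 (enum_val i) =
    crossed_res (crossed_term f 1 (enum_val i)).
  by apply/ffunP=> g; rewrite crossed_resE !crossed_termE; case: eqP; rewrite ?rmorph0 ?rmorph1.
by rewrite -rmorphM crossed_resE.
Qed.

Lemma crossed_norm_res_unit x y : crossed_res x * y = 1 -> crossed_norm x \is a GRing.unit.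
Proof.
move=> xy1; rewrite -[_ \is a _]negbK -res_eq0 -crossed_res_norm.
apply/eqP => x0; have := congr1 (@crossed_norm _ _ _ _) xy1.
by rewrite crossed_normM x0 mul0r crossed_norm1 => /esym/eqP; rewrite oner_eq0.
Qed.

End CrossedReduction.

Section WildReduced.
Variables (S : dvrType) (hT : finGroupType) (act : ringAction hT S).
Variable f : cocycle2 act.
Local Notation T := (crossed f).
Local Notation Tbar := (crossed (bar_cocycle f)).
Hypothesis act_faithful : faithful_action act.
Hypothesis act_triv : forall h s, res (act h s) = res s.
Hypothesis card_pchar : [pchar residue S].-nat #|hT|.
Hypothesis sep : forall x : residue S, exists p : {poly residue S},
  [/\ forall i, p`_i \in fixed_residue act, separable_poly p & root p x].
Hypothesis split : forall x y : T, exists a b c d : T,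
  [/\ x = a * x + b * y, y = c * x + d * y
    & forall r s, r * x + s * y = 0 -> r * a + s * c = 0 /\ r * b + s * d = 0].
Hypothesis comm : commutative (@GRing.mul Tbar).

(** The q-th power of the residue of x is a scalar c, q being the order of the group. If c is
    nonzero the residue is invertible; otherwise it is nilpotent, and a geometric series inverts 1
    minus it. *)
Lemma crossed_res_local (x : T) :
  crossed_norm x \is a GRing.unit \/ crossed_norm (1 - x) \is a GRing.unit.
Proof.
have [|c cE] := com_crossed_frob_scalar comm card_pchar (crossed_res x).
  by move=> g; have := @expg_cardG _ [set: hT]%G _ (finset.in_setT g); rewrite cardsT.
have q_gt0 : (0 < #|hT|)%N by case/andP: card_pchar.
have [c0|c0] := eqVneq c 0; [right|left]; last first.
  apply: (@crossed_norm_res_unit _ _ _ _ _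
    (crossed_res x ^+ #|hT|.-1 * crossed_scalar (bar_cocycle f) c^-1)).
  by rewrite mulrA -exprS prednK // cE -rmorphM mulfV ?rmorph1.
apply: (@crossed_norm_res_unit _ _ _ _ _ (\sum_(i < #|hT|) crossed_res x ^+ i)).
rewrite rmorphB rmorph1 -opprB mulNr -subrX1 cE c0 rmorph0.
by rewrite sub0r opprK.
Qed.

(* For a lift [y] of a nilpotent element, splitting the surjection of [T ^ 2] onto the
   left ideal [T pi + T y] forces one of its two generators to be a multiple of the other;
   [pi = t y] with [t] and [y] nonunits is impossible as both norms are fixed nonunits. *)
Theorem wild_reduced (z : Tbar) n : z ^+ n = 0 -> z = 0.
Proof.
have [y <-] := crossed_res_surj z => {z} yn0.
have [pi piP] := uniformizer_exists S; pose x := crossed_scalar f pi.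
have [pi0 _ _] := piP.
have res_pi : res pi = 0 by apply/(uniformizer_dvd_res piP); exists 1; rewrite mul1r.
have res_mul_x t : crossed_res (t * x) = 0.
  apply/ffunP=> g; rewrite crossed_resE crossed_mul_scalarE crossed_zeroE rmorphM /=.
  by rewrite act_triv res_pi mulr0.
(* The scalar pi normalizes the crossed product: moving it across U_g costs the unit
   [act g pi / pi]. *)
have [y' y'E] : exists y', x * y = y' * x.
  exists ([ffun g => y g / sval (cid2 (ract_uniformizer act piP g))] : {ffun hT -> S}).
  apply/ffunP=> g; rewrite crossed_scalar_mulE crossed_mul_scalarE ffunE.
  by case: cid2 => u Uu uE /=; rewrite uE mulrA divrK // mulrC.
have xI : injective ( *%R x).
  move=> s t /ffunP st; apply/ffunP=> g; have := st g.
  by rewrite !crossed_scalar_mulE => /(mulfI pi0).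
have Ny : crossed_norm y \isn't a GRing.unit.
  apply/negP => /crossed_norm_unit[w wy _].
  have /eqP := congr1 (fun t => crossed_res t ^+ n) wy; rewrite rmorph1 expr1n.
  by rewrite rmorphM (com_crossed_exprMn comm) yn0 mulr0 eq_sym oner_eq0.
have [a [b [c [d [xE yE rel]]]]] := split x y.
(* If [a] is invertible, the relation [- y' * x + x * y = 0] gives [x * c = y' * a], and cancelling
   x exhibits y as a left multiple of x, with residue 0. Otherwise [(1 - a) * x = b * y] can be
   solved for x. *)
have [/crossed_norm_unit[a' _ aa']|/crossed_norm_unit[w w1 _]] := crossed_res_local a.
  have [] := rel (- y') x; first by rewrite mulNr y'E addNr.
  rewrite mulNr addrC => /eqP; rewrite subr_eq0 => /eqP xc _.
  have -> : y = c * a' * x; last exact: res_mul_x.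
  by apply: xI; rewrite /= !mulrA xc -(mulrA y') aa' mulr1.
pose t := w * b; have xt : x = t * y.
  rewrite -[LHS]mul1r -w1 -mulrA mulrBl mul1r [X in X - _]xE.
  by rewrite addrAC subrr add0r mulrA.
case: (boolP (crossed_norm t \is a GRing.unit)) => [/crossed_norm_unit[t' t't _]|Nt].
  by rewrite -[y]mul1r -t't -mulrA -xt res_mul_x.
have dvd_norm (s : T) : crossed_norm s \isn't a GRing.unit -> rdvd (pi ^+ #|hT|) (crossed_norm s).
  move=> Ns; apply: (fixed_nunit_dvd piP act_faithful act_triv card_pchar sep _ Ns) => h.
  exact: crossed_norm_fixed.
have [[u uE] [v vE]] := (dvd_norm _ Nt, dvd_norm _ Ny).
have : crossed_norm x = crossed_norm t * crossed_norm y by rewrite xt crossed_normM.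
rewrite crossed_norm_scalar uE vE.
have [e Ue eE] : exists2 e, e \is a GRing.unit & \prod_g act g pi = e * pi ^+ #|hT|.
  exists (\prod_g sval (cid2 (ract_uniformizer act piP g))).
    by rewrite unitr_prod // => g _; case: cid2.
  rewrite -prodr_const -big_split; apply: eq_bigr => g _.
  by case: cid2.
rewrite eE => eqpi; have q_gt0 : (0 < #|hT|)%N by case/andP: card_pchar.
have dvd_e : rdvd (pi ^+ (#|hT| + #|hT|)) (e * pi ^+ #|hT|).
  by exists (u * v); rewrite eqpi exprD mulrACA.
have := uniformizer_expr_dvd piP Ue dvd_e.
by rewrite -[X in (_ <= X)%N]addn0 leq_add2l leqNgt q_gt0.
Qed.

Corollary wild_unipotent (z : Tbar) n : [pchar residue S].-nat n -> z ^+ n = 1 -> z = 1.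
Proof.
move=> pn zn; apply/eqP; rewrite -subr_eq0; apply/eqP/(@wild_reduced _ n).
exact: (com_crossed_frobB1 comm pn).
Qed.

End WildReduced.

(** * Kummer theory for commutative twisted group algebras *)

Section KummerIdeals.
Variables (gT : finGroupType) (k : fieldType) (act : ringAction gT k).
Variable f : cocycle2 act.
Hypothesis act_triv : forall g x, act g x = x.
Hypothesis comm : commutative (@GRing.mul (crossed f)).
Variable w : gT -> k.
Hypothesis wM : forall g h, w (g * h)%g = w g * w h.
Hypothesis w_neq0 : forall g, w g != 0.
Variable q : nat.
Hypothesis qP : [pchar k].-nat q.
Hypothesis w_ker : forall g, w g = 1 -> (g ^+ q = 1)%g.
Local Notation C := (com_crossed comm).
Hypothesis ker_reduced : forall (x : C) n,
  (forall g, x g != 0 -> w g = 1) -> x ^+ n = 0 -> x = 0.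
Implicit Types (x y z : C) (g h : gT).
Local Notation scalar := (crossed_scalar f : {rmorphism k -> C}).

Let w1 : w 1%g = 1.
Proof. by apply: (mulfI (w_neq0 1%g)); rewrite -wM mulg1 mulr1. Qed.

Let wX g n : w (g ^+ n)%g = w g ^+ n.
Proof. by elim: n => [|n IHn]; rewrite ?w1 // expgS exprS wM IHn. Qed.

Let q_gt0 : (0 < q)%N. Proof. by case/andP: qP. Qed.

Lemma com_crossed_abelian g h : (g * h = h * g)%g.
Proof.
have := comm (crossed_term f 1 g) (crossed_term f 1 h).
rewrite !crossed_termM !act_triv !mul1r => /ffunP/(_ (g * h)%g).
rewrite crossed_term_id crossed_termE; case: eqP => // _ /eqP.
by rewrite (negbTE (cocycle_neq0 f g h)).
Qed.

Definition twist i x : C := [ffun g => w g ^+ i * x g] : {ffun gT -> k}.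

Lemma twistE i x g : twist i x g = w g ^+ i * x g. Proof. by rewrite ffunE. Qed.

Fact twist_zmod_morphism i : zmod_morphism (twist i).
Proof.
move=> x y; apply/ffunP=> g.
by rewrite crossed_addE crossed_oppE !twistE crossed_addE crossed_oppE mulrBr.
Qed.
Fact twist_monoid_morphism i : monoid_morphism (twist i).
Proof.
split=> [|x y]; apply/ffunP=> g; rewrite twistE.
  rewrite crossed_oneE crossed_termE; case: eqP => [->|]; last by rewrite mulr0.
  by rewrite w1 expr1n mul1r.
rewrite !crossed_mulE mulr_sumr; apply: eq_bigr => h _.
rewrite !act_triv !twistE -[in w g](mulKVg h g) wM exprMn -!mulrA; congr (_ * _).
by rewrite mulrCA.
Qed.
HB.instance Definition _ i := GRing.isZmodMorphism.Build C C (twist i) (twist_zmod_morphism i).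
HB.instance Definition _ i := GRing.isMonoidMorphism.Build C C (twist i) (twist_monoid_morphism i).

Lemma twistD i j x : twist i (twist j x) = twist (i + j) x.
Proof. by apply/ffunP=> g; rewrite !twistE exprD mulrA. Qed.

Lemma twist0 x : twist 0 x = x.
Proof. by apply/ffunP=> g; rewrite !twistE expr0 mul1r. Qed.

Lemma twist_mod i x : twist (i %% #|gT|) x = twist i x.
Proof.
apply/ffunP=> g; rewrite !twistE [in RHS](divn_eq i #|gT|) exprD mulnC exprM -(wX g #|gT|).
have -> : (g ^+ #|gT| = 1)%g by have := @expg_cardG _ [set: gT]%G g (finset.in_setT g); rewrite cardsT.
by rewrite w1 expr1n mul1r.
Qed.

(** For x nilpotent and g in its support, [twist 1 x - scalar (w g) * x] is nilpotent with smaller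
    support, hence 0 by induction; so w is constant on the support of x. Multiplying by the inverse
    of U_g moves this support into the kernel of w, where [ker_reduced] applies. *)
Lemma com_crossed_nilpotent x n : x ^+ n = 0 -> x = 0.
Proof.
have [m] := ubnP #|[pred g | x g != 0]|; elim: m x n => // m IHm x n le_x xn.
apply: contrapT => x0.
have [g xg] : exists g, x g != 0.
  apply/existsP; apply: contra_notT x0 => /existsPn x0; apply/ffunP=> g.
  by rewrite crossed_zeroE; apply/eqP; have := x0 g; rewrite negbK.
have constw h : x h != 0 -> w h = w g.
  move=> xh; apply/eqP; rewrite -subr_eq0; apply: contraT => wgh.
  pose y := twist 1 x - scalar (w g) * x.
  have yE l : y l = (w l - w g) * x l.
    by rewrite crossed_addE crossed_oppE twistE crossed_scalar_mulE expr1 mulrBl.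
  have y0 : y = 0.
    apply: (IHm y n.*2); last first.
      have tn : twist 1 x ^+ n = 0 by rewrite -rmorphXn [x ^+ n]xn rmorph0.
      have xwn : (- (scalar (w g) * x)) ^+ n = 0.
        by rewrite -mulNr exprMn [X in _ * X]xn mulr0.
      exact: (com_crossed_nilD comm tn xwn).
    rewrite -ltnS; apply: leq_trans le_x; rewrite ltnS; apply: proper_card; apply/properP; split.
      by apply/fintype.subsetP=> l; rewrite !inE yE; apply: contraNneq => ->; rewrite mulr0.
    by exists g; rewrite !inE // yE subrr mul0r eqxx.
  have /ffunP/(_ h)/eqP := y0.
  by rewrite yE crossed_zeroE mulf_eq0 (negbTE wgh) (negbTE xh).
have [t _ [gt1 tg1]] := crossed_term_inv f g (unitr1 k).
pose y := x * (crossed_term f t g^-1%g : C).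
have : y = 0.
  apply: (@ker_reduced y n); last by rewrite exprMn [X in X * _]xn mul0r.
  move=> h; rewrite crossed_mul_termE invgK => yh.
  have : x (h * g)%g != 0 by apply: contraNneq yh => ->; rewrite !mul0r.
  by move/constw; rewrite wM => /(canRL (mulfK (w_neq0 g))); rewrite mulfV.
move/(congr1 (fun z : C => z * (crossed_term f 1 g : C))).
by rewrite mul0r -mulrA [X in _ * X]tg1 mulr1.
Qed.

Lemma com_crossed_expf_neq0 x n : x != 0 -> x ^+ n != 0.
Proof. by apply: contra_neq; exact: com_crossed_nilpotent. Qed.

(* [x * b] is a nonzero product of conjugates of [x] with as many factors as possible. *)
Lemma twist_orthogonal x : x != 0 -> exists b : C, x * b != 0 /\
  forall j, twist j (x * b) = x * b \/ (x * b) * twist j (x * b) = 0.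
Proof.
move=> x0; have N_gt0 : (0 < #|gT|)%N by apply/card_gt0P; exists 1%g.
pose i0 := Ordinal N_gt0; pose xD (D : {set 'I_#|gT|}) : C := \prod_(i in D) twist i x.
have xD1 : xD (finset.set1 i0) = x by rewrite /xD big_set1 twist0.
pose P (D : {set 'I_#|gT|}) := (i0 \in D) && (xD D != 0).
have P0 : P (finset.set1 i0) by rewrite /P set11 xD1.
case: (@arg_maxnP _ _ P (fun D => #|D|) P0) => D /andP[i0D xD0] Dmax.
have xDM E F : xD E * xD F = xD (E :|: F) * xD (E :&: F).
  rewrite /xD [X in _ * X](big_setID E) /= [in RHS](big_setID E) /=.
  by rewrite finset.setUK finset.setDUl finset.setDv finset.set0U -mulrA [X in _ * X]mulrC finset.setIC.
pose shift (E : {set 'I_#|gT|}) := @ordS _ @: E.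
have xDS E : twist 1 (xD E) = xD (shift E).
  rewrite /xD rmorph_prod big_imset /=; last by move=> i j _ _; exact: ordS_inj.
  by apply: eq_bigr => i _; rewrite twistD add1n twist_mod.
have xDj j : twist j (xD D) = xD (iter j shift D).
  by elim: j => [|j IHj]; rewrite ?twist0 //= -xDS -IHj twistD.
have card_j j : #|iter j shift D| = #|D|.
  by elim: j => //= j IHj; rewrite card_imset ?IHj //; exact: ordS_inj.
have xDb : xD D = x * \prod_(i in D :\ i0) twist i x.
  by rewrite /xD (big_setD1 i0) //= twist0.
exists (\prod_(i in D :\ i0) twist i x); rewrite -xDb; split=> // j.
(* If the product over the union of D and its shift is nonzero, maximality of D forces the shift
   into D, and equal cardinalities make them equal. Keeping 0 in D ensures that all these products
   are multiples of x. *)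
rewrite xDj xDM; have [->|xj0] := eqVneq (xD (D :|: iter j shift D)) 0.
  by right; rewrite mul0r.
left; congr xD; apply/eqP; rewrite eqEcard card_j leqnn andbT.
have /eqP eD : D == D :|: iter j shift D.
  by rewrite eqEcard finset.subsetUl; apply: Dmax; rewrite /P inE i0D.
by move: (finset.subsetUr D (iter j shift D)); rewrite -eD.
Qed.

(** Frobenius is injective on k, so w g = w h, and the exponent q kills the kernel of w. *)
Lemma expq_inj_w g h : w (g ^+ q)%g = w (h ^+ q)%g -> (g ^+ q = h ^+ q)%g.
Proof.
have frobI (a b : k) : a ^+ q = b ^+ q -> a = b.
  move=> ab; apply/eqP; rewrite -subr_eq0 -[_ == 0]andTb -q_gt0 -expf_eq0.
  by rewrite exprDn_pchar // exprNn_pchar // ab subrr.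
rewrite !wX => /frobI wgh; apply/eqP; rewrite eq_mulVg1 -expgVn -expgMn; last first.
  exact: com_crossed_abelian.
apply/eqP; apply: w_ker; rewrite wM -wgh -wM mulVg.
exact: w1.
Qed.

(** On q-th powers w is injective, so a Lagrange polynomial Q equal to 1 at [w g] and to 0 at the
    other values of w on the support writes the term of z at g as a combination of the twists of z,
    with the coefficients of Q. *)
Lemma twist_eigen z g :
  (forall h, z h != 0 -> exists l, h = (l ^+ q)%g) ->
  (forall j, exists c, z * twist j z = scalar c * z ^+ 2) -> z g != 0 ->
  exists c, z * (crossed_term f (z g) g : C) = scalar c * z ^+ 2.
Proof.
move=> zq ztwist zg.
pose Q : {poly k} := \prod_(h | (z h != 0) && (h != g)) ((w g - w h)^-1 *: ('X - (w h)%:P)).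
have Qg : Q.[w g] = 1.
  rewrite horner_prod big1 // => h /andP[zh hg]; rewrite hornerZ hornerXsubC mulVf //.
  have [[l lE] [m mE]] := (zq h zh, zq g zg).
  by rewrite subr_eq0; apply: contra_neq hg; rewrite lE mE => /expq_inj_w.
have Qh h : z h != 0 -> h != g -> Q.[w h] = 0.
  move=> zh hg; rewrite horner_prod (bigD1 h) ?zh ?hg //=.
  by rewrite hornerZ hornerXsubC subrr mulr0 mul0r.
have {1}-> : (crossed_term f (z g) g : C) = \sum_(j < size Q) scalar Q`_j * twist j z.
  apply/ffunP=> h; rewrite crossed_sumE crossed_termE.
  transitivity (Q.[w h] * z h).
    case: eqP => [->|/eqP hg]; first by rewrite Qg mul1r.
    by have [->|zh] := eqVneq (z h) 0; rewrite ?mulr0 // Qh ?mul0r.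
  rewrite horner_coef mulr_suml; apply: eq_bigr => j _.
  by rewrite crossed_scalar_mulE twistE mulrA.
have [c cE] := choice ztwist.
exists (\sum_(j < size Q) Q`_j * c j); rewrite mulr_sumr rmorph_sum mulr_suml.
by apply: eq_bigr => j _; rewrite mulrCA cE rmorphM mulrA.
Qed.

(** Iterating [twist_eigen] gives z t^n = e^n z^(n+1), where t is the term of z at g. When n is the
    order of g, t^n is a scalar c. That d is the explicit power e^n is what later allows t to be
    rescaled. *)
Lemma twist_eigen_exp z g :
  (forall h, z h != 0 -> exists l, h = (l ^+ q)%g) ->
  (forall j, exists c, z * twist j z = scalar c * z ^+ 2) -> z g != 0 ->
  exists c d, [/\ c != 0, d != 0, scalar c * z = scalar d * z ^+ #[g]%g.+1,
    crossed_term f (z g) g ^+ #[g]%g = crossed_scalar f c & exists e, d = e ^+ #[g]%g /\ e != 0].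
Proof.
move=> zq ztwist zg; have [e eE] := twist_eigen zq ztwist zg.
pose t : C := crossed_term f (z g) g.
have ztn n : z * t ^+ n = scalar (e ^+ n) * z ^+ n.+1.
  elim: n => [|n IHn]; first by rewrite !expr0 rmorph1 mul1r mulr1 expr1.
  rewrite exprSr mulrA IHn -mulrA [z ^+ n.+1]exprSr -mulrA eE.
  by rewrite [z ^+ n * _]mulrCA -exprD addn2 mulrA -rmorphM -exprSr.
have Uz : z g \is a GRing.unit by rewrite unitfE.
have [c Uc cE] := crossed_term_exp f g #[g]%g Uz; rewrite expg_order in cE.
have tE : t ^+ #[g]%g = scalar (c * f 1%g 1%g).
  by rewrite /= /crossed_scalar mulfK ?cocycle_neq0 //; exact: cE.
have c0 : c * f 1%g 1%g != 0 by rewrite mulf_neq0 ?cocycle_neq0 // -unitfE.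
have := ztn #[g]%g; rewrite tE mulrC => ctE.
have z0 : z != 0 by apply: contraNneq zg => ->; rewrite crossed_zeroE.
have e0 : e ^+ #[g]%g != 0.
  apply: contra_neq z0 => e0; move: ctE; rewrite e0 rmorph0 mul0r.
  move/(congr1 ( *%R (scalar (c * f 1%g 1%g)^-1))).
  by rewrite mulrA -rmorphM mulVf // rmorph1 mul1r mulr0.
exists (c * f 1%g 1%g), (e ^+ #[g]%g); split=> //.
by exists e; split=> //; move: e0; rewrite expf_eq0 order_gt0.
Qed.

(** [twist_eigen_exp] is used twice. Applied to y = z^q, it gives c y = d y^(m+1), so that e = (d/c)
    y^m is a nonzero idempotent multiple of x. Applied to e, whose powers all equal e, it compares
    scalars directly. *)
Theorem kummer_ideal x : x != 0 -> exists b : C, x * b != 0 /\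
  forall g, (x * b) g != 0 -> (exists h, g = (h ^+ q)%g) /\
    exists2 c, c != 0 & crossed_term f c g ^+ #[g]%g = 1.
Proof.
move=> x0; have [b [z0 ztwist]] := twist_orthogonal x0; set z := x * b in z0 ztwist.
have supp_q (y : C) h : (y ^+ q) h != 0 -> exists l, h = (l ^+ q)%g.
  by move/(com_crossed_frob_supp comm qP) => [l _ ->]; exists l.
have twist_scalar (y : C) : (forall j, twist j y = y \/ y * twist j y = 0) ->
    forall j, exists c, y * twist j y = scalar c * y ^+ 2.
  move=> yP j; have [->|->] := yP j; first by exists 1; rewrite rmorph1 mul1r.
  by exists 0; rewrite rmorph0 mul0r.
have twistX (y : C) n : (0 < n)%N -> (forall j, twist j y = y \/ y * twist j y = 0) ->
    forall j, twist j (y ^+ n) = y ^+ n \/ y ^+ n * twist j (y ^+ n) = 0.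
  move=> n0 yP j; rewrite rmorphXn /= -exprMn; have [->|->] := yP j; [by left|right].
  by rewrite expr0n eqn0Ngt n0.
have zq0 := com_crossed_expf_neq0 q z0; have zqP := twistX _ _ q_gt0 ztwist.
have [g zg] : exists g, (z ^+ q) g != 0.
  apply/existsP; apply: contraNT zq0 => /existsPn zq0; apply/eqP/ffunP=> g.
  by rewrite crossed_zeroE; apply/eqP; have := zq0 g; rewrite negbK.
have [c [d [c0 d0 cdE _ _]]] := twist_eigen_exp (supp_q z) (twist_scalar _ zqP) zg.
pose m := #[g]%g; have m_gt0 : (0 < m)%N by exact: order_gt0.
pose y := z ^+ q; pose e := scalar (d / c) * y ^+ m.
have ye : y * e = y.
  rewrite /e mulrCA -exprS.
  have -> : scalar (d / c) = scalar c^-1 * scalar d by rewrite -rmorphM mulrC.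
  by rewrite -mulrA -cdE mulrA -rmorphM mulVf // rmorph1 mul1r.
have e0 : e != 0 by apply: contra_neq zq0 => e0; rewrite -/y -ye e0 mulr0.
have yme n : (0 < n)%N -> y ^+ n * e = y ^+ n.
  by case: n => // n _; rewrite exprSr -mulrA ye.
have ee : e * e = e by rewrite {1}/e -mulrA yme.
have eX n : (0 < n)%N -> e ^+ n = e.
  by case: n => // n _; elim: n => // n IHn; rewrite exprS IHn.
have eP j : twist j e = e \/ e * twist j e = 0.
  have tw : twist j (scalar (d / c)) = scalar (d / c).
    apply/ffunP=> h; rewrite twistE crossed_scalarE; case: eqP => [->|]; last by rewrite mulr0.
    by rewrite w1 expr1n mul1r.
  rewrite /e (rmorphM (twist j)) /= [X in X * _]tw.
  have [->|e1] := twistX _ _ m_gt0 zqP j; [by left | right].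
  by rewrite mulrACA e1 mulr0.
have supp_e h : e h != 0 -> exists l, h = (l ^+ q)%g.
  by rewrite -(eX q q_gt0); exact: supp_q.
have [b' eE] : exists b', e = x * b'.
  exists (b * (z ^+ (q * m).-1 * scalar (d / c))); rewrite !mulrA -exprS prednK ?muln_gt0 ?q_gt0 //.
  by rewrite mulrC exprM.
exists b'; rewrite -eE; split=> // h eh; split; first exact: supp_e.
have [c' [d' [c'0 d'0 cd' termE [kap [d'E kap0]]]]] := twist_eigen_exp supp_e (twist_scalar _ eP) eh.
(* As e is idempotent, c' e = d' e; hence the power of the term is kap^m with m the order of h, and
   dividing the term by kap makes that power 1. *)
have cd : c' = d'.
  apply/eqP; rewrite -subr_eq0; apply: contraT => cd0; case/eqP: e0.
  have e1 : scalar (c' - d') * e = 0 by rewrite rmorphB mulrBl cd' eX // subrr.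
  have := congr1 ( *%R (scalar (c' - d')^-1)) e1.
  by rewrite mulrA -rmorphM mulVf // rmorph1 mul1r mulr0.
exists (kap^-1 * e h); first by rewrite mulf_neq0 ?invr_eq0.
rewrite -crossed_scalar_term; have exprC n : (scalar kap^-1 * (crossed_term f (e h) h : C)) ^+ n =
  scalar (kap^-1 ^+ n) * (crossed_term f (e h) h : C) ^+ n by rewrite exprMn rmorphXn.
rewrite [LHS]exprC [X in _ * X]termE cd d'E -[crossed_scalar f _]/(scalar _) -rmorphM.
by rewrite exprVn mulVf ?expf_neq0 // rmorph1.
Qed.

End KummerIdeals.

(** * The inertia group *)

Lemma zmod_morphism0 (U V : zmodType) (g : U -> V) : zmod_morphism g -> g 0 = 0.
Proof. by move=> gB; rewrite -(subrr 0) gB subrr. Qed.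

Lemma zmod_morphismD (U V : zmodType) (g : U -> V) : zmod_morphism g ->
  {morph g : x y / x + y}.
Proof.
move=> gB x y; have gN z : g (- z) = - g z.
  by rewrite -[- z]sub0r gB zmod_morphism0 // sub0r.
by rewrite -{1}[y]opprK gB gN opprK.
Qed.

Section SubgroupAction.
Variables (gT : finGroupType) (H : {group gT}).

Section Restriction.
Variables (A : comUnitRingType) (act : ringAction gT A) (f : cocycle2 act).

Fact sub_act1 x : act (sgval (1%g : subg_of H)) x = x.
Proof. exact: ract1. Qed.
Fact sub_actM (g h : subg_of H) x :
  act (sgval (g * h)%g) x = act (sgval g) (act (sgval h) x).
Proof. exact: ractM. Qed.
Definition sub_action : ringAction (subg_of H) A :=
  @RingAction _ A (fun h => act (sgval h)) sub_act1 sub_actM.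

Fact sub_cocycle_unit (g h : subg_of H) : f (sgval g) (sgval h) \is a GRing.unit.
Proof. exact: cocycle_unit. Qed.
Fact sub_cocycleP (g h l : subg_of H) :
  f (sgval g) (sgval h) * f (sgval (g * h)%g) (sgval l) =
  sub_action g (f (sgval h) (sgval l)) * f (sgval g) (sgval (h * l)%g).
Proof. exact: cocycleP. Qed.
Definition sub_cocycle : cocycle2 sub_action := Cocycle2 sub_cocycle_unit sub_cocycleP.

End Restriction.

Lemma sgval_codom g : g \in H -> g \in codom (@sgval gT H).
Proof. by move=> gH; rewrite -(subgK _ gH) codom_f. Qed.

Lemma sgvalX (g : subg_of H) n : sgval (g ^+ n)%g = (sgval g ^+ n)%g.
Proof. by elim: n => [|n IHn] //; rewrite !expgS -IHn. Qed.

Lemma card_subg_of : #|subg_of H| = #|H|.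
Proof.
rewrite -cardsT -(card_imset _ (@subg_inj gT H)); apply: eq_card => g.
apply/imsetP/idP => [[h _ ->]|gH]; first exact: subgP.
by exists (subg H g); rewrite ?inE // subgK.
Qed.

End SubgroupAction.

Section ResidualInertia.
Variables (S : dvrType) (gT : finGroupType) (act : ringAction gT S).
Variable f : cocycle2 act.
Hypothesis act_faithful : faithful_action act.
Hypothesis sepSR : residually_separable act.
Hypothesis T_hereditary : hereditary (crossed f).
Local Notation k := (residue S).
Local Notation bact := (bar_action act).
Local Notation fb := (bar_cocycle f).
Local Notation A := (crossed fb).
Implicit Types (g h : gT) (H : {group gT}).

Definition inertia_set : {set gT} := [set g | `[< forall x, bact g x = x >]]%SET.

Lemma inertiaP g : reflect (forall x, bact g x = x) (g \in inertia_set).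
Proof. by rewrite inE; exact: asboolP. Qed.

Fact inertia_group_set : group_set inertia_set.
Proof.
apply/group_setP; split=> [|g h /inertiaP gI /inertiaP hI]; apply/inertiaP => x.
  exact: ract1.
by rewrite ractM hI gI.
Qed.
Canonical inertia := Group inertia_group_set.

Lemma inertia_normal : (inertia <| [set: gT])%g.
Proof.
apply/normalP; split=> [|g _]; first exact: finset.subsetT.
apply/eqP; rewrite eqEcard cardJg leqnn andbT.
apply/fintype.subsetP=> _ /imsetP[h /inertiaP hI ->]; apply/inertiaP => x.
by rewrite /conjg !ractM hI -ractM mulVg ract1.
Qed.

Lemma inertia_res g s : g \in inertia -> res (act g s) = res s.
Proof. by move=> /inertiaP gI; rewrite -bar_act_res; exact: gI. Qed.

Section WildSubgroup.
Variable H : {group gT}.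
Hypothesis HI : H \subset inertia.
Hypothesis pH : [pchar k].-nat #|H|.
Hypothesis commH : commutative (@GRing.mul (crossed (bar_cocycle (sub_cocycle H f)))).

Let fH := sub_cocycle H f.
Let ext : crossed (bar_cocycle fH) -> A := crossed_ext fb (@sgval gT H).

Let ext_mon : monoid_morphism ext.
Proof. exact: (@crossed_ext_monoid_morphism _ _ _ _ _ _ _ _ (@subg_inj gT H)). Qed.
Let extX z n : ext (z ^+ n) = ext z ^+ n.
Proof.
by elim: n => [|n IHn]; rewrite ?expr0 ?exprS; [exact: ext_mon.1 | rewrite ext_mon.2 IHn].
Qed.
Let ext_inj : injective ext.
Proof. exact/can_inj/(@crossed_extK _ _ _ _ _ _ _ _ (@subg_inj gT H)). Qed.
Let ext0 : ext 0 = 0.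
Proof. exact: zmod_morphism0 (@crossed_ext_zmod_morphism _ _ _ _ _ _ _ _). Qed.

Let supp_ext (x : A) : (forall g, x g != 0 -> g \in H) -> exists z, ext z = x.
Proof.
move=> xH; exists (crossed_restr (bar_cocycle fH) (@sgval gT H) x).
apply: crossed_restrK; first exact: subg_inj.
by move=> g gP; apply: contraNeq gP => /xH; exact: sgval_codom.
Qed.

Let faithfulH : faithful_action (sub_action H act).
Proof. by move=> h hid; apply: subg_inj; apply: act_faithful. Qed.
Let trivH (h : subg_of H) s : res (sub_action H act h s) = res s.
Proof. by apply: inertia_res; apply: (fintype.subsetP HI); exact: subgP. Qed.
Let cardH : [pchar k].-nat #|subg_of H|.
Proof. by rewrite card_subg_of. Qed.
Let sepH (x : k) : exists p : {poly k},
  [/\ forall i, p`_i \in fixed_residue (sub_action H act), separable_poly p & root p x].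
Proof.
have [p [pR sep_p px]] := sepSR x; exists p; split=> // i.
by apply/asboolP; have [r [fr ->]] := pR i; exists r; split=> // h; exact: fr.
Qed.
(** The splitting identities are obtained in the whole crossed product for the extensions by zero of
    x and y. Applying the restriction [E], linear over the subalgebra on each side, brings the four
    coefficients down. *)
Let splitH (x y : crossed fH) : exists a b c d : crossed fH,
  [/\ x = a * x + b * y, y = c * x + d * y
    & forall r s, r * x + s * y = 0 -> r * a + s * c = 0 /\ r * b + s * d = 0].
Proof.
pose E := crossed_restr fH (@sgval gT H) : crossed f -> crossed fH.
pose e := crossed_ext f (@sgval gT H) : crossed fH -> crossed f.
have eK : cancel e E by exact: crossed_extK (@subg_inj gT H).
have ED : {morph E : u v / u + v}.
  by apply/zmod_morphismD; exact: crossed_restr_zmod_morphism.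
have El u t : E (e u * t) = u * E t by exact: crossed_restr_mull.
have Er u t : E (t * e u) = E t * u by exact: crossed_restr_mulr.
have [_ eM] : monoid_morphism e by exact: (@crossed_ext_monoid_morphism _ _ _ _ _ fH f _ (@subg_inj gT H)).
have eB : zmod_morphism e by exact: crossed_ext_zmod_morphism.
have [a [b [c [d [xE yE rel]]]]] := left_hereditary_split (e x) (e y) T_hereditary.1.
exists (E a), (E b), (E c), (E d); split.
- by rewrite -!Er -ED -xE eK.
- by rewrite -!Er -ED -yE eK.
move=> r s rs0; have [|ra sb] := rel (e r) (e s).
  by rewrite -!eM -(zmod_morphismD eB) rs0 (zmod_morphism0 eB).
have E0 : E 0 = 0 by apply/zmod_morphism0; exact: crossed_restr_zmod_morphism.
by rewrite -!El -!ED ra sb E0.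
Qed.

Lemma wild_subgroup_reduced (x : A) n : (forall g, x g != 0 -> g \in H) -> x ^+ n = 0 -> x = 0.
Proof.
move=> /supp_ext[z <-]; rewrite -extX -ext0 => /ext_inj zn.
by rewrite (wild_reduced faithfulH trivH cardH sepH splitH commH zn).
Qed.

Lemma wild_subgroup_unipotent (x : A) n : (forall g, x g != 0 -> g \in H) ->
  [pchar k].-nat n -> x ^+ n = 1 -> x = 1.
Proof.
move=> /supp_ext[z <-] pn; rewrite -extX -ext_mon.1 => /ext_inj zn.
by rewrite (wild_unipotent faithfulH trivH cardH sepH splitH commH pn zn).
Qed.

End WildSubgroup.

End ResidualInertia.

Lemma pchar_expr1 (F : fieldType) n (a : F) : [pchar F].-nat n -> a ^+ n = 1 -> a = 1.
Proof.
move=> pn an; have n_gt0 : (0 < n)%N by case/andP: pn.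
apply/eqP; rewrite -subr_eq0 -[_ == 0]andTb -n_gt0 -expf_eq0.
by rewrite exprDn_pchar // exprNn_pchar // an expr1n subrr.
Qed.

(** * The ramification character and the wild inertia group *)

Section RamificationCharacter.
Variables (S : dvrType) (gT : finGroupType) (act : ringAction gT S).
Hypothesis act_faithful : faithful_action act.
Variable pi : S.
Hypothesis piP : uniformizer pi.
Local Notation k := (residue S).
Local Notation bact := (bar_action act).
Local Notation I := (inertia act).
Implicit Types (g h : gT).

(** Defined on the whole group, where it is only a 1-cocycle with values in the units of k ([ramM]);
    it becomes a character on the inertia group. *)
Definition ram g : k := res (sval (cid2 (ract_uniformizer act piP g))).

Lemma ramE g u : act g pi = u * pi -> ram g = res u.
Proof.
have [pi0 _ _] := piP; move=> uE; rewrite /ram; case: cid2 => v _ vE /=.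
by congr res; apply: (mulIf pi0); rewrite -vE uE.
Qed.

Lemma ramP g : exists2 u, act g pi = u * pi & ram g = res u.
Proof. by have [u _ uE] := ract_uniformizer act piP g; exists u => //; exact: ramE. Qed.

Lemma ramM g h : ram (g * h)%g = bact g (ram h) * ram g.
Proof.
have [[u uE ->] [v vE ->]] := (ramP g, ramP h).
rewrite /= bar_act_res -rmorphM; apply: ramE.
by rewrite ractM vE rmorphM uE mulrA.
Qed.

Lemma ram1 : ram 1%g = 1.
Proof. by rewrite (@ramE _ 1) ?rmorph1 // ract1 mul1r. Qed.

Lemma ram_neq0 g : ram g != 0.
Proof.
apply/eqP => g0; have := ramM g^-1%g g; rewrite mulVg ram1 g0 rmorph0 mul0r.
by move/eqP; rewrite oner_eq0.
Qed.

Lemma ramM_inertia g h : g \in I -> ram (g * h)%g = ram g * ram h.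
Proof. by move/inertiaP => gI; rewrite ramM gI mulrC. Qed.

Lemma ramX_inertia g n : g \in I -> ram (g ^+ n)%g = ram g ^+ n.
Proof.
by move=> gI; elim: n => [|n IHn]; rewrite ?ram1 // expgS exprS ramM_inertia // IHn.
Qed.

(** The cocycle is evaluated on both sides of [g * h = h * g ^ h]. The result says that w is
    invariant under the diagonal action of G, the source of the triviality of the action on
    characters of Gamma. *)
Lemma ramJ g h : g \in I -> bact h (ram (g ^ h)%g) = ram g.
Proof.
move=> gI; apply: (mulIf (ram_neq0 h)).
by rewrite -ramM -conjgC ramM_inertia.
Qed.

Definition wild_set : {set gT} := [set g in I | ram g == 1]%SET.

Lemma wildP g : reflect (g \in I /\ ram g = 1) (g \in wild_set).
Proof.
rewrite [g \in wild_set]finset.in_set; apply: (iffP andP) => -[gI]; first by move/eqP.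
by move=> ->; rewrite gI.
Qed.

Fact wild_group_set : group_set wild_set.
Proof.
apply/group_setP; split=> [|g h /wildP[gI g1] /wildP[hI h1]]; apply/wildP.
  by rewrite group1 ram1.
by rewrite groupM // ramM_inertia // g1 h1 mulr1.
Qed.
Canonical wild := Group wild_group_set.

Lemma wild_sub_inertia : wild \subset I.
Proof. by apply/fintype.subsetP=> g /wildP[]. Qed.

Lemma wild_conj g h : g \in wild -> h \in I -> (g ^ h)%g \in wild.
Proof.
move=> /wildP[gI g1] hI; apply/wildP; rewrite groupJ //; split=> //.
by have := ramJ h gI; rewrite g1; have /inertiaP-> := hI.
Qed.

(** By induction on m, g s - s is divisible by pi^m: g acts trivially on pi^m modulo pi^(m+1), so n
    (g s - s) is congruent to the sum of the g^i (g s - s), i < n, which telescopes to 0; and n is a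
    unit. *)
Lemma wild_order_pchar g : g \in wild -> #[g]%g%:R != 0 :> k -> g = 1%g.
Proof.
move=> /wildP[gI g1] n0; apply: act_faithful => s; set n := #[g]%g in n0.
have [u uE] := ramP g; rewrite g1 => resu.
have unitn : n%:R \is a @GRing.unit S by rewrite -[_ \is a _]negbK -res_eq0 rmorph_nat.
have act_mod m (t : S) : rdvd (pi ^+ m.+1) (act g (t * pi ^+ m) - t * pi ^+ m).
  have [v vE] : rdvd pi (act g t * u ^+ m - t).
    apply/(uniformizer_dvd_res piP); rewrite rmorphB rmorphM rmorphXn /= -resu expr1n mulr1.
    by rewrite inertia_res // subrr.
  by exists v; rewrite rmorphM rmorphXn /= uE exprMn mulrA -mulrBl vE exprS mulrA.
apply/eqP; rewrite -subr_eq0; apply/eqP; apply: (uniformizer_cap piP) => m.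
elim: m => [|m [t tE]]; first by exists (act g s - s); rewrite mulr1.
have iter_mod i : rdvd (pi ^+ m.+1) (act (g ^+ i)%g (t * pi ^+ m) - t * pi ^+ m).
  elim: i => [|i [v vE]]; first by rewrite ract1 subrr; exact: rdvd0.
  have -> : act (g ^+ i.+1)%g (t * pi ^+ m) - t * pi ^+ m =
      act g (v * pi ^+ m.+1) + (act g (t * pi ^+ m) - t * pi ^+ m).
    by rewrite -vE rmorphB expgS ractM addrA subrK.
  apply: rdvdD; last exact: act_mod.
  by rewrite rmorphM rmorphXn /= uE exprMn mulrA; exists (act g v * u ^+ m.+1).
have sum0 : \sum_(i < n) act (g ^+ i)%g (t * pi ^+ m) = 0.
  rewrite -tE; under eq_bigr => i _ do rewrite rmorphB -ractM -expgSr.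
  rewrite sumrB -(big_mkord xpredT (fun i => act (g ^+ i.+1)%g s)).
  rewrite -(big_mkord xpredT (fun i => act (g ^+ i)%g s)) -sumrB.
  by rewrite telescope_sumr // expg_order expg0 subrr.
have [v vE] : rdvd (pi ^+ m.+1) (n%:R * (t * pi ^+ m)).
  have -> : n%:R * (t * pi ^+ m) =
      \sum_(i < n) (-1) * (act (g ^+ i)%g (t * pi ^+ m) - t * pi ^+ m).
    by rewrite -mulr_sumr sumrB sum0 sub0r mulN1r opprK sumr_const card_ord mulr_natl.
  by apply: rdvd_sum => i _; apply: rdvd_mull.
by exists (v / n%:R); rewrite tE mulrAC -vE [RHS]mulrC mulKr.
Qed.

Lemma wild_pchar : [pchar k].-nat #|wild|.
Proof.
apply/pnatP => // p p_pr p_dvd; rewrite !inE p_pr /=; apply/negPn/negP => p0.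
have [g gP gp] := Cauchy p_pr p_dvd.
by have := order1 gT; rewrite -(wild_order_pchar gP) ?gp // => p1; move: p_pr; rewrite p1.
Qed.

(** The character induces an embedding of I / P into the units of the field k; c represents a
    generator of this cyclic quotient. *)
Lemma inertia_wild_cyclic : exists2 c, c \in I &
  forall g, g \in I -> exists2 p, p \in wild & exists i, g = (p * c ^+ i)%g.
Proof.
have nI : (wild <| I)%g.
  rewrite /normal wild_sub_inertia; apply/fintype.subsetP=> h hI; rewrite inE.
  by apply/fintype.subsetP=> _ /imsetP[g gP ->]; exact: wild_conj.
have repr_ram g : g \in I -> ram (repr (coset wild g)) = ram g.
  move=> gI; have /rcosetP[p /wildP[pI p1] ->] : repr (coset wild g) \in (wild :* g)%g.
    rewrite -(val_coset (fintype.subsetP (normal_norm nI) g gI)); exact: mem_repr_coset.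
  by rewrite ramM_inertia // p1 mul1r.
have /cyclicP[C CE] : cyclic (I / wild)%g.
  apply: (@field_mul_group_cyclic _ (I / wild)%G k (fun X => ram (repr X))).
    move=> _ _ /morphimP[g gN gI ->] /morphimP[h hN hI ->].
    by rewrite -morphM // !repr_ram ?groupM // ramM_inertia.
  move=> _ /morphimP[g gN gI ->]; rewrite repr_ram //; split=> [g1|].
    by apply: coset_id; apply/wildP.
  by move/(coset_idr gN)/wildP => [].
have /morphimP[c cN cI cE] : C \in (I / wild)%g by rewrite CE cycle_id.
exists c => // g gI; have gN := fintype.subsetP (normal_norm nI) g gI.
have : coset wild g \in (I / wild)%g by exact: mem_quotient.
rewrite CE => /cycleP[i gE]; exists (g * (c ^+ i)^-1)%g; last by exists i; rewrite mulgKV.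
apply: coset_idr; first by rewrite groupM ?groupV ?groupX.
by rewrite morphM ?groupV ?groupX // morphV ?groupX // morphX //= -cE gE mulgV.
Qed.

End RamificationCharacter.

(** The field computation behind [lamM] in [det_wildJ]; its three product equations are instances of
    the cocycle condition. *)
Lemma conj_cocycle_identity (F : fieldType) (a b c d e m n r s t : F) :
  e != 0 -> s != 0 -> t != 0 -> a * b = c * d -> e * b = m * n -> r * s = t * n ->
  a / e * (m / t) * r = c * (d / s).
Proof.
move=> e0 s0 t0 abcd ebmn rstn.
apply: (mulIf (mulf_neq0 (mulf_neq0 e0 t0) s0)).
have -> : a / e * (m / t) * r * (e * t * s) = a * m * (r * s) by field; rewrite ?e0 ?t0.
have -> : c * (d / s) * (e * t * s) = c * d * e * t by field; rewrite ?s0.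
by rewrite rstn -abcd -[a * b * e]mulrA [b * e]mulrC ebmn; ring.
Qed.

(** Meant for U_a U_b = f(a,b) U_(ab): what commutes with U_a, U_b and the scalars commutes with
    U_(ab). *)
Lemma commute_mul_cancel (R : nzRingType) (s t a b c x : R) :
  t * s = 1 -> s * t = 1 -> a * b = s * c ->
  s * x = x * s -> a * x = x * a -> b * x = x * b -> c * x = x * c.
Proof.
move=> ts st abc sx ax bx; have tx : t * x = x * t.
  by rewrite -[LHS]mulr1 -st mulrA -(mulrA t) -sx mulrA ts mul1r.
have -> : c = t * (a * b) by rewrite abc mulrA ts mul1r.
by rewrite -!mulrA bx (mulrA a) ax !mulrA tx.
Qed.

(** * Commutativity of the twisted group algebra of the inertia group *)

Section InertiaCommutative.
Variables (S : dvrType) (gT : finGroupType) (act : ringAction gT S).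
Variable f : cocycle2 act.
Hypothesis act_faithful : faithful_action act.
Hypothesis sepSR : residually_separable act.
Hypothesis T_hereditary : hereditary (crossed f).
Variable pi : S.
Hypothesis piP : uniformizer pi.
Local Notation k := (residue S).
Local Notation bact := (bar_action act).
Local Notation fb := (bar_cocycle f).
Local Notation A := (crossed fb).
Local Notation I := (inertia act).
Local Notation P := (wild act piP).
Local Notation q := #|P|.
Implicit Types (g h : gT).

Lemma inertia_cocycleP g h l : g \in I ->
  fb g h * fb (g * h)%g l = fb h l * fb g (h * l)%g.
Proof. by move=> /inertiaP gI; rewrite cocycleP gI. Qed.

Lemma subgroup_comm (H : {group gT}) : H \subset I ->
  (forall g h, g \in H -> h \in H -> (g * h = h * g)%g /\ fb g h = fb h g) ->
  commutative (@GRing.mul (crossed (bar_cocycle (sub_cocycle H f)))).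
Proof.
move=> /fintype.subsetP HI cH; apply: crossed_comm => [g x|g h|g h].
- by have /inertiaP := HI _ (subgP g); apply.
- by apply: subg_inj; exact: (cH _ _ (subgP g) (subgP h)).1.
exact: (cH _ _ (subgP g) (subgP h)).2.
Qed.

Lemma cycle_comm z : z \in I ->
  commutative (@GRing.mul (crossed (bar_cocycle (sub_cocycle <[z]>%G f)))).
Proof.
move=> zI; apply: (@crossed_cyclic_comm _ _ _ _ _ (subg <[z]>%G z)) => [g x|g].
  have /inertiaP : sgval g \in I; last by apply.
  by apply: (fintype.subsetP _ _ (subgP g)); rewrite cycle_subG.
have /cycleP[i gE] := subgP g; apply/cycleP; exists i; apply: subg_inj.
by rewrite sgvalX subgK ?cycle_id.
Qed.

(* Up to a sign, [c ^+ q * det_wild g] is the determinant of the left multiplication by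
   [c U_g] on the subalgebra spanned by the [U_x] with [x] in [P]. *)
Definition det_wild g : k := \prod_(x in P) fb g x.

Lemma det_wildM g h : g \in I -> h \in P -> det_wild g * det_wild h = fb g h ^+ q * det_wild (g * h)%g.
Proof.
move=> gI hP; have : \prod_(x in P) (fb g h * fb (g * h)%g x) = \prod_(x in P) (fb h x * fb g (h * x)%g).
  by apply: eq_bigr => x _; exact: inertia_cocycleP.
rewrite !big_split prodr_const => ->; rewrite mulrC; congr (_ * _).
rewrite /det_wild (reindex_inj (mulgI h)).
by apply: eq_bigl => x; rewrite groupMl.
Qed.

Lemma det_wild1 : det_wild 1%g = fb 1%g 1%g ^+ q.
Proof. by rewrite -prodr_const; apply: eq_bigr => x _; exact: cocycle1l. Qed.

Lemma det_wild_neq0 g : det_wild g != 0.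
Proof. by apply/prodf_neq0 => x _; exact: cocycle_neq0. Qed.

(** Conjugation by U_h is an automorphism of k^f P sending U_g to (f(h,g) / f(g',h)) U_g' with g'
    the conjugate of g, and automorphisms preserve determinants. Concretely, the factors [lam x] and
    [lam (g * x)] have the same product over x in P. *)
Lemma det_wildJ g h : g \in P -> h \in I ->
  (fb h g / fb (g ^ h^-1)%g h) ^+ q * det_wild (g ^ h^-1)%g = det_wild g.
Proof.
move=> gP hI; pose lam x := fb h x / fb (x ^ h^-1)%g h.
have memI x : x \in P -> x \in I by case/wildP.
have hJ x : (x ^ h^-1 * h = h * x)%g by rewrite conjgE invgK -!mulgA mulVg mulg1.
have lamM x : x \in P -> lam g * lam x * fb (g ^ h^-1)%g (x ^ h^-1)%g = fb g x * lam (g * x)%g.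
  move=> xP; rewrite /lam conjMg.
  have gI' : (g ^ h^-1)%g \in I by rewrite groupJ ?groupV // memI.
  apply: (@conj_cocycle_identity _ _ (fb (h * g) x)%g _ _ _ _ (fb (g ^ h^-1) (h * x))%g);
    rewrite ?cocycle_neq0 //.
  - exact: inertia_cocycleP.
  - by rewrite -hJ inertia_cocycleP.
  - by rewrite -hJ inertia_cocycleP.
have prod_lam : \prod_(x in P) lam x != 0.
  by apply/prodf_neq0 => x _; rewrite mulf_neq0 ?invr_eq0 ?cocycle_neq0.
apply: (mulIf prod_lam); rewrite mulrAC -prodr_const -(big_split _ _ _ (fun=> lam g)) /=.
have -> : det_wild (g ^ h^-1)%g = \prod_(x in P) fb (g ^ h^-1)%g (x ^ h^-1)%g.
  rewrite /det_wild (reindex_inj (conjg_inj h^-1%g)) /=; apply: eq_bigl => x.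
  apply/idP/idP => [xP|xP]; last by rewrite wild_conj ?groupV.
  by rewrite -(conjgKV h x) wild_conj.
rewrite -big_split /= (eq_bigr (fun x => fb g x * lam (g * x)%g)) => [|x xP]; last exact: lamM.
rewrite big_split /=; congr (_ * _); rewrite [RHS](reindex_inj (mulgI g)) /=.
by apply: eq_bigl => x; rewrite groupMl.
Qed.

(** The commutator of U_h and U_g is y = lam U_z with z in P. By [det_wildJ] its determinant is 1,
    which forces y^q = 1; as y lies in the commutative reduced algebra of the cyclic group of z, y =
    1. *)
Lemma wild_term_comm g h : g \in P -> h \in I ->
  crossed_term fb 1 h * crossed_term fb 1 g = crossed_term fb 1 g * crossed_term fb 1 h.
Proof.
move=> gP hI; have gI : g \in I by case/wildP: gP.
pose g' := (g ^ h^-1)%g; pose z := (g' * g^-1)%g.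
have g'P : g' \in P by rewrite wild_conj ?groupV.
have zP : z \in P by rewrite groupM ?groupV.
have zI : z \in I by case/wildP: zP.
have zg : (z * g = g')%g by rewrite mulgKV.
pose lam := fb h g / fb g' h / fb z g.
pose y : A := crossed_term fb lam z.
have lam_det : lam ^+ q * det_wild z = 1.
  apply: (mulIf (det_wild_neq0 g)); rewrite mul1r -mulrA det_wildM // zg exprMn.
  by rewrite exprVn mulrA divfK ?expf_neq0 ?cocycle_neq0 // det_wildJ.
(* Determinant 1 passes to powers. At n = q the power sits at z^q = 1, and c f(1,1) is a q-th root
   of unity in characteristic p, hence 1. *)
have yX n : exists2 c, y ^+ n = crossed_term fb c (z ^+ n)%g & c ^+ q * det_wild (z ^+ n)%g = 1.
  elim: n => [|n [c yn cdet]].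
    by exists (fb 1%g 1%g)^-1 => //; rewrite det_wild1 -exprMn mulVf ?expr1n ?cocycle_neq0.
  exists (lam * c * fb z (z ^+ n)%g).
    by rewrite exprS yn crossed_termM expgS; have /inertiaP-> := zI.
  rewrite expgS exprMn [(lam * c) ^+ _]exprMn -!mulrA -det_wildM ?groupX // mulrA.
  rewrite mulrACA lam_det cdet.
  exact: mulr1.
have y1 : y = 1.
  have [c yq cdet] := yX q.
  have zq : (z ^+ q = 1)%g by exact: expg_cardG.
  apply: (@wild_subgroup_unipotent _ _ _ f act_faithful sepSR T_hereditary <[z]>%G _ _ _ _ q).
  - by rewrite cycle_subG.
  - by apply: pnat_dvd (wild_pchar act_faithful piP); apply: cardSg; rewrite cycle_subG.
  - exact: cycle_comm.
  - move=> l; rewrite crossed_termE; case: (l =P z) => [-> _|_]; first exact: cycle_id.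
    by rewrite eqxx.
  - exact: wild_pchar.
  rewrite yq zq crossed_oneE; congr crossed_term.
  apply: (mulIf (cocycle_neq0 fb 1%g 1%g)); rewrite mulVf ?cocycle_neq0 //.
  apply: (pchar_expr1 (wild_pchar act_faithful piP)).
  by rewrite exprMn -det_wild1 -zq.
have hg : (h * g = g' * h)%g by rewrite /g' conjgE invgK -!mulgA mulVg mulg1.
have yg : y * crossed_term fb 1 g = crossed_term fb (fb h g / fb g' h) g'.
  rewrite crossed_termM zg; have /inertiaP-> := zI.
  by rewrite mulr1 divfK ?cocycle_neq0.
rewrite -[X in _ = X * _]mul1r -y1 yg !crossed_termM hg rmorph1 !mul1r.
have /inertiaP-> : g' \in I by case/wildP: g'P.
by rewrite mulr1 divfK ?cocycle_neq0.
Qed.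

Lemma scalar_inertia_comm s (x : A) : (forall g, x g != 0 -> g \in I) ->
  crossed_scalar fb s * x = x * crossed_scalar fb s.
Proof.
move=> xI; apply/ffunP=> g; rewrite crossed_scalar_mulE crossed_mul_scalarE.
have [->|/xI/inertiaP->] := eqVneq (x g) 0; first by rewrite mulr0 mul0r.
by rewrite mulrC.
Qed.

(** I is generated by P, whose terms commute with all terms of I, and one further element c;
    commuting with a given term is stable under products. *)
Lemma inertia_term_comm g h : g \in I -> h \in I ->
  crossed_term fb 1 g * crossed_term fb 1 h = crossed_term fb 1 h * crossed_term fb 1 g.
Proof.
pose U l : A := crossed_term fb 1 l; rewrite -/(U g) -/(U h).
have UM a b : a \in I -> U a * U b = crossed_scalar fb (fb a b) * U (a * b)%g.
  by move=> /inertiaP aI; rewrite crossed_termM aI crossed_scalar_term !mul1r mulr1.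
have Us l s : l \in I -> crossed_scalar fb s * U l = U l * crossed_scalar fb s.
  move=> lI; apply: scalar_inertia_comm => j; rewrite crossed_termE.
  by case: (j =P l) => [->//|]; rewrite eqxx.
have mulC a b l : a \in I -> b \in I -> l \in I ->
    U a * U l = U l * U a -> U b * U l = U l * U b -> U (a * b)%g * U l = U l * U (a * b)%g.
  move=> aI bI lI al bl.
  have ff1 : crossed_scalar fb (fb a b)^-1 * crossed_scalar fb (fb a b) = 1.
    by rewrite -rmorphM mulVf ?rmorph1 ?cocycle_neq0.
  have ff2 : crossed_scalar fb (fb a b) * crossed_scalar fb (fb a b)^-1 = 1.
    by rewrite -rmorphM mulfV ?rmorph1 ?cocycle_neq0.
  exact: (@commute_mul_cancel A _ _ _ _ _ _ ff1 ff2 (UM a b aI) (Us l _ lI) al bl).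
have expC c l i : c \in I -> l \in I -> U c * U l = U l * U c ->
    U (c ^+ i)%g * U l = U l * U (c ^+ i)%g.
  move=> cI lI cl; elim: i => [|i IHi]; last by rewrite expgS mulC ?groupX.
  have -> : U (c ^+ 0)%g = crossed_scalar fb (fb 1%g 1%g).
    by rewrite /crossed_scalar mulfV ?cocycle_neq0.
  exact: Us.
have [c cI cP] := inertia_wild_cyclic act piP.
have memI x : x \in P -> x \in I by case/wildP.
have wild_U p l : p \in P -> l \in I -> U p * U l = U l * U p.
  by move=> pP lI; apply: esym; exact: wild_term_comm.
have comm_c a : a \in I -> U a * U c = U c * U a.
  move=> /cP[p pP [i ->]].
  by apply: (mulC _ _ _ (memI _ pP) (groupX i cI) cI (wild_U _ _ pP cI)); exact: expC.
move=> gI hI; have [p pP [i ->]] := cP g gI.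
apply: (mulC _ _ _ (memI _ pP) (groupX i cI) hI (wild_U _ _ pP hI)).
by apply: (expC _ _ _ cI hI); rewrite (comm_c h hI).
Qed.

Lemma inertia_comm g h : g \in I -> h \in I -> (g * h = h * g)%g /\ fb g h = fb h g.
Proof.
move=> gI hI; have := inertia_term_comm gI hI; rewrite !crossed_termM.
have [/inertiaP-> /inertiaP->] := (gI, hI); rewrite !mul1r => e.
have gh : (g * h = h * g)%g.
  have := congr1 (fun x : A => x (g * h)%g) e; rewrite crossed_term_id crossed_termE.
  by case: eqP => // _ /eqP; rewrite (negbTE (cocycle_neq0 fb g h)).
by split=> //; move: e; rewrite gh => /crossed_term_inj.
Qed.

End InertiaCommutative.

(** * The maximal trivializing subgroup *)

Section MaximalTrivialSubgroup.
Variables (S : dvrType) (gT : finGroupType) (act : ringAction gT S).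
Variable f : cocycle2 act.
Hypothesis act_faithful : faithful_action act.
Hypothesis sepSR : residually_separable act.
Hypothesis T_hereditary : hereditary (crossed f).
Variable pi : S.
Hypothesis piP : uniformizer pi.
Local Notation k := (residue S).
Local Notation bact := (bar_action act).
Local Notation fb := (bar_cocycle f).
Local Notation A := (crossed fb).
Local Notation I := (inertia act).
Local Notation P := (wild act piP).
Local Notation q := #|P|.
Local Notation ram := (ram act piP).
Implicit Types (g h : gT).

Let comm_I g h (gI : g \in I) (hI : h \in I) :=
  inertia_comm act_faithful sepSR T_hereditary piP gI hI.
Let qP := wild_pchar act_faithful piP.

Lemma wild_exp1 x N : x \in P -> (x ^+ N = 1)%g -> N%:R != 0 :> k -> x = 1%g.
Proof.
move=> xP xN N0; apply: (wild_order_pchar act_faithful xP).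
have /dvdnP[m NE] : (#[x]%g %| N)%N by rewrite order_dvdn xN.
by apply: contraNneq N0 => x0; rewrite NE natrM x0 mulr0.
Qed.

(** Transfers [kummer_ideal] from k^f I, with w the ramification character and q = |P|, to elements
    of the whole crossed product supported on I. *)
Lemma inertia_kummer (x : A) : x != 0 -> (forall g, x g != 0 -> g \in I) ->
  exists b : A, x * b != 0 /\ forall g, (x * b) g != 0 ->
   [/\ g \in I, exists2 h, h \in I & g = (h ^+ q)%g &
     exists2 c, c != 0 & crossed_term fb c g ^+ #[g]%g = 1].
Proof.
move=> x0 xI; pose fI := sub_cocycle I f.
have commI : commutative (@GRing.mul (crossed (bar_cocycle fI))).
  by apply: subgroup_comm => // g h gI hI; exact: comm_I.
have commP : commutative (@GRing.mul (crossed (bar_cocycle (sub_cocycle P f)))).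
  apply: subgroup_comm; first exact: wild_sub_inertia.
  by move=> g h /wildP[gI _] /wildP[hI _]; exact: comm_I.
pose ext : crossed (bar_cocycle fI) -> A := crossed_ext fb (@sgval gT I).
have [ext1 extM] : monoid_morphism ext.
  exact: (@crossed_ext_monoid_morphism _ _ _ _ _ (bar_cocycle fI) fb _ (@subg_inj gT I)).
have extX z n : ext (z ^+ n) = ext z ^+ n.
  by elim: n => [|n IHn]; rewrite ?expr0 ?exprS ?extM ?IHn.
have ext0 : ext 0 = 0 by exact: zmod_morphism0 (@crossed_ext_zmod_morphism _ _ _ _ _ _ _ _).
have extK : cancel ext (crossed_restr (bar_cocycle fI) (@sgval gT I)).
  exact: crossed_extK (@subg_inj gT I).
have extE z (g : subg_of I) : ext z (sgval g) = z g by exact: crossed_extE (@subg_inj gT I) _ _.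
have extI z g : ext z g != 0 -> exists2 h, g = sgval h & z h != 0.
  case: (boolP (g \in codom (@sgval gT I))) => [/codomP[h ->]|gP].
    by rewrite extE => zh; exists h.
  by rewrite /ext crossed_ext_eq0 ?eqxx.
have [z zE] : exists z, ext z = x.
  exists (crossed_restr (bar_cocycle fI) (@sgval gT I) x).
  apply: crossed_restrK; first exact: subg_inj.
  by move=> g gP; apply: contraNeq gP => /xI; exact: sgval_codom.
have z0 : z != 0 by apply: contra_neq x0 => z0; rewrite -zE z0 ext0.
have sgI (g : subg_of I) : sgval g \in I by exact: subgP.
pose w (g : subg_of I) := ram (sgval g).
have w_triv (g : subg_of I) y : bar_action (sub_action I act) g y = y.
  by have /inertiaP := sgI g; apply.
have wM (g h : subg_of I) : w (g * h)%g = w g * w h by rewrite /w ramM_inertia.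
have w_ker (g : subg_of I) : w g = 1 -> (g ^+ q = 1)%g.
  move=> wg; apply: subg_inj; rewrite sgvalX; apply: expg_cardG.
  by apply/wildP.
have ker_red (y : com_crossed commI) n :
    (forall g : subg_of I, y g != 0 -> w g = 1) -> y ^+ n = 0 -> y = 0.
  move=> yw yn; apply: (can_inj extK); rewrite ext0.
  apply: (wild_subgroup_reduced act_faithful sepSR T_hereditary
    (wild_sub_inertia act piP) qP commP) => [g|].
    by move/extI => [h -> yh]; apply/wildP; rewrite sgI; split=> //; exact: yw.
  by rewrite -extX; transitivity (ext 0); [congr ext; exact: yn | exact: ext0].
have [b [zb0 bP]] := kummer_ideal w_triv wM (fun g : subg_of I => ram_neq0 act piP (sgval g)) qP w_ker ker_red z0.
exists (ext b); rewrite -zE -extM; split.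
  by apply: contra_neq zb0 => e0; apply: (can_inj extK); rewrite e0 ext0.
move=> _ /extI[g -> /bP[[h gE] [c c0 cE]]]; split; first exact: sgI.
  by exists (sgval h); rewrite ?sgI // gE sgvalX.
exists c => //; have order_g : #[sgval g]%g = #[g]%g.
  apply/eqP; rewrite eqn_dvd !order_dvdn -(inj_eq (@subg_inj gT I)) sgvalX expg_order eqxx.
  by rewrite andbT -sgvalX expg_order.
have <- : ext (crossed_term (bar_cocycle fI) c g) = crossed_term fb c (sgval g).
  rewrite /ext /crossed_ext (bigD1 g) //= crossed_term_id big1 ?addr0 // => j jg.
  by rewrite crossed_termE (negbTE jg) crossed_term0.
rewrite order_g -extX -ext1; congr ext; exact: cE.
Qed.

(** For Y = c U_y the condition says that Y^i depends only on y^i, so y^i |-> Y^i is multiplicative;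
    the inverses of the coefficients of the Y^i form the trivializing cochain. *)
Lemma cycle_trivial y c : y \in I -> c != 0 -> crossed_term fb c y ^+ #[y]%g = 1 ->
  cohom_trivial_on fb <[y]>%G.
Proof.
move=> yI c0 Yo; pose Y : A := crossed_term fb c y; have Uc : c \is a GRing.unit by rewrite unitfE.
(* [ix] chooses some exponent of x as a power of y; the default 0 occurs only outside the cyclic
   group. *)
pose ix x := if pselect (exists i, x = (y ^+ i)%g) is left e then sval (cid e) else 0%N.
pose s x := (Y ^+ ix x) x.
have sE n : [/\ Y ^+ n = crossed_term fb (s (y ^+ n)%g) (y ^+ n)%g & s (y ^+ n)%g != 0].
  have -> : s (y ^+ n)%g = (Y ^+ n) (y ^+ n)%g.
    rewrite /s /ix; case: pselect => [e|[]]; last by exists n.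
    case: (cid e) => i /= ei; congr (fun_of_fin _ _).
    have /eqP in_ : (i == n %[mod #[y]%g])%N by rewrite -eq_expg_mod_order ei.
    by rewrite -(expr_mod i Yo) in_ expr_mod.
  have [d Ud dE] := crossed_term_exp fb y n Uc.
  by rewrite /Y dE crossed_term_id; split=> //; rewrite -unitfE.
exists (fun x => (s x)^-1); split.
  by move=> _ /cycleP[n ->]; rewrite unitrV unitfE; have [] := sE n.
move=> _ _ /cycleP[n ->] /cycleP[m ->].
have [[[Yn sn] [Ym sm]] [Ynm snm]] := (sE n, sE m, sE (n + m)%N).
have /inertiaP yn_triv : (y ^+ n)%g \in I by rewrite groupX.
move: Ynm; rewrite exprD Yn Ym crossed_termM yn_triv expgD => /crossed_term_inj <-.
by rewrite yn_triv invrK -invfM mulrA mulVf ?mul1r ?mulf_neq0.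
Qed.

Variable Gamma : {group gT}.
Hypothesis GammaI : Gamma \subset I.
Hypothesis Gamma_max : forall K : {group gT}, K \subset I -> cohom_trivial_on fb K ->
  Gamma \subset K -> K = Gamma.
Variable v : gT -> k.
Hypothesis v_neq0 : forall g, v g != 0.
Hypothesis vM : forall a b, a \in Gamma -> b \in Gamma -> v a * v b * fb a b = v (a * b)%g.

Local Notation V g := (crossed_term fb (v g) g).
Let memI a : a \in Gamma -> a \in I. Proof. exact: (fintype.subsetP GammaI). Qed.

Lemma trivial_termM a b : a \in Gamma -> b \in Gamma -> V a * V b = V (a * b)%g.
Proof.
move=> aG bG; rewrite crossed_termM; have /inertiaP-> := memI aG.
by rewrite vM.
Qed.

Lemma trivial_term1 : V 1%g = 1.
Proof.
rewrite crossed_oneE; congr crossed_term; apply: (mulIf (cocycle_neq0 fb 1%g 1%g)).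
rewrite mulVf ?cocycle_neq0 //; apply: (mulfI (v_neq0 1%g)).
by rewrite mulrA vM // mulg1 mulr1.
Qed.

Lemma trivial_termX a n : a \in Gamma -> V a ^+ n = V (a ^+ n)%g.
Proof.
move=> aG; elim: n => [|n IHn]; first by rewrite trivial_term1.
by rewrite exprS IHn trivial_termM ?groupX // expgS.
Qed.

(** For z of order p in Gamma, V z would satisfy (V z)^p = 1, hence equal 1 by reducedness, although
    it is a nonzero term at z. *)
Lemma trivial_card_neq0 : #|Gamma|%:R != 0 :> k.
Proof.
apply/eqP => d0; have [p pk] := natf0_pchar (cardG_gt0 Gamma) (introT eqP d0).
have p_dvd : (p %| #|Gamma|)%N by rewrite (dvdn_pcharf pk) d0.
have p_pr : prime p by case/andP: pk.
have [z zG zp] := Cauchy p_pr p_dvd.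
have pnat_p : [pchar k].-nat p.
  by apply/pnatP; rewrite ?prime_gt0 // => l l_pr; rewrite dvdn_prime2 // => /eqP->.
have V1 : V z = 1.
  apply: (@wild_subgroup_unipotent _ _ _ f act_faithful sepSR T_hereditary <[z]>%G _ _ _ _ p).
  - by rewrite cycle_subG memI.
  - by rewrite /= -/(#[z])%g zp.
  - by apply: cycle_comm; rewrite memI.
  - move=> l; rewrite crossed_termE; case: (l =P z) => [-> _|_]; first exact: cycle_id.
    by rewrite eqxx.
  - exact: pnat_p.
  by rewrite trivial_termX // -zp expg_order trivial_term1.
have z1 : z = 1%g.
  have := congr1 (fun x : A => x z) V1; rewrite crossed_term_id crossed_oneE crossed_termE.
  by case: eqP => // _ /eqP; rewrite (negbTE (v_neq0 z)).
by move: zp p_pr; rewrite z1 order1 => <-.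
Qed.

(** Being a q-th power rules out p-torsion: an element (h^j)^q of order p has w (h^j) = 1, so h^j is
    in P and its q-th power is 1. Then w is injective on K = Gamma <g>, which is thus cyclic with
    generator a g^i. The product of V a and (c U_g)^i has power 1 in that order, so the cocycle is
    trivial on K, and maximality gives K = Gamma. *)
Lemma mem_trivial_kummer g h c : h \in I -> g = (h ^+ q)%g -> c != 0 ->
  crossed_term fb c g ^+ #[g]%g = 1 -> g \in Gamma.
Proof.
move=> hI gE c0 cE; have gI : g \in I by rewrite gE groupX.
have order_g : #[g]%g%:R != 0 :> k.
  apply/eqP => d0; have [p pk] := natf0_pchar (order_gt0 g) (introT eqP d0).
  have p_dvd : (p %| #[g]%g)%N by rewrite (dvdn_pcharf pk) d0.
  have p_pr : prime p by case/andP: pk.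
  have [z /cycleP[j zE] zp] := Cauchy p_pr p_dvd.
  have pnat_p : [pchar k].-nat p.
    by apply/pnatP; rewrite ?prime_gt0 // => l l_pr; rewrite dvdn_prime2 // => /eqP->.
  have zh : z = ((h ^+ j) ^+ q)%g by rewrite zE gE expgAC.
  have hjI : (h ^+ j)%g \in I by rewrite groupX.
  have z1 : z = 1%g.
    rewrite zh; apply: expg_cardG; apply/wildP; split=> //.
    apply: (pchar_expr1 qP); apply: (pchar_expr1 pnat_p).
    by rewrite -!(ramX_inertia piP) ?groupX // -zh -zp expg_order ram1.
  by move: zp p_pr; rewrite z1 order1 => <-.
pose N := (#|Gamma| * #[g]%g)%N.
have N0 : N%:R != 0 :> k by rewrite natrM mulf_neq0 // trivial_card_neq0.
have gC : <[g]>%g \subset 'C(Gamma)%g.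
  rewrite cycle_subG; apply/centP => a /memI aI; exact: (comm_I gI aI).1.
pose K := (Gamma <*> <[g]>)%G.
have KE x : x \in K -> exists2 a, a \in Gamma & exists i, x = (a * g ^+ i)%g.
  rewrite /K /= cent_joinEr // => /mulsgP[a _ aG /cycleP[i ->] ->].
  by exists a => //; exists i.
have KI : K \subset I by rewrite join_subG GammaI cycle_subG.
have KN x : x \in K -> (x ^+ N = 1)%g.
  move/KE => [a aG [i ->]]; rewrite expgMn; last exact: (comm_I (memI aG) (groupX i gI)).1.
  have -> : (a ^+ N = 1)%g by rewrite /N expgM (expg_cardG aG) expg1n.
  have -> : ((g ^+ i) ^+ N = 1)%g by rewrite expgAC /N mulnC expgM expg_order !expg1n.
  exact: mulg1.
have ram_inj x : x \in K -> ram x = 1 -> x = 1%g.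
  move=> xK x1; apply: (wild_exp1 _ (KN x xK) N0); apply/wildP; split=> //.
  exact: (fintype.subsetP KI).
have /cyclicP[y yE] : cyclic K.
  apply: (@field_mul_group_cyclic _ K k ram) => [a b aK bK|a aK].
    by rewrite ramM_inertia // (fintype.subsetP KI).
  by split=> [|->]; [exact: ram_inj | exact: ram1].
have yK : y \in K by rewrite yE cycle_id.
have yI := fintype.subsetP KI y yK.
have [a aG [i yai]] := KE y yK.
have order_y : #[y]%g = #|K| by rewrite yE.
have Uc : c \is a GRing.unit by rewrite unitfE.
have [ci Uci ciE] := crossed_term_exp fb g i Uc.
have YE : V a * crossed_term fb c g ^+ i = crossed_term fb (v a * ci * fb a (g ^+ i)%g) y.
  by rewrite ciE crossed_termM yai; have /inertiaP-> := memI aG.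
have Yo : (V a * crossed_term fb c g ^+ i) ^+ #[y]%g = 1.
  rewrite exprMn_comm; last first.
    rewrite /GRing.comm ciE !crossed_termM; have giI : (g ^+ i)%g \in I by rewrite groupX.
    have [ag fag] := comm_I (memI aG) giI; rewrite ag fag.
    have [/inertiaP-> /inertiaP->] := (memI aG, giI).
    by rewrite [v a * ci]mulrC.
  rewrite order_y trivial_termX //.
  have -> : (a ^+ #|K| = 1)%g by apply: expg_cardG; apply: (fintype.subsetP (joing_subl _ _)).
  have /dvdnP[m ->] : (#[g]%g %| #|K|)%N.
    by apply: order_dvdG; rewrite -cycle_subG joing_subr.
  by rewrite trivial_term1 mul1r -exprM mulnA mulnC exprM cE expr1n.
rewrite YE in Yo.
have KG : K = Gamma.
  apply: Gamma_max => //; last exact: joing_subl.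
  have -> : K = <[y]>%G by apply: val_inj.
  apply: (cycle_trivial yI _ Yo).
  by rewrite !mulf_neq0 ?cocycle_neq0 // -unitfE.
by rewrite -KG -cycle_subG joing_subr.
Qed.

Lemma ram_trivial_inj : {in Gamma &, injective ram}.
Proof.
move=> a b aG bG ab; apply/eqP; rewrite eq_mulgV1; apply/eqP.
have abG : (a * b^-1)%g \in Gamma by rewrite groupM ?groupV.
apply: (wild_exp1 _ (expg_cardG abG) trivial_card_neq0); apply/wildP.
split; first exact: memI.
apply: (mulIf (ram_neq0 act piP b)); rewrite mul1r -(ramM_inertia piP) ?memI // mulgKV.
exact: ab.
Qed.

Lemma ram_trivial_unity a : a \in Gamma -> ram a ^+ #|Gamma| = 1.
Proof. by move=> aG; rewrite -(ramX_inertia piP) ?memI // expg_cardG // ram1. Qed.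

(** The d values of w on Gamma exhaust the d-th roots of unity of k, so x agrees with some a in
    Gamma up to an element of P killed by d, hence trivial. Gamma is thus the d-torsion of the
    normal subgroup I, whence its normality. *)
Lemma trivial_torsion x : x \in I -> (x ^+ #|Gamma| = 1)%g -> x \in Gamma.
Proof.
move=> xI xd; pose rs := [seq ram a | a <- enum Gamma].
have rs_mem : ram x \in rs.
  rewrite -(@mem_unity_roots _ #|Gamma|) ?cardG_gt0 //.
  - by apply/unity_rootP; rewrite -(ramX_inertia piP) // xd ram1.
  - apply/allP => _ /mapP[a aG ->]; apply/unity_rootP; apply: ram_trivial_unity.
    by rewrite mem_enum in aG.
  - by rewrite map_inj_in_uniq ?enum_uniq // => a b; rewrite !mem_enum; exact: ram_trivial_inj.
  - by rewrite size_map -cardE.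
have /mapP[a] := rs_mem; rewrite mem_enum => aG xa.
have aI := memI aG; have /eqP : (x * a^-1 = 1)%g; last first.
  by rewrite -eq_mulgV1 => /eqP->.
apply: (@wild_exp1 _ #|Gamma|); last exact: trivial_card_neq0.
  apply/wildP; rewrite groupM ?groupV //; split=> //.
  by apply: (mulIf (ram_neq0 act piP a)); rewrite mul1r -(ramM_inertia piP) ?groupM ?groupV // mulgKV.
rewrite expgMn; last by apply: (comm_I xI _).1; rewrite groupV.
by rewrite xd expgVn expg_cardG // invg1 mulg1.
Qed.

Lemma trivial_normal : (Gamma <| [set: gT])%g.
Proof.
rewrite /normal finset.subsetT; apply/fintype.subsetP=> g _; rewrite inE.
apply/fintype.subsetP=> _ /imsetP[a aG ->]; apply: trivial_torsion.
  by rewrite memJ_norm ?memI // (fintype.subsetP (normal_norm (inertia_normal act))) // finset.in_setT.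
by rewrite -conjXg expg_cardG // conj1g.
Qed.

End MaximalTrivialSubgroup.

(** * Idempotents attached to the characters of the trivializing subgroup *)

Section CharacterIdempotents.
Variables (gT : finGroupType) (k : fieldType) (act : ringAction gT k).
Variables (Gamma : {group gT}) (ram : gT -> k) (fbar : cocycle2 act).
Implicit Types (g h a b : gT).
Local Notation d := #|Gamma|.
Hypothesis Gamma_normal : (Gamma <| [set: gT])%g.
Hypothesis act_Gamma : forall a s, a \in Gamma -> act a s = s.
Hypothesis d_neq0 : d%:R != 0 :> k.
Hypothesis ram_neq0 : forall a, ram a != 0.
Hypothesis ramM : forall a b, a \in Gamma -> ram (a * b)%g = ram a * ram b.
Hypothesis ram_inj : {in Gamma &, injective ram}.
Hypothesis ramJ : forall a g, a \in Gamma -> act g (ram (a ^ g)%g) = ram a.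
Hypothesis fbar1 : forall g, fbar g 1%g = 1.
Hypothesis fbar_inv : forall g h a, a \in Gamma -> fbar g h = fbar g (h * a)%g.

Lemma normal_memJ a g : a \in Gamma -> (a ^ g)%g \in Gamma.
Proof.
by move=> aG; rewrite memJ_norm // (fintype.subsetP (normal_norm Gamma_normal)) // finset.in_setT.
Qed.

Lemma ram_one : ram 1%g = 1.
Proof. by apply: (mulfI (ram_neq0 1%g)); rewrite -ramM ?group1 // mulg1 mulr1. Qed.

Lemma ram_exp a n : a \in Gamma -> ram (a ^+ n)%g = ram a ^+ n.
Proof.
by move=> aG; elim: n => [|n IHn]; rewrite ?ram_one // expgS exprS ramM // IHn.
Qed.

Lemma ram_unity a : a \in Gamma -> ram a ^+ d = 1.
Proof. by move=> aG; rewrite -ram_exp // expg_cardG // ram_one. Qed.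

Lemma ram_eq1 a : a \in Gamma -> ram a = 1 -> a = 1%g.
Proof. by move=> aG a1; apply: ram_inj; rewrite ?group1 // a1 ram_one. Qed.

(** w embeds Gamma in the units of k; the value at a generator has order exactly d by
    injectivity. *)
Lemma ram_generator : exists c, [/\ c \in Gamma, (Gamma :=: <[c]>)%g & d.-primitive_root (ram c)].
Proof.
have /cyclicP[c cE] : cyclic Gamma.
  apply: (@field_mul_group_cyclic _ Gamma k ram) => [a b aG bG|a aG]; first exact: ramM.
  by split=> [|->]; [exact: ram_eq1 | exact: ram_one].
have cG : c \in Gamma by rewrite cE cycle_id.
exists c; split=> //.
have [m m_prim m_dvd] := prim_order_exists (cardG_gt0 Gamma) (ram_unity cG).
suff -> : d = m by [].
apply/eqP; rewrite eqn_dvd m_dvd andbT cE -/(#[c])%g order_dvdn; apply/eqP.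
by apply: ram_eq1; rewrite ?groupX // ram_exp // (prim_expr_order m_prim).
Qed.

Lemma ram_char_inj (i j : 'I_d) : (forall a, a \in Gamma -> ram a ^+ i = ram a ^+ j) -> i = j.
Proof.
have [c [cG _ c_prim]] := ram_generator; move/(_ c cG)/eqP.
rewrite (eq_prim_root_expr c_prim) !modn_small // => /eqP ij.
exact: val_inj.
Qed.

Lemma char_ram (chi : gT -> k) : {in Gamma &, forall a b, chi (a * b)%g = chi a * chi b} ->
  (forall a, a \in Gamma -> chi a != 0) ->
  exists i : 'I_d, forall a, a \in Gamma -> chi a = ram a ^+ i.
Proof.
move=> chiM chi0; have [c [cG cE c_prim]] := ram_generator.
have chi1 : chi 1%g = 1.
  by apply: (mulIf (chi0 1%g (group1 _))); rewrite -chiM // mul1g mul1r.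
have chiX n : chi (c ^+ n)%g = chi c ^+ n.
  by elim: n => [|n IHn]; rewrite ?chi1 // expgS exprS chiM ?groupX // IHn.
have [|i ci] := prim_rootP c_prim (x := chi c).
  by rewrite -chiX expg_cardG.
exists i => a; rewrite {1}cE => /cycleP[n ->].
by rewrite chiX ci ram_exp // -!exprM mulnC.
Qed.

Lemma fbar_trivial g a : a \in Gamma -> fbar g a = 1.
Proof. by move=> aG; rewrite -[a]mul1g -fbar_inv. Qed.

(** This is the cocycle condition at (a, b, g), where [b * g = g * b ^ g] and the invariance of
    [fbar] absorbs [b ^ g]. *)
Lemma fbar_charM g a b : a \in Gamma -> b \in Gamma -> fbar (a * b)%g g = fbar a g * fbar b g.
Proof.
move=> aG bG; have := cocycleP fbar a b g; rewrite fbar_trivial // mul1r => ->.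
by rewrite act_Gamma // [(b * g)%g]conjgC -fbar_inv ?normal_memJ // mulrC.
Qed.

Lemma fbar_pi g : exists i : 'I_d, forall a, a \in Gamma -> fbar a g = ram a ^+ i.
Proof.
apply: char_ram => [a b aG bG|a aG]; first exact: fbar_charM.
exact: cocycle_neq0.
Qed.

(** Multiplicativity of pi_f. The action of g on the character of h disappears in [e4], because that
    character is a power of w, which is invariant by [ramJ]. *)
Lemma fbar_piM g h a : a \in Gamma -> fbar a (g * h)%g = fbar a g * fbar a h.
Proof.
move=> aG; have e1 := cocycleP fbar a g h; rewrite act_Gamma // in e1.
have e2 := cocycleP fbar g (a ^ g)%g h; rewrite fbar_trivial ?normal_memJ // mul1r in e2.
have e3 : fbar g (a ^ g * h)%g = fbar g h.
  by rewrite [(a ^ g * h)%g]conjgC -fbar_inv ?normal_memJ.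
have e4 : act g (fbar (a ^ g)%g h) = fbar a h.
  by have [i iE] := fbar_pi h; rewrite !iE ?normal_memJ // rmorphXn /= ramJ.
apply: (mulfI (cocycle_neq0 fbar g h)); rewrite -e1 [(a * g)%g]conjgC e2 e3 e4.
by rewrite [RHS]mulrC mulrA.
Qed.

Lemma fbar_shift (i : 'I_d) g : exists j : 'I_d,
  forall a, a \in Gamma -> ram a ^+ i = ram a ^+ j * fbar a g.
Proof.
have [|a aG|j jE] := @char_ram (fun a => ram a ^+ i / fbar a g).
- by move=> a b aG bG; rewrite ramM // exprMn fbar_charM // invfM mulrACA.
- by rewrite mulf_neq0 ?invr_eq0 ?expf_neq0 ?cocycle_neq0.
by exists j => a aG; rewrite -jE // divfK ?cocycle_neq0.
Qed.

Variable A : nzRingType.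
Variables (V : gT -> A) (scal : {rmorphism k -> A}).
Hypothesis VM : forall g h, V g * V h = scal (fbar g h) * V (g * h)%g.
Hypothesis V1 : V 1%g = 1.
Hypothesis Vscal : forall g s, V g * scal s = scal (act g s) * V g.
Hypothesis V_sum : forall x : A, exists c : gT -> k, x = \sum_g scal (c g) * V g.
Hypothesis V_free : forall c : gT -> k, \sum_g scal (c g) * V g = 0 -> forall g, c g = 0.

Lemma V_triv_conj a g : a \in Gamma -> V a * V g = scal (fbar a g) * (V g * V (a ^ g)%g).
Proof.
by move=> aG; rewrite !VM (fbar_trivial g) ?normal_memJ // rmorph1 mul1r -conjgC.
Qed.

Lemma VM_triv g a : a \in Gamma -> V g * V a = V (g * a)%g.
Proof. by move=> aG; rewrite VM fbar_trivial // rmorph1 mul1r. Qed.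

Lemma V_inv g : exists x, x * V g = 1 /\ V g * x = 1.
Proof.
have scalK s : s != 0 -> scal s^-1 * scal s = 1.
  by move=> s0; rewrite -rmorphM mulVf // rmorph1.
have linv h : exists x, x * V h = 1.
  exists (scal (fbar h^-1%g h)^-1 * V h^-1%g).
  by rewrite -mulrA VM mulVg V1 mulr1 scalK ?cocycle_neq0.
have [x xV] := linv g; exists x; split=> //.
have rinv : V g * (V g^-1%g * scal (fbar g g^-1%g)^-1) = 1.
  rewrite mulrA VM mulgV V1 mulr1 -rmorphM mulfV ?rmorph1 //; exact: cocycle_neq0.
have -> : x = V g^-1%g * scal (fbar g g^-1%g)^-1.
  by rewrite -[LHS]mulr1 -rinv mulrA xV mul1r.
exact: rinv.
Qed.

Definition char_idem i : A := \sum_(a in Gamma) scal (d%:R^-1 * ram a ^- i) * V a.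

Lemma V_mul_idem i b : b \in Gamma -> V b * char_idem i = scal (ram b ^+ i) * char_idem i.
Proof.
move=> bG; rewrite /char_idem !mulr_sumr [RHS](reindex_inj (mulgI b)) /=.
apply: eq_big => [a|a aG]; first by rewrite groupMl.
rewrite mulrA Vscal act_Gamma // -mulrA VM_triv // mulrA -rmorphM; congr (scal _ * _).
rewrite mulrCA; congr (_ * _); rewrite ramM // exprMn invfM mulrA mulfV ?mul1r //.
by rewrite expf_neq0.
Qed.

Lemma char_idem_scal i s : scal s * char_idem i = char_idem i * scal s.
Proof.
rewrite /char_idem mulr_sumr mulr_suml; apply: eq_bigr => a aG.
by rewrite -mulrA Vscal act_Gamma // !mulrA -!rmorphM mulrC.
Qed.

Lemma char_idem_orth (i j : 'I_d) : char_idem i * char_idem j = if i == j then char_idem i else 0.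
Proof.
rewrite {1}/char_idem mulr_suml.
have -> : \sum_(a in Gamma) scal (d%:R^-1 * ram a ^- i) * V a * char_idem j =
    scal (d%:R^-1 * \sum_(a in Gamma) (ram a ^- i * ram a ^+ j)) * char_idem j.
  rewrite mulr_sumr rmorph_sum mulr_suml; apply: eq_bigr => a aG.
  by rewrite -mulrA V_mul_idem // mulrA -rmorphM mulrA.
case: eqP => [->|/eqP ij].
  rewrite (eq_bigr (fun=> 1)) => [|a _]; last by rewrite mulVf // expf_neq0.
  by rewrite sumr_const mulVf // rmorph1 mul1r.
suff -> : \sum_(a in Gamma) (ram a ^- i * ram a ^+ j) = 0 by rewrite mulr0 rmorph0 mul0r.
have [c [cG _ c_prim]] := ram_generator.
set s := \sum_(a in Gamma) _; have : s = ram c ^- i * ram c ^+ j * s.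
  rewrite /s mulr_sumr [LHS](reindex_inj (mulgI c)) /=; apply: eq_big => [a|a aG].
    by rewrite groupMl.
  by rewrite ramM // !exprMn invfM mulrACA.
move/eqP; rewrite -subr_eq0 -{1}[s]mul1r -mulrBl mulf_eq0 => /orP[|/eqP//].
rewrite subr_eq0 => /eqP e; case/eqP: ij; apply: val_inj => /=; apply/eqP.
have := eq_prim_root_expr c_prim i j; rewrite !modn_small // => <-.
by apply/eqP; rewrite -[LHS]mulr1 e mulrA mulfV ?mul1r // expf_neq0.
Qed.

Lemma char_idem_sum : \sum_(i < d) char_idem i = 1.
Proof.
rewrite exchange_big /= (bigD1 1%g) //= [X in _ + X]big1 => [|a /andP[aG a1]].
  rewrite addr0 -mulr_suml V1 mulr1 -rmorph_sum /= (eq_bigr (fun=> d%:R^-1)) => [|i _].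
    by rewrite sumr_const card_ord -(mulr_natl d%:R^-1) mulfV ?rmorph1.
  by rewrite ram_one expr1n invr1 mulr1.
rewrite -mulr_suml -rmorph_sum -mulr_sumr /=.
suff -> : \sum_(i < d) ram a ^- i = 0 by rewrite mulr0 rmorph0 mul0r.
have ra1 : (ram a)^-1 - 1 != 0.
  by rewrite subr_eq0 invr_eq1; apply: contra_neq a1; exact: ram_eq1.
apply: (mulfI ra1); rewrite mulr0 (eq_bigr (fun i : 'I_d => (ram a)^-1 ^+ i)) => [|i _].
  by rewrite -subrX1 exprVn ram_unity // invr1 subrr.
by rewrite exprVn.
Qed.

Lemma char_idem_neq0 i : char_idem i != 0.
Proof.
pose c g := if g \in Gamma then d%:R^-1 * ram g ^- i else 0.
have cE : char_idem i = \sum_g scal (c g) * V g.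
  rewrite /char_idem big_mkcond; apply: eq_bigr => g _; rewrite /c.
  by case: ifP => // _; rewrite rmorph0 mul0r.
apply/eqP => e0; have /eqP := V_free (etrans (esym cE) e0) 1%g.
by rewrite /c group1 ram_one expr1n invr1 mulr1 invr_eq0 (negbTE d_neq0).
Qed.

Lemma char_idem_conj (i j : nat) g : (forall a, a \in Gamma -> ram a ^+ i = ram a ^+ j * fbar a g) ->
  char_idem i * V g = V g * char_idem j.
Proof.
move=> ijg; rewrite mulr_suml mulr_sumr.
rewrite [RHS](reindex_inj (conjg_inj g)) /=; apply: eq_big => [a|a aG].
  by rewrite memJ_norm // (fintype.subsetP (normal_norm Gamma_normal)) // finset.in_setT.
rewrite -mulrA V_triv_conj // mulrA -rmorphM [RHS]mulrA Vscal -[RHS]mulrA; congr (scal _ * _).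
rewrite ijg // rmorphM !fmorphV rmorphXn rmorph_nat /= ramJ //.
by rewrite invfM mulrA divfK // cocycle_neq0.
Qed.

(** The idempotents sum to 1, so some [t * char_idem i] is nonzero; as each V a acts on
    [char_idem i] by a scalar, this product is a nonzero multiple of [char_idem i]. *)
Lemma char_idem_in_ideal (J : set A) (c : gT -> k) : two_sided_ideal J ->
  (forall g, c g != 0 -> g \in Gamma) ->
  let t := \sum_g scal (c g) * V g in J t -> t != 0 -> exists i : 'I_d, J (char_idem i).
Proof.
move=> [_ _ JMl JMr] cG t Jt t0.
have [i ti] : exists i : 'I_d, t * char_idem i != 0.
  apply: contrapT => nt; case/eqP: t0; rewrite -[t]mulr1 -char_idem_sum mulr_sumr.
  by apply: big1 => i _; apply/eqP/negPn/negP => ti; apply: nt; exists i.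
exists i; pose tau := \sum_(a in Gamma) c a * ram a ^+ i.
have tE : t * char_idem i = scal tau * char_idem i.
  rewrite /t mulr_suml rmorph_sum mulr_suml (bigID (mem Gamma)) /= [X in _ + X]big1 ?addr0.
    by apply: eq_bigr => a aG; rewrite -mulrA V_mul_idem // mulrA -rmorphM.
  move=> g gG; have [->|/cG] := eqVneq (c g) 0; last by rewrite (negbTE gG).
  by rewrite rmorph0 !mul0r.
have tau0 : tau != 0 by apply: contraNneq ti => tau0; rewrite tE tau0 rmorph0 mul0r.
have -> : char_idem i = scal tau^-1 * (t * char_idem i).
  by rewrite tE mulrA -rmorphM mulVf // rmorph1 mul1r.
by apply: JMl; apply: JMr.
Qed.

Definition char_rel : rel 'I_d := fun i j =>
  [exists g, [forall a in Gamma, ram a ^+ i == ram a ^+ j * fbar a g]].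

Lemma char_relP (i j : 'I_d) : reflect
  (exists g, forall a, a \in Gamma -> ram a ^+ i = ram a ^+ j * fbar a g) (char_rel i j).
Proof.
apply: (iffP existsP) => -[g gP]; exists g.
  by move=> a aG; apply/eqP; exact: (forall_inP gP).
by apply/forall_inP => a aG; apply/eqP; exact: gP.
Qed.

Lemma char_rel_refl i : char_rel i i.
Proof. by apply/char_relP; exists 1%g => a aG; rewrite fbar1 mulr1. Qed.

Lemma char_rel_sym i j : char_rel i j -> char_rel j i.
Proof.
move/char_relP => [g gP]; apply/char_relP; exists g^-1%g => a aG.
by rewrite gP // -mulrA -fbar_piM // mulgV fbar1 mulr1.
Qed.

Lemma char_rel_trans i j l : char_rel i j -> char_rel j l -> char_rel i l.
Proof.
move=> /char_relP[g gP] /char_relP[h hP]; apply/char_relP; exists (h * g)%g => a aG.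
by rewrite gP // hP // fbar_piM // mulrA.
Qed.

Lemma char_rel_equiv : {in [set: 'I_d]%SET & &, equivalence_rel char_rel}.
Proof.
move=> i j l _ _ _; split=> [|ij]; first exact: char_rel_refl.
by apply/idP/idP; apply: char_rel_trans => //; exact: char_rel_sym.
Qed.

Definition char_orbits : {set {set 'I_d}} := equivalence_partition char_rel [set: 'I_d]%SET.

Lemma char_orbits_partition : finset.partition char_orbits [set: 'I_d]%SET.
Proof. exact: equivalence_partitionP char_rel_equiv. Qed.

Lemma char_orbit_rel O i j : O \in char_orbits -> i \in O -> (j \in O) = char_rel i j.
Proof.
move=> OP iO; rewrite -(pblock_equivalence_partition char_rel_equiv) ?finset.in_setT //.
have [/eqP cov triv _] := and3P char_orbits_partition.
by rewrite -/char_orbits (def_pblock triv OP iO).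
Qed.

Definition orbit_idem (O : {set 'I_d}) : A := \sum_(i in O) char_idem i.

Lemma char_idem_orbit (i : 'I_d) (O : {set 'I_d}) : char_idem i * orbit_idem O = if i \in O then char_idem i else 0.
Proof.
rewrite /orbit_idem mulr_sumr; case: ifP => iO.
  rewrite (bigD1 i) //= char_idem_orth eqxx big1 ?addr0 // => j /andP[_ ji].
  by rewrite char_idem_orth eq_sym (negbTE ji).
rewrite big1 // => j jO; rewrite char_idem_orth; case: eqP => // ij.
by rewrite -ij iO in jO.
Qed.

Lemma orbit_idem_orth O O' : O \in char_orbits -> O' \in char_orbits ->
  orbit_idem O * orbit_idem O' = if O == O' then orbit_idem O else 0.
Proof.
move=> OP O'P; rewrite {1}/orbit_idem mulr_suml.
have -> : \sum_(i in O) char_idem i * orbit_idem O' =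
    \sum_(i in O) if O == O' then char_idem i else 0.
  apply: eq_bigr => i iO; rewrite char_idem_orbit; case: eqP => [<-|ne]; first by rewrite iO.
  case: ifP => // iO'; case: ne; have [_ triv _] := and3P char_orbits_partition.
  by rewrite -(def_pblock triv OP iO) -(def_pblock triv O'P iO').
by case: eqP => // _; rewrite big1.
Qed.

Lemma orbit_idem_sum : \sum_(O in char_orbits) orbit_idem O = 1.
Proof.
rewrite -char_idem_sum -(set_partition_big _ char_orbits_partition) /=.
by apply: eq_bigl => i; rewrite finset.in_setT.
Qed.

Lemma orbit_idem_central O x : O \in char_orbits -> orbit_idem O * x = x * orbit_idem O.
Proof.
move=> OP; have [c ->] := V_sum x; rewrite mulr_sumr mulr_suml; apply: eq_bigr => g _.
have OV : V g * orbit_idem O = orbit_idem O * V g.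
  transitivity (\sum_(i in O) char_idem i * V g); last by rewrite mulr_suml.
  (* The unit is inserted on the left as the sum of all e_i. Each e_i V_g becomes V_g e_j with j in
     the orbit of i, so e_O on the right keeps exactly the i in O. *)
  rewrite -[LHS]mul1r -char_idem_sum mulr_suml [RHS]big_mkcond /=; apply: eq_bigr => i _.
  have [j jP] := fbar_shift i g; rewrite mulrA (char_idem_conj jP) -mulrA char_idem_orbit.
  have ij : char_rel i j by apply/char_relP; exists g.
  have -> : (j \in O) = (i \in O).
    apply/idP/idP => [jO|iO]; last by rewrite (char_orbit_rel j OP iO).
    by rewrite (char_orbit_rel i OP jO) char_rel_sym.
  by case: ifP; rewrite ?mulr0.
rewrite mulrA -[RHS]mulrA OV mulrA; congr (_ * _).
rewrite /orbit_idem mulr_sumr mulr_suml; apply: eq_bigr => i _.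
by rewrite char_idem_scal.
Qed.

Hypothesis idem_in_ideal : forall J : set A, two_sided_ideal J -> forall x, J x -> x != 0 ->
  exists i : 'I_d, J (char_idem i).

Definition orbit_ideal O : set A := fun x => x * orbit_idem O = x.

(** A nonzero ideal inside contains some e_i, necessarily with i in O; conjugating by the invertible
    V g yields e_j for every j in O, hence their sum, which generates the ideal. *)
Lemma orbit_ideal_minimal O : O \in char_orbits -> minimal_two_sided_ideal (orbit_ideal O).
Proof.
move=> OP; have [_ _ O0] := and3P char_orbits_partition.
have [i0 i0O] : exists i, i \in O by apply/set0Pn; apply: contraNneq O0 => <-.
split.
- split=> [|x y xO yO|a x xO|a x xO]; rewrite /orbit_ideal ?mul0r //=.
  + by rewrite mulrDl xO yO.
  + by rewrite -mulrA xO.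
  + by rewrite -mulrA -(orbit_idem_central a OP) mulrA xO.
- move=> e; have := char_idem_neq0 i0; suff : orbit_ideal O (char_idem i0).
    by rewrite e => -> /eqP.
  by rewrite /orbit_ideal char_idem_orbit i0O.
move=> J Jideal JO; have [J0 JD JMl JMr] := Jideal.
have [[x Jx x0]|nx] := pselect (exists2 x, J x & x != 0); last first.
  left; apply/seteqP; split=> [x Jx|x ->//]; apply: contrapT => x0; apply: nx.
  by exists x => //; apply/eqP.
right; have [i Ji] := idem_in_ideal Jideal Jx x0.
have iO : i \in O.
  apply: contraT => iO; have := JO _ Ji; rewrite /orbit_ideal char_idem_orbit (negbTE iO).
  by move/esym/eqP; rewrite (negbTE (char_idem_neq0 i)).
have J1 : J (orbit_idem O).
  apply: big_ind => // j; rewrite (char_orbit_rel j OP iO) => /char_relP[g gP].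
  have [y [yV _]] := V_inv g.
  have -> : char_idem j = y * (char_idem i * V g).
    by rewrite (char_idem_conj gP) mulrA yV mul1r.
  by apply: JMl; apply: JMr.
by apply/seteqP; split=> // z <-; apply: JMl.
Qed.

Theorem orbit_simple_components : has_simple_components A #|char_orbits|.
Proof.
have memO (m : 'I_#|char_orbits|) : enum_val m \in char_orbits by exact: enum_valP.
exists (fun m => orbit_ideal (enum_val m)); split=> [m|a]; first exact: (orbit_ideal_minimal (memO m)).
exists [ffun m => a * orbit_idem (enum_val m)]; split.
  split=> [m|].
    by rewrite ffunE /orbit_ideal -mulrA (orbit_idem_orth (memO m) (memO m)) eqxx.
  rewrite -{1}[a]mulr1 -orbit_idem_sum big_enum_val mulr_sumr.
  by apply: eq_bigr => m _; rewrite ffunE.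
move=> b [bO ->]; apply/ffunP=> m; rewrite ffunE mulr_suml (bigD1 m) //= bO big1 ?addr0 // => l lm.
rewrite -(bO l) -mulrA (orbit_idem_orth (memO l) (memO m)) (inj_eq enum_val_inj) (negbTE lm).
exact: mulr0.
Qed.

Theorem orbit_simple : simple_ring A <-> #|char_orbits| = 1%N.
Proof.
split=> [simA|].
  have [O OP] : exists O, O \in char_orbits.
    apply/set0Pn; apply/eqP => e0; have := orbit_idem_sum; rewrite e0 big_set0 => /eqP.
    by rewrite eq_sym oner_eq0.
  apply/eqP/cards1P; exists O; apply/finset.setP => O'; rewrite finset.in_set1.
  apply/idP/eqP => [O'P|->//]; apply/eqP/negPn/negP => OO'.
  have full Q : Q \in char_orbits -> orbit_idem Q = 1.
    move=> QP; have [idQ Q0 _] := orbit_ideal_minimal QP.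
    have [//|/(congr1 (fun X : set A => X 1))] := simA _ idQ.
    by rewrite /orbit_ideal /= mul1r => ->.
  have := orbit_idem_orth OP O'P; rewrite !full // mulr1 eq_sym (negbTE OO') => /eqP.
  by rewrite oner_eq0.
move=> /eqP/cards1P[O OE] J Jideal; have OP : O \in char_orbits by rewrite OE set11.
have EO : orbit_idem O = 1 by rewrite -orbit_idem_sum OE big_set1.
have [_ _ Omin] := orbit_ideal_minimal OP.
have -> : setT = orbit_ideal O by apply/seteqP; split=> x // _; rewrite /orbit_ideal EO mulr1.
by apply: Omin => // x _; rewrite /orbit_ideal EO mulr1.
Qed.

End CharacterIdempotents.

(** * Ideals of the crossed product meet the algebra of the inertia group *)

Section IdealInertia.
Variables (gT : finGroupType) (k : fieldType) (act : ringAction gT k) (f : cocycle2 act).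

(* An element of the ideal of minimal support, translated so that [1] is in its support,
   commutes with the scalars. *)
Lemma ideal_meets_kernel (J : set (crossed f)) x : two_sided_ideal J -> J x -> x != 0 ->
  exists y, [/\ J y, y != 0 & forall g, y g != 0 -> forall s, act g s = s].
Proof.
move=> [J0 JD JMl JMr]; have [m] := ubnP #|[pred g | x g != 0]|.
elim: m x => // m IHm x le_x Jx x0.
have [g0 xg0] : exists g, x g != 0.
  apply/existsP; apply: contraNT x0 => /existsPn x0; apply/eqP/ffunP=> g.
  by rewrite crossed_zeroE; apply/eqP; have := x0 g; rewrite negbK.
pose y := x * crossed_term f 1 g0^-1%g.
have Jy : J y by exact: JMr.
have yE h : (y h != 0) = (x (h * g0)%g != 0).
  by rewrite crossed_mul_termE invgK rmorph1 mulr1 mulf_eq0 (negbTE (cocycle_neq0 f _ _)) orbF.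
have y1 : y 1%g != 0 by rewrite yE mul1g.
have card_y : #|[pred g | y g != 0]| = #|[pred g | x g != 0]|.
  rewrite -(fintype.card_image (mulIg g0)); apply: eq_card => h; rewrite !inE.
  apply/fintype.imageP/idP => [[l]|xh]; first by rewrite inE yE => xl ->.
  by exists (h * g0^-1)%g; rewrite ?inE ?yE mulgKV.
have [yk|/existsNP[g /not_implyP[yg /existsNP[s sg]]]] :=
  pselect (forall g, y g != 0 -> forall s, act g s = s).
  by exists y; split=> //; apply: contraNneq y1 => ->; rewrite crossed_zeroE.
(* The commutator with s loses the coefficient at 1 and keeps a nonzero one at g, since g moves
   s. *)
pose z := crossed_scalar f s * y - y * crossed_scalar f s.
have zE h : z h = (s - act h s) * y h.
  by rewrite crossed_addE crossed_oppE crossed_scalar_mulE crossed_mul_scalarE mulrBl [y h * _]mulrC.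
have Jz : J z.
  apply: JD; first exact: JMl.
  by rewrite -mulN1r; apply: JMl; apply: JMr.
apply: (IHm z) => //.
  rewrite -ltnS; apply: leq_trans le_x; rewrite ltnS -card_y; apply: proper_card.
  apply/properP; split.
    by apply/fintype.subsetP=> h; rewrite !inE zE; apply: contraNneq => ->; rewrite mulr0.
  by exists 1%g; rewrite !inE // zE ract1 subrr mul0r eqxx.
apply/eqP => /(congr1 (fun x : crossed f => x g))/eqP; rewrite crossed_zeroE zE mulf_eq0 (negbTE yg) orbF.
by rewrite subr_eq0 eq_sym => /eqP.
Qed.

End IdealInertia.

Local Open Scope classical_set_scope.
Local Open Scope card_scope.

Lemma card_finset_II (T : finType) (U : Type) (X : {set T}) (F : T -> U) :
  {in X &, injective F} -> F @` [set` X] #= `I_#|X|.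
Proof.
move=> F_inj; pose G (m : 'I_#|X|) := F (enum_val m).
have -> : F @` [set` X] = G @` setT.
  apply/seteqP; split=> [_ [x xX <-]|_ [m _ <-]]; last by exists (enum_val m); rewrite //= enum_valP.
  by exists (enum_rank_in xX x); rewrite // /G enum_rankK_in.
apply: card_eq_trans (card_esym card_II); apply: inj_card_eq => m l _ _ Gml.
by apply/enum_val_inj/F_inj; rewrite ?enum_valP.
Qed.

(** * Characters of Gamma, the image of pi_f, and its cosets *)

Section CharacterSets.
Variables (gT : finGroupType) (k : fieldType) (act : ringAction gT k).
Variables (Gamma : {group gT}) (ram : gT -> k) (fbar : cocycle2 act).
Local Notation d := #|Gamma|.
Hypothesis Gamma_normal : (Gamma <| [set: gT]%SET)%g.
Hypothesis act_Gamma : forall a s, a \in Gamma -> act a s = s.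
Hypothesis ram_neq0 : forall a, ram a != 0.
Hypothesis ramM : forall a b, a \in Gamma -> ram (a * b)%g = ram a * ram b.
Hypothesis ram_inj : {in Gamma &, injective ram}.
Hypothesis ramJ : forall a g, a \in Gamma -> act g (ram (a ^ g)%g) = ram a.
Hypothesis fbar1 : forall g, fbar g 1%g = 1.
Hypothesis fbar_inv : forall g h a, a \in Gamma -> fbar g h = fbar g (h * a)%g.

Definition ram_char (i : 'I_d) : {ffun subg_of Gamma -> k} := [ffun a => ram (sgval a) ^+ i].

Lemma ram_charE (i : 'I_d) a : ram_char i a = ram (sgval a) ^+ i.
Proof. by rewrite ffunE. Qed.

Lemma ram_char_injective : injective ram_char.
Proof.
move=> i j /ffunP ij; apply: (ram_char_inj ram_neq0 ramM ram_inj) => a aG.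
by have := ij (subg Gamma a); rewrite !ram_charE subgK.
Qed.

Lemma Hom_unitsE : Hom_units Gamma k = ram_char @` [set` [set: 'I_d]%SET].
Proof.
apply/seteqP; split=> [chi [chi0 chiM]|_ [i _ <-]]; last first.
  split=> [a|a b]; rewrite !ram_charE ?expf_neq0 //.
  by rewrite -exprMn -ramM // subgP.
have [a b aG bG|a aG|i iE] := char_ram ram_neq0 ramM ram_inj (chi := fun g => chi (subg Gamma g)).
- by rewrite subgM.
- exact: chi0.
exists i; first by rewrite /= finset.in_setT.
by apply/ffunP=> a; rewrite ram_charE -iE ?subgP // sgvalK.
Qed.

Lemma pi_imageP chi : pi_image Gamma fbar chi <->
  exists g, forall a : subg_of Gamma, chi a = fbar (sgval a) g.
Proof.
split=> [[C _ <-]|[g gE]]; first by exists (repr C) => a; rewrite ffunE.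
have gN : g \in ('N(Gamma))%g by rewrite (fintype.subsetP (normal_norm Gamma_normal)) // finset.in_setT.
exists (coset Gamma g); first by apply: mem_quotient; rewrite finset.in_setT.
apply/ffunP=> a; rewrite ffunE gE.
have /rcosetP[b bG ->] : repr (coset Gamma g) \in (Gamma :* g)%g.
  by rewrite -(val_coset gN); exact: mem_repr_coset.
by rewrite [(b * g)%g]conjgC -fbar_inv // memJ_norm.
Qed.

Definition pi_index : {set 'I_d} :=
  [set i : 'I_d | [exists g, [forall a in Gamma, ram a ^+ i == fbar a g]]]%SET.

Lemma pi_indexP (i : 'I_d) : reflect (exists g, forall a, a \in Gamma -> ram a ^+ i = fbar a g)
  (i \in pi_index).
Proof.
rewrite finset.in_set; apply: (iffP existsP) => -[g gP]; exists g.
  by move=> a aG; apply/eqP; exact: (forall_inP gP).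
by apply/forall_inP => a aG; apply/eqP; exact: gP.
Qed.

Lemma pi_imageE : pi_image Gamma fbar = ram_char @` [set` pi_index].
Proof.
apply/seteqP; split=> [chi /pi_imageP[g gE]|_ [i /pi_indexP[g gE] <-]]; last first.
  by apply/pi_imageP; exists g => a; rewrite ram_charE gE ?subgP.
have [i iE] := fbar_pi Gamma_normal act_Gamma ram_neq0 ramM ram_inj fbar1 fbar_inv g.
exists i; first by apply/pi_indexP; exists g => a aG; rewrite iE.
by apply/ffunP=> a; rewrite ram_charE gE iE ?subgP.
Qed.

Local Notation orbits := (char_orbits Gamma ram fbar).

Lemma char_cosetsE : char_cosets (pi_image Gamma fbar) (Hom_units Gamma k) =
  (fun O : {set 'I_d} => ram_char @` [set` O]) @` [set` orbits].
Proof.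
have orbit_rel := char_orbit_rel Gamma_normal act_Gamma ram_neq0 ramM ram_inj ramJ fbar1 fbar_inv.
have rel_sym := char_rel_sym Gamma_normal act_Gamma ram_neq0 ramM ram_inj ramJ fbar1 fbar_inv.
have cosetE O i : O \in orbits -> i \in O ->
    [set char_mul (ram_char i) psi | psi in pi_image Gamma fbar] = ram_char @` [set` O].
  move=> OP iO; apply/seteqP; split=> [_ [psi /pi_imageP[g gE] <-]|_ [j jO <-]].
    (* The inverse appears because the coset multiplies w^i by pi_f(g), whereas [fbar_shift] divides
       w^i by the value at the chosen element. *)
    have [j jE] := fbar_shift Gamma_normal act_Gamma ram_neq0 ramM ram_inj fbar1 fbar_inv i g^-1%g.
    have piM := fbar_piM Gamma_normal act_Gamma ram_neq0 ramM ram_inj ramJ fbar1 fbar_inv.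
    exists j.
      by rewrite /= (orbit_rel _ _ j OP iO); apply/char_relP; exists g^-1%g.
    apply/ffunP=> a; rewrite [RHS]ffunE !ram_charE gE jE ?subgP // -mulrA -piM ?subgP //.
    by rewrite mulVg fbar1 mulr1.
  have /rel_sym/char_relP[g gP] : char_rel ram fbar i j by rewrite -(orbit_rel _ _ j OP iO).
  exists [ffun a : subg_of Gamma => fbar (sgval a) g].
    by apply/pi_imageP; exists g => a; rewrite ffunE.
  by apply/ffunP=> a; rewrite !ffunE gP ?subgP.
have part := char_orbits_partition Gamma_normal act_Gamma ram_neq0 ramM ram_inj ramJ fbar1 fbar_inv.
rewrite Hom_unitsE; apply/seteqP; split=> [_ [_ [i _ <-] <-]|_ [O OP <-]].
  have [/eqP covT triv _] := and3P part.
  have iC : i \in finset.cover orbits by rewrite covT finset.in_setT.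
  exists (finset.pblock orbits i); first exact: finset.pblock_mem.
  by rewrite -(cosetE _ i) ?finset.mem_pblock // finset.pblock_mem.
have [_ _ O0] := and3P part; have [i iO] : exists i, i \in O.
  by apply/set0Pn; apply: contraNneq O0 => <-.
exists (ram_char i); first by exists i => //=; rewrite finset.in_setT.
exact: cosetE.
Qed.

Lemma card_Hom_units : Hom_units Gamma k #= `I_d.
Proof.
rewrite Hom_unitsE -[X in `I_X]card_ord -cardsT; apply: card_finset_II => i j _ _.
exact: ram_char_injective.
Qed.

Lemma card_pi_image : pi_image Gamma fbar #= `I_#|pi_index|.
Proof. by rewrite pi_imageE; apply: card_finset_II => i j _ _; exact: ram_char_injective. Qed.

Lemma card_char_cosets :
  char_cosets (pi_image Gamma fbar) (Hom_units Gamma k) #= `I_#|orbits|.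
Proof.
rewrite char_cosetsE; apply: card_finset_II => O O' _ _ OO'; apply/finset.setP => i.
have sub (X Y : {set 'I_d}) : ram_char @` [set` X] = ram_char @` [set` Y] -> i \in X -> i \in Y.
  move=> XY iX; have : (ram_char @` [set` Y]) (ram_char i) by rewrite -XY; exists i.
  by move=> [j jY /ram_char_injective <-].
by apply/idP/idP; exact: sub.
Qed.

(** [pi_index] is the orbit of the index 0 of the trivial character, so there is a single orbit
    exactly when it is everything. *)
Lemma card_char_orbits1 : #|orbits| = 1%N <-> #|pi_index| = d.
Proof.
have orbit_rel := char_orbit_rel Gamma_normal act_Gamma ram_neq0 ramM ram_inj ramJ fbar1 fbar_inv.
have part := char_orbits_partition Gamma_normal act_Gamma ram_neq0 ramM ram_inj ramJ fbar1 fbar_inv.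
have rel_sym := char_rel_sym Gamma_normal act_Gamma ram_neq0 ramM ram_inj ramJ fbar1 fbar_inv.
have [/eqP covT triv O0] := and3P part.
pose z : 'I_d := Ordinal (cardG_gt0 Gamma).
have zC : z \in finset.cover orbits by rewrite covT finset.in_setT.
have zO : finset.pblock orbits z \in orbits by exact: finset.pblock_mem.
have indexE i : (i \in pi_index) = (i \in finset.pblock orbits z).
  rewrite (orbit_rel _ z i zO) ?finset.mem_pblock //; apply/pi_indexP/idP => [[g gP]|/rel_sym/char_relP[g gP]].
    by apply: rel_sym; apply/char_relP; exists g => a aG; rewrite gP // expr0 mul1r.
  by exists g => a aG; rewrite gP // expr0 mul1r.
split=> [/eqP/cards1P[O OE]|index_d].
  rewrite -[RHS]card_ord -cardsT; apply: eq_card => i; rewrite indexE finset.in_setT.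
  have iC : i \in finset.cover orbits by rewrite covT finset.in_setT.
  have : finset.pblock orbits i \in orbits by exact: finset.pblock_mem.
  move: zO; rewrite OE !finset.in_set1 => /eqP zOE /eqP iOE.
  by rewrite -OE; rewrite OE zOE -iOE -OE finset.mem_pblock.
have indexT i : i \in pi_index.
  have /eqP -> : pi_index == [set: 'I_d]%SET; last exact: finset.in_setT.
  by rewrite eqEcard cardsT card_ord index_d leqnn andbT; exact: finset.subsetT.
apply/eqP/cards1P; exists (finset.pblock orbits z); apply/finset.setP => O; rewrite finset.in_set1.
apply/idP/eqP => [OP|->//]; have [i iO] : exists i, i \in O.
  by apply/set0Pn; apply: contraNneq O0 => <-.
rewrite -(finset.def_pblock triv OP iO); apply: finset.def_pblock => //.
by rewrite -indexE.
Qed.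

End CharacterSets.

(** * Change of basis to a cohomologous cocycle *)

Section TwistedBasis.
Variables (gT : finGroupType) (k : fieldType) (act : ringAction gT k).
Variables (f fbar : cocycle2 act) (v : gT -> k).
Hypothesis v_neq0 : forall g, v g != 0.
Hypothesis fbarE : forall g h, fbar g h = v g * act g (v h) / v (g * h)%g * f g h.

(** Rescaled terms multiply by the cohomologous cocycle [fbar]: pi_f is read off [fbar] while the
    algebra remains that of [f]. *)
Definition twisted_term g : crossed f := crossed_term f (v g) g.

Lemma twisted_termM g h :
  twisted_term g * twisted_term h = crossed_scalar f (fbar g h) * twisted_term (g * h)%g.
Proof. by rewrite crossed_termM crossed_scalar_term fbarE [in RHS]mulrAC divfK. Qed.

Lemma twisted_term_scalar g s :
  twisted_term g * crossed_scalar f s = crossed_scalar f (act g s) * twisted_term g.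
Proof.
apply/ffunP=> h; rewrite crossed_mul_scalarE crossed_scalar_mulE crossed_termE.
by case: eqP => [->|_]; rewrite ?mulr0 ?mul0r // mulrC.
Qed.

Lemma twisted_term_combE (c : gT -> k) g :
  (\sum_h crossed_scalar f (c h) * twisted_term h) g = c g * v g.
Proof.
rewrite crossed_sumE (bigD1 g) //= crossed_scalar_mulE crossed_term_id big1 ?addr0 // => h hg.
by rewrite crossed_scalar_mulE crossed_termE eq_sym (negbTE hg) mulr0.
Qed.

Lemma twisted_term_span (x : crossed f) :
  x = \sum_g crossed_scalar f (x g / v g) * twisted_term g.
Proof. by apply/ffunP=> g; rewrite twisted_term_combE divfK. Qed.

Lemma twisted_term_free (c : gT -> k) :
  \sum_g crossed_scalar f (c g) * twisted_term g = 0 -> forall g, c g = 0.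
Proof.
move=> /ffunP c0 g; have := c0 g; rewrite twisted_term_combE crossed_zeroE => /eqP.
by rewrite mulf_eq0 (negbTE (v_neq0 g)) orbF => /eqP.
Qed.

End TwistedBasis.

Theorem corollary3p11
  (S : dvrType) (gT : finGroupType) (act : ringAction gT S)
  (act_faithful : faithful_action act)
  (sepSR : residually_separable act)
  (f : cocycle2 act)
  (T_hereditary : hereditary (crossed f))
  (Gamma : {group gT})
  (GammaP : maximal_inertial_trivial (bar_cocycle f) Gamma)
  (fbar : cocycle2 (bar_action act))
  (fbar_cohom : cohomologous (bar_cocycle f) fbar)
  (fbar_norm : normalized fbar)
  (fbar_inv : forall g1 g2 a, a \in Gamma -> fbar g1 g2 = fbar g1 (g2 * a)%g) :
  (exists2 n : nat,
     has_simple_components (crossed (bar_cocycle f)) n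
   & char_cosets (pi_image Gamma fbar) (Hom_units Gamma (residue S)) #= `I_n)
  /\
  (simple_ring (crossed (bar_cocycle f)) <->
     pi_image Gamma fbar #= `I_#|Gamma| /\
     Hom_units Gamma (residue S) #= `I_#|Gamma|).
Proof.
have [[ker_Gamma _] Gamma_max'] := GammaP; have [v [v_unit fbarE]] := fbar_cohom.
have [pi piP] := uniformizer_exists S; set fb := bar_cocycle f in fbarE *.
have v_neq0 g : v g != 0 by rewrite -unitfE.
have fbar1 g : fbar g 1%g = 1 by have [] := fbar_norm g.
have act_Gamma a s : a \in Gamma -> bar_action act a s = s by move=> aG; exact: ker_Gamma.
have GammaI : Gamma \subset inertia act.
  by apply/fintype.subsetP=> a aG; apply/inertiaP => s; exact: act_Gamma.
have Gamma_max (K : {group gT}) : K \subset inertia act -> cohom_trivial_on fb K ->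
    Gamma \subset K -> K = Gamma.
  move=> KI trivK; apply: Gamma_max'; split=> // g gK s.
  by have /inertiaP := fintype.subsetP KI g gK; apply.
(* The normalization and the invariance of [fbar] give fbar(a,b) = 1 for b in Gamma, so the cochain
   v relating the two cocycles also trivializes [fb] on Gamma. *)
have vM a b : a \in Gamma -> b \in Gamma -> v a * v b * fb a b = v (a * b)%g.
  move=> aG bG; have := fbarE a b; rewrite (fbar_trivial fbar1 fbar_inv) // act_Gamma // mulrAC => e.
  by apply: (mulIf (invr_neq0 (v_neq0 (a * b)%g))); rewrite -e mulfV.
have d_neq0 := trivial_card_neq0 act_faithful sepSR T_hereditary GammaI v_neq0 vM.
have Gamma_normal := trivial_normal act_faithful sepSR T_hereditary piP GammaI v_neq0 vM.
have ram_inj : {in Gamma &, injective (ram act piP)}.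
  exact: (ram_trivial_inj act_faithful sepSR T_hereditary GammaI v_neq0 vM).
have ram0 := ram_neq0 act piP.
have memI a : a \in Gamma -> a \in inertia act by exact: (fintype.subsetP GammaI).
have ramM a b : a \in Gamma -> ram act piP (a * b)%g = ram act piP a * ram act piP b.
  by move=> aG; rewrite ramM_inertia ?memI.
have ramJ' a g : a \in Gamma -> bar_action act g (ram act piP (a ^ g)%g) = ram act piP a.
  by move=> aG; rewrite ramJ ?memI.
pose V := twisted_term fb v; pose scal := (crossed_scalar fb : {rmorphism _ -> crossed fb}).
have VM : forall g h, V g * V h = scal (fbar g h) * V (g * h)%g by exact: twisted_termM.
have V1 : V 1%g = 1 by exact: (trivial_term1 v_neq0 vM).
have Vscal : forall g s, V g * scal s = scal (bar_action act g s) * V g.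
  exact: twisted_term_scalar.
have V_sum x : exists c, x = \sum_g scal (c g) * V g.
  by exists (fun g => x g / v g); exact: twisted_term_span.
have V_free : forall c, \sum_g scal (c g) * V g = 0 -> forall g, c g = 0.
  exact: twisted_term_free.
(* The support is pushed into the inertia group, then into Gamma; dividing the coefficients by v
   expresses the result in the basis V, where a character idempotent can be extracted. *)
have idem_in_ideal (J : set (crossed fb)) : two_sided_ideal J -> forall x, J x -> x != 0 ->
    exists i : 'I_#|Gamma|, J (char_idem Gamma (ram act piP) V scal i).
  move=> Jideal x Jx x0; have [J0 JD JMl JMr] := Jideal.
  have [y [Jy y0 yI]] := ideal_meets_kernel Jideal Jx x0.
  have [|b [yb0 ybP]] := inertia_kummer act_faithful sepSR T_hereditary piP y0.
    by move=> g /yI gI; apply/inertiaP.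
  pose t := y * b; have tG g : t g != 0 -> g \in Gamma.
    move=> /ybP[gI [h hI gE] [c c0 cE]].
    exact: (mem_trivial_kummer act_faithful sepSR T_hereditary GammaI Gamma_max v_neq0 vM hI gE c0 cE).
  apply: (char_idem_in_ideal act_Gamma d_neq0 ram0 ramM ram_inj fbar1 fbar_inv VM V1 Vscal
    (c := fun g => t g / v g) Jideal).
  - by move=> g; rewrite mulf_eq0 => /norP[/tG].
  - by rewrite -(twisted_term_span v_neq0); exact: JMr.
  by rewrite -(twisted_term_span v_neq0).
have comps := orbit_simple_components Gamma_normal act_Gamma d_neq0 ram0 ramM ram_inj ramJ'
  fbar1 fbar_inv VM V1 Vscal V_sum V_free idem_in_ideal.
have simple := orbit_simple Gamma_normal act_Gamma d_neq0 ram0 ramM ram_inj ramJ'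
  fbar1 fbar_inv VM V1 Vscal V_sum V_free idem_in_ideal.
split.
  exists #|char_orbits Gamma (ram act piP) fbar|; first exact: comps.
  exact: (card_char_cosets Gamma_normal act_Gamma ram0 ramM ram_inj ramJ' fbar1 fbar_inv).
have orbits1 := card_char_orbits1 Gamma_normal act_Gamma ram0 ramM ram_inj ramJ' fbar1 fbar_inv.
have card_pi := card_pi_image Gamma_normal act_Gamma ram0 ramM ram_inj fbar1 fbar_inv.
rewrite simple orbits1; split=> [pi_d|[pi_d _]].
  split; last exact: card_Hom_units ram0 ramM ram_inj.
  by rewrite -[X in _ #= `I_X]pi_d; exact: card_pi.
by apply/card_eq_II; apply: card_eq_trans pi_d; apply: card_esym.
Qed.
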